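(* Let $(u^*,v^* )\in\mathcal A_1'\times\mathcal A_2'$, $u^*=(\pi^*,\kappa^* )$, be a $u$-regular optimal pair (defined in the context). Then the stochastic processes \[ \begin{aligned} m_1^{u^*}(t):=&\int_0^t\Big(\mu(s,\pi_s^* )-r_s+\frac{\partial\mu}{\partial x}(s,\pi^*_s)\pi^*_s-\sigma^2_s\pi^*_s+\rho\sigma_sb_s\kappa_s^*\Big)ds+\int_0^t\sigma_s\,d^-W_s^1\\ &+\int_0^t\int_{\mathbb{R}_0}\frac{\gamma_1(s,z)}{1+\pi_s^*\gamma_1(s,z)}\tilde N^1(d^-s,dz)-\int_0^t\int_{\mathbb{R}_0}\frac{\pi_s^*\gamma_1^2(s,z)}{1+\pi_s^*\gamma_1(s,z)}G^1(dz)ds,\quad 0\le t\le T, \end{aligned} \] and \[ \begin{aligned} m_2^{u^*}(t):=&\int_0^t\big(\lambda_s-a_s+\rho\sigma_sb_s\pi^*_s-b_s^2\kappa_s^*\big)ds-\int_0^t\rho b_s\,d^-W_s^1-\int_0^t\sqrt{1-\rho^2}\,b_s\,d^-W_s^2\\ &-\int_0^t\int_{\mathbb{R}_0}\frac{\gamma_2(s,z)}{1-\kappa_s^*\gamma_2(s,z)}\tilde N^2(d^-s,dz)-\int_0^t\int_{\mathbb{R}_0}\frac{\kappa_s^*\gamma_2^2(s,z)}{1-\kappa_s^*\gamma_2(s,z)}G^2(dz)ds,\quad 0\le t\le T, \end{aligned} \] are $(\mathcal H_t,Q_{u^*,v^*})$-martingales, where \[ F_{u^*,v^*}(s):=\mathbb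 E\Big[\frac{\varepsilon_T^{v^*}U'(X_T^{u^*})X_T^{u^*}}{\mathbb E(\varepsilon_T^{v^*}U'(X_T^{u^*})X_T^{u^*})}\,\Big|\,\mathcal H_s\Big],\quad s\in[0,T], \] and $Q_{u^*,v^*}$ is the probability measure on $(\Omega,\mathcal F)$, equivalent to $\mathbb P$, defined by $Q_{u^*,v^*}(d\omega):=F_{u^*,v^*}(T)\,\mathbb P(d\omega)$.
   Context: **Probability setting.** $(\Omega,\mathcal F,\{\mathcal F_t\}_{t\ge0},\mathbb P)$ is a filtered probability space; $W^1,W^2$ are independent Brownian motions; $\tilde N^i(dt,dz)=N^i(dt,dz)-G^i(dz)dt$, $i=1,2$, are independent compensated Poisson random measures on $[0,\infty)\times\mathbb R_0$, $\mathbb R_0=\mathbb R\setminus\{0\}$, with Lévy measures $G^i$; $\{\mathcal F_t\}$ is the $\mathbb P$-augmentation of the filtration they generate. $T>0$ is fixed. $\{\mathcal G^1_t\},\{\mathcal G^2_t\},\{\mathcal H_t\}$ ($0\le t\le T$) are filtrations satisfying the usual conditions with $\mathcal F_t\subset\mathcal G^j_t\subset\mathcal H_t$, $j=1,2$. $\hat N^i_{\mathcal H}(dt,dz)$ is the $\mathcal H_t$-compensator (dual predictable projection) of $N^i$. **Forward integrals.** For a measurable process $\varphi$ with $\int_0^T|\varphi_t|dt<\infty$, $\int_0^t\varphi_s\,d^-W^i_s:=\lim_{\varepsilon\to0^+}\varepsilon^{-1}\int_0^t\varphi_s(W^i_{(s+\varepsilon)\wedge t}-W^i_s)ds$; for a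 measurable random field $\zeta$ with $\int_0^T\int_{\mathbb R_0}|\zeta|1_{U_n}G^i(dz)dt<\infty$ for all $n$, $\int_0^t\int_{\mathbb R_0}\zeta(s,z)\tilde N^i(d^-s,dz):=\lim_n\big(\int_0^t\int\zeta1_{U_n}N^i(ds,dz)-\int_0^t\int\zeta1_{U_n}G^i(dz)ds\big)$, where $U_n\subset\mathbb R_0$ are compact, increasing to $\mathbb R_0$, $G^i(U_n)<\infty$. Limits are uniform on $[0,T]$ in probability; the integrand is called forward integrable if the limit exists. **Coefficients.** $\rho\in(-1,0]$ and $X_0>0$ are constants. $r_t,\mu(t,x),\sigma_t,\gamma_1(t,z)$ are càglàd and $\mathcal G^1_t$-adapted (for fixed $x,z$), $\mu(t,\cdot)\in C^1$; $a_t,b_t,\gamma_2(t,z),\lambda_t$ are càglàd and $\mathcal G^2_t$-adapted, $\int_0^T|\lambda_t|dt<\infty$, $\lambda_t>a_t>0$ a.s. For some constant $\epsilon>0$: $\sigma\ge\epsilon$ is forward integrable w.r.t. $W^1$; $b$ is forward integrable w.r.t. $W^1,W^2$; $\ln(1+\gamma_1(t,z))$ and $\gamma_2(t,z)\ge\epsilon$ are continuous in $z$ around zero for a.a. $(t,\omega)$ and forward integrable w.r.t. $\tilde N^1$, $\tilde N^2$ respectively. For each $\mathcal H_t$-adapted càglàd $\pi$ and $k=1,2$: $\int_0^T(|r_t|+|\mu(t,\pi_t)|+|a_t|+\sigma_t^2+b_t^2)dt+\int_0^T\int(|\ln(1+\gamma_1)|^2+|\gamma_1|^k+|\ln(1+\gamma_1)-\gamma_1|)G^1(dz)dt+\int_0^T\int|\gamma_2|^kG^2(dz)dt+\int_0^T\int|\gamma_1|^k\hat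 N^1_{\mathcal H}(dt,dz)+\int_0^T\int|\gamma_2|^k\hat N^2_{\mathcal H}(dt,dz)<\infty$. **Strategies and wealth.** $\mathcal A_1$ is the set of $\mathcal H_t$-adapted càglàd $u=(\pi,\kappa)$ such that: $\sigma\pi$ is forward integrable w.r.t. $W^1$ and $b\kappa$ w.r.t. $W^1,W^2$; for some $\epsilon_\pi,\epsilon_\kappa\in(0,1)$, $\pi_t\gamma_1>-1+\epsilon_\pi$ (a.e. for $dt\times G^1(dz)$ and for $\hat N^1_{\mathcal H}$) and $\kappa_t\gamma_2<1-\epsilon_\kappa$ (a.e. for $dt\times G^2(dz)$ and for $\hat N^2_{\mathcal H}$); $\ln(1+\pi_t\gamma_1(t,z))$, $\ln(1-\kappa_t\gamma_2(t,z))$ are continuous in $z$ around zero for a.a. $(t,\omega)$ and forward integrable w.r.t. $\tilde N^1,\tilde N^2$ respectively; and, for $k=1,2$, $\int_0^T[|\mu(t,\pi_t)-r_t||\pi_t|+|\lambda_t-a_t||\kappa_t|+|\sigma_tb_t\pi_t\kappa_t|+\sigma_t^2\pi_t^2+b_t^2\kappa_t^2]dt<\infty$ and the integrals of $|\ln(1+\pi\gamma_1)|^k+|\pi\gamma_1|^k$ against $G^1(dz)dt$ and $\hat N^1_{\mathcal H}(dt,dz)$, and of $|\ln(1-\kappa\gamma_2)|^k+|\kappa\gamma_2|^k$ against $G^2(dz)dt$ and $\hat N^2_{\mathcal H}(dt,dz)$, over $[0,T]\times\mathbb R_0$ are finite. For $u\in\mathcal A_1$ the wealth is \[ \begin{aligned}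 X^u_t=X_0\exp\Big\{&\int_0^t\big[r_s+(\mu(s,\pi_s)-r_s)\pi_s+(\lambda_s-a_s)\kappa_s-\tfrac12\sigma_s^2\pi_s^2+\rho\sigma_sb_s\pi_s\kappa_s-\tfrac12b_s^2\kappa_s^2\big]ds\\ &+\int_0^t(\sigma_s\pi_s-\rho b_s\kappa_s)d^-W^1_s-\int_0^t\sqrt{1-\rho^2}b_s\kappa_sd^-W^2_s+\int_0^t\!\int\ln(1+\pi_s\gamma_1)\tilde N^1(d^-s,dz)\\ &+\int_0^t\!\int\ln(1-\kappa_s\gamma_2)\tilde N^2(d^-s,dz)+\int_0^t\!\int[\ln(1+\pi_s\gamma_1)-\pi_s\gamma_1]G^1(dz)ds+\int_0^t\!\int[\ln(1-\kappa_s\gamma_2)+\kappa_s\gamma_2]G^2(dz)ds\Big\}. \end{aligned} \] **Priors.** $\mathcal A_2$ is the set of $\mathcal H_t$-adapted càglàd $v=(\theta_1,\theta_2,\theta_3,\theta_4)$ (with $\theta_3,\theta_4>-1$) such that $\theta_1,\theta_2,\theta_3,\theta_4$ are forward integrable w.r.t. $W^1,W^2,\tilde N^1,\tilde N^2$; for $k=1,2$, the expectation of $\int_0^T(\theta_1^2+\theta_2^2)ds$ plus the integrals over $[0,T]\times\mathbb R_0$ of $|\ln(1+\theta_3)|^k+|\theta_3|^k$ against $G^1(dz)ds$ and $\hat N^1_{\mathcal H}$ and of $|\ln(1+\theta_4)|^k+|\theta_4|^k$ against $G^2(dz)ds$ and $\hat N^2_{\mathcal H}$ is finite; and $\int_0^\cdot\theta_1d^-W^1+\int_0^\cdot\theta_2d^-W^2+\int_0^\cdot\int\theta_3\tilde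 N^1(d^-s,dz)+\int_0^\cdot\int\theta_4\tilde N^2(d^-s,dz)$ is an $\mathcal H_t$-special semimartingale whose local martingale part $M^v$ satisfies the Novikov condition ($M^v$ locally square integrable, $\Delta M^v>-1$, $\mathbb E\exp(\frac12\langle M^{v,c}\rangle_T+\langle M^{v,d}\rangle_T)<\infty$, with $c,d$ the continuous and purely discontinuous parts). $\varepsilon^v$ is the Doléans-Dade exponential: $d\varepsilon^v_t=\varepsilon^v_{t-}dM^v_t$, $\varepsilon^v_0=1$; it is an $\mathcal H_t$-martingale, and $d\mathcal Q^v=\varepsilon^v_Td\mathbb P$. **Game.** $U:(0,\infty)\to\mathbb R$ is strictly increasing and concave with strictly decreasing derivative; $g:[0,T]\times\mathbb R^4\times\Omega\to\mathbb R$ is measurable and Fréchet differentiable in $v$. $\mathcal A_1'\subset\mathcal A_1$ is a given subset with $\mathbb E[|U(X^u_T)|^2+|U'(X^u_T)X^u_T|^2]<\infty$ for $u\in\mathcal A_1'$, and $\mathcal A_2'\subset\mathcal A_2$ a given subset with $\mathbb E[|\varepsilon^v_T|^2+\int_0^T|g(s,v_s)|^2ds]<\infty$ for $v\in\mathcal A_2'$. $J(u,v)=\mathbb E[\varepsilon_T^vU(X^u_T)+\int_0^T\varepsilon^v_sg(s,v_s)ds]$. $(u^*,v^* )\in\mathcal A_1'\times\mathcal A_2'$ is optimal if $J(u^*,v^* )=\sup_{u\in\mathcal A_1'}\inf_{v\in\mathcal A_2'}J(u,v)=\inf_{v\in\mathcal A_2'}\sup_{u\in\mathcal A_1'}J(u,v)$.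 **$u$-regular optimal pair.** An optimal pair $(u^*,v^* )$ is $u$-regular if: (a) for every bounded $\alpha\in\mathcal A_1'$ there is $\delta>0$ with $u^*+y\alpha\in\mathcal A_1'$ for $|y|<\delta$, the derivative $\frac{d}{dy}X_T^{u^*+y\alpha}$ exists and may be computed by differentiating under the integrals in the formula for $\ln X_T^{u^*+y\alpha}$, and $\{\varepsilon_T^{v^*}U'(X_T^{u^*+y\alpha})\frac{d}{dy}X_T^{u^*+y\alpha}\}_{|y|<\delta}$ is $\mathbb P$-uniformly integrable; (b) for all $0\le t<t+h\le T$ and $A_1,A_2\in\mathcal H_t$, the process $s\mapsto(1_{A_1}1_{(t,t+h]}(s),1_{A_2}1_{(t,t+h]}(s))$ belongs to $\mathcal A_1'$.
   Formalization: Optimality also requires a saddle point, J(u*,v* )=sup_u J(u,v* )=inf_v J(u*,v), since the displayed sup-inf equalities alone do not suffice; adaptedness of γ1, γ2 is joint measurability in (z,ω), not only for each fixed z. *)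

(* Defs.v *)
From HB Require Import structures.
From mathcomp Require Import all_boot all_order all_algebra.
From mathcomp Require Import all_classical all_reals all_analysis measurable_realfun.

Set Implicit Arguments.
Unset Strict Implicit.
Unset Printing Implicit Defensive.

Import Order.TTheory GRing.Theory Num.Theory.
Import numFieldNormedType.Exports.

Local Open Scope classical_set_scope.
Local Open Scope ring_scope.

(* A process is a map [R -> Om -> R] of which only the values at times in
   [0, T] (in [0, +oo[ for the driving noises) matter; a random field is a map
   [R -> R -> Om -> R] of (time, mark, omega), the mark being in R \ {0}.
   Path regularity holds for every omega; (in)equalities between processes are
   almost sure. *)

Definition R0 (R : realType) : set R := [set z : R | z != 0].
Arguments R0 {R}.

Section processes.
Context {R : realType} {d : measure_display} {Om : measurableType d}.
Implicit Types (P : probability Om R) (H : R -> set (set Om)).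
Implicit Types (S : set (set Om)) (T : R).
Implicit Types (N : Om -> {measure set (R * R) -> \bar R}).
Implicit Types (G : {measure set R -> \bar R}) (Un : nat -> set R).
Implicit Types (X Y M : R -> Om -> R) (f : R -> R) (zeta : R -> R -> Om -> R).

Definition usual_filtration P T H :=
  [/\ forall t, 0 <= t <= T -> sigma_algebra setT (H t) /\ H t `<=` measurable,
      forall s t, 0 <= s -> s <= t -> t <= T -> H s `<=` H t,
      forall t, 0 <= t < T -> \bigcap_(s in `]t, T]%classic) H s `<=` H t
    & forall A, P.-negligible A -> H 0 A].

Definition sub_measurable S (Z : Om -> R) :=
  forall B : set R, measurable B -> S (Z @^-1` B).

Definition adapted T H X := forall t, 0 <= t <= T -> sub_measurable (H t) (X t).

Definition caglad T f :=
  (forall t, 0 < t <= T -> f s @[s --> t^'-] --> f t) /\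
  (forall t, 0 <= t < T -> cvg (f s @[s --> t^'+])).

Definition cadlag T f :=
  (forall t, 0 <= t < T -> f s @[s --> t^'+] --> f t) /\
  (forall t, 0 < t <= T -> cvg (f s @[s --> t^'-])).

Definition caglad_adapted T H X :=
  (forall om, caglad T (X ^~ om)) /\ adapted T H X.

(* The fields are integrated against random measures that depend on omega:
   adaptedness is joint measurability with respect to B(R \ {0}) (x) H_t. *)
Definition caglad_adapted_field T H zeta :=
  (forall z om, z != 0 -> caglad T (fun t => zeta t z om)) /\
  (forall t, 0 <= t <= T -> forall B : set R, measurable B ->
     <<s R0 `*` setT,
         [set C | exists D A, [/\ measurable D, D `<=` R0, H t A & C = D `*` A]] >>
       [set x : R * Om | x.1 != 0 /\ B (zeta t x.1 x.2)]).

Definition measurable_process T X :=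
  measurable_fun (`[0, T]%classic `*` setT) (fun x : R * Om => X x.1 x.2).

Definition measurable_field T zeta :=
  measurable_fun ((`[0, T]%classic `*` R0) `*` setT)
    (fun x : (R * R) * Om => zeta x.1.1 x.1.2 x.2).

(* Convergence to [I], uniform on [0, T] in probability. *)
Definition ucp {J : Type} P T (F : set_system J) (Xs : J -> R -> Om -> R)
    (I : R -> Om -> R) :=
  forall eta e : R, 0 < eta -> 0 < e ->
    \forall j \near F, exists A, [/\ measurable A, (P A < e%:E)%E &
      forall om, ~ A om -> forall t, 0 <= t <= T ->
        `|Xs j t om - I t om| <= eta].

(* [Y] is a version of the conditional expectation of [Z] given [S]. *)
Definition is_cond_exp P S (Z Y : Om -> R) :=
  [/\ P.-integrable setT (EFin \o Z), P.-integrable setT (EFin \o Y),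
      sub_measurable S Y
    & forall A, S A -> (\int[P]_(om in A) (Y om)%:E = \int[P]_(om in A) (Z om)%:E)%E].

Definition martingale P T H X :=
  forall s t, 0 <= s -> s <= t -> t <= T -> is_cond_exp P (H s) (X t) (X s).

Definition uniformly_integrable {J : Type} P (D : set J) (f : J -> Om -> R) :=
  forall e : R, 0 < e -> exists K : R, forall j, D j ->
    (\int[P]_(om in [set om | (K < `|f j om|)%R]) `|f j om|%:E <= e%:E)%E.

Definition indep_systems P (S1 S2 : set (set Om)) :=
  forall A B, S1 A -> S2 B -> (P (A `&` B) = P A * P B)%E.

Definition sigma_gen (X : R -> Om -> R) (D : set R) : set (set Om) :=
  <<s [set A | exists t (B : set R), [/\ D t, measurable B & A = X t @^-1` B]] >>.

Definition brownian P (W : R -> Om -> R) :=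
  [/\ forall t, 0 <= t -> measurable_fun setT (W t),
      {ae P, forall om, W 0 om = 0},
      {ae P, forall om, {within `[0, +oo[, continuous (W ^~ om)}},
      forall s t, 0 <= s -> s < t -> forall B : set R, measurable B ->
        P ((fun om => W t om - W s om) @^-1` B) =
        normal_prob 0 (Num.sqrt (t - s)) B
    & forall s t, 0 <= s -> s < t ->
        indep_systems P (sigma_gen W `[0, s])
          (preimage_set_system setT (fun om => W t om - W s om) measurable)].

Definition half_space : set (R * R) := [set x | 0 <= x.1 /\ x.2 != 0].

Definition levy_measure (G : {measure set R -> \bar R}) :=
  G [set 0] = 0%E /\
  (\int[G]_(z in R0) (Num.min 1 (z ^+ 2))%:E < +oo)%E.

Definition sigma_gen_rm (N : Om -> {measure set (R * R) -> \bar R})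
    (D : set (R * R)) : set (set Om) :=
  <<s [set A | exists (C : set (R * R)) (B : set (\bar R)), [/\ measurable C, C `<=` D, measurable B &
         A = (fun om => N om C) @^-1` B]] >>.

Definition poisson_random_measure P (N : Om -> {measure set (R * R) -> \bar R})
    (G : {sigma_finite_measure set R -> \bar R}) :=
  [/\ {ae P, forall om, forall C, measurable C -> C `<=` half_space ->
        N om C = +oo%E \/ exists n : nat, N om C = n%:R%:E},
      forall C (c : R), measurable C -> C `<=` half_space ->
        (lebesgue_measure \x G)%E C = c%:E -> forall n : nat,
        P [set om | N om C = n%:R%:E] = poisson_prob c 0 [set n],
      forall C, measurable C -> C `<=` half_space ->
        (lebesgue_measure \x G)%E C = +oo%E ->
        {ae P, forall om, N om C = +oo%E}
    & forall n (C : 'I_n -> set (R * R)) (B : 'I_n -> set (\bar R)),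
        (forall i, [/\ measurable (C i), C i `<=` half_space & measurable (B i)]) ->
        trivIset setT C ->
        (P (\bigcap_(i in setT) [set om | B i (N om (C i))]) =
         \prod_(i < n) P [set om | B i (N om (C i))])%E].

Definition predictable_sets T H : set (set (R * Om)) :=
  <<s `[0, T]%classic `*` setT,
      [set C | (exists2 A, H 0 A & C = [set 0] `*` A) \/
               (exists s t A, [/\ 0 <= s, s < t, t <= T, H s A &
                                  C = `]s, t]%classic `*` A])] >>.

Definition predictable {d'} {V : measurableType d'} T H (X : R -> Om -> V) :=
  forall B : set V, measurable B ->
    predictable_sets T H [set x | 0 <= x.1 <= T /\ B (X x.1 x.2)].

Definition predictable_field_sets T H : set (set ((R * R) * Om)) :=
  <<s (`[0, T]%classic `*` R0) `*` setT,
      [set C | exists D B, [/\ predictable_sets T H D, measurable B, B `<=` R0 &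
                 C = [set x | D (x.1.1, x.2) /\ B x.1.2]]] >>.

(* [Nh] is the dual predictable projection of [N]. *)
Definition compensator P T H (N Nh : Om -> {measure set (R * R) -> \bar R}) :=
  forall V : R * R -> Om -> \bar R,
    (forall x om, (0 <= V x om)%E) ->
    (forall B : set (\bar R), measurable B -> predictable_field_sets T H
       [set x | (`[0, T]%classic `*` R0) x.1 /\ B (V x.1 x.2)]) ->
    predictable T H
      (fun t om => \int[Nh om]_(x in `[0%R, t]%classic `*` R0) V x om)%E /\
    (\int[P]_om \int[Nh om]_(x in `[0%R, T]%classic `*` R0) V x om =
     \int[P]_om \int[N om]_(x in `[0%R, T]%classic `*` R0) V x om)%E.

Definition fwdW_approx (W X : R -> Om -> R) (e : R) : R -> Om -> R :=
  fun t om => e^-1 * \int[lebesgue_measure]_(s in `[0, t])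
    (X s om * (W (Num.min (s + e) t) om - W s om)).

Definition fwdW_spec P T W X (I : R -> Om -> R) :=
  ucp P T (0 : R)^'+ (fwdW_approx W X) I.

Definition fwdW_integrable P T W X :=
  [/\ measurable_process T X,
      {ae P, forall om,
        (\int[lebesgue_measure]_(s in `[0%R, T]) `|X s om|%:E < +oo)%E}
    & exists I, fwdW_spec P T W X I].

(* The forward integral, unique up to indistinguishability. *)
Definition fwdW P T W X : R -> Om -> R := get (fwdW_spec P T W X).

Definition fwdN_approx (N : Om -> {measure set (R * R) -> \bar R})
    (G : {measure set R -> \bar R}) (Un : nat -> set R) zeta (n : nat) :
    R -> Om -> R := fun t om =>
  \int[N om]_(x in `[0, t]%classic `*` R0) (zeta x.1 x.2 om * \1_(Un n) x.2)
  - \int[lebesgue_measure]_(s in `[0, t])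
      \int[G]_(z in R0) (zeta s z om * \1_(Un n) z).

Definition fwdN_spec P T N G Un zeta (I : R -> Om -> R) :=
  ucp P T \oo (fwdN_approx N G Un zeta) I.

Definition fwdN_integrable P T N G Un zeta :=
  [/\ measurable_field T zeta,
      forall n, {ae P, forall om,
        (\int[lebesgue_measure]_(s in `[0%R, T])
           \int[G]_(z in R0) (`|zeta s z om| * \1_(Un n) z)%:E < +oo)%E}
    & exists I, fwdN_spec P T N G Un zeta I].

Definition fwdN P T N G Un zeta : R -> Om -> R := get (fwdN_spec P T N G Un zeta).

(* The mark space is R \ {0}, so that "around zero" is a punctured
   neighbourhood of 0. *)
Definition continuous_around_zero P T zeta :=
  {ae (lebesgue_measure \x P)%E, forall x : R * Om, 0 <= x.1 <= T ->
    \forall z \near (0 : R)^', {for z, continuous (fun z => zeta x.1 z x.2)}}.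

Definition stopping_time T H (tau : Om -> R) :=
  (forall om, 0 <= tau om) /\
  forall t, 0 <= t <= T -> H t [set om | tau om <= t].

Definition stopped X (tau : Om -> R) : R -> Om -> R :=
  fun t om => X (Num.min t (tau om)) om.

(* A stopping time at least T does not stop anything on [0, T]. *)
Definition localizing P T H (tau : nat -> Om -> R) :=
  [/\ forall n, stopping_time T H (tau n),
      forall n om, tau n om <= tau n.+1 om
    & {ae P, forall om, exists n, T <= tau n om}].

Definition local_martingale P T H M :=
  [/\ forall om, cadlag T (M ^~ om), adapted T H M
    & exists tau, localizing P T H tau /\
        forall n, martingale P T H (stopped M (tau n))].

Definition locally_square_integrable P T H M :=
  exists tau, localizing P T H tau /\
    forall n, martingale P T H (stopped M (tau n)) /\
      forall t, 0 <= t <= T ->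
        (\int[P]_om ((stopped M (tau n) t om) ^+ 2)%:E < +oo)%E.

Definition indistinguishable P T X Y :=
  {ae P, forall om, forall t, 0 <= t <= T -> X t om = Y t om}.

(* Canonical decomposition of the special semimartingale [Y], null at 0. *)
Definition special_decomposition P T H Y M (A : R -> Om -> R) :=
  [/\ local_martingale P T H M /\ (forall om, M 0 om = 0),
      predictable T H A /\ (forall om, A 0 om = 0),
      forall om, cadlag T (A ^~ om),
      {ae P, forall om, bounded_variation 0 T (A ^~ om)}
    & indistinguishable P T Y (fun t om => M t om + A t om)].

Definition continuous_local_martingale P T H M :=
  local_martingale P T H M /\
  forall om, {within `[0, T], continuous (M ^~ om)}.

Definition purely_discontinuous P T H M :=
  [/\ local_martingale P T H M, forall om, M 0 om = 0
    & forall L, continuous_local_martingale P T H L ->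
        local_martingale P T H (fun t om => M t om * L t om)].

Definition angle_bracket P T H M (C : R -> Om -> R) :=
  [/\ predictable T H C,
      forall om, [/\ cadlag T (C ^~ om), C 0 om = 0 &
        forall s t, 0 <= s -> s <= t -> t <= T -> C s om <= C t om]
    & local_martingale P T H (fun t om => (M t om) ^+ 2 - C t om)].

Definition jump X t om : R := X t om - lim (X s om @[s --> t^'-]).

Definition novikov P T H M :=
  [/\ locally_square_integrable P T H M,
      {ae P, forall om, forall t, 0 < t <= T -> -1 < jump M t om}
    & exists Mc Md C D,
        [/\ continuous_local_martingale P T H Mc, purely_discontinuous P T H Md,
            indistinguishable P T M (fun t om => Mc t om + Md t om),
            angle_bracket P T H Mc C /\ angle_bracket P T H Md D
          & (\int[P]_om (expR (2^-1 * C T om + D T om))%:E < +oo)%E]].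

Definition riemann_sum X M (s : seq R) : R -> Om -> R := fun t om =>
  \sum_(i < size s) X (nth 0 (0 :: s) i) om *
    (M (Num.min (nth 0 s i) t) om - M (Num.min (nth 0 (0 :: s) i) t) om).

(* [I] is the stochastic integral \int_0^. X_{s-} dM_s of the left limits of a
   cadlag adapted [X]: the limit of the sums along any partitions of [0, T]
   whose mesh goes to 0. *)
Definition left_stochastic_integral P T X M I :=
  forall s : nat -> seq R,
    (forall n, itv_partition 0 T (s n)) ->
    (forall e : R, 0 < e -> \forall n \near \oo, forall i, (i < size (s n))%N ->
       nth 0 (s n) i - nth 0 (0 :: s n) i < e) ->
    ucp P T \oo (fun n => riemann_sum X M (s n)) I.

(* d E_t = E_{t-} dM_t, E_0 = 1 *)
Definition doleans_dade P T H M (E : R -> Om -> R) :=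
  [/\ forall om, cadlag T (E ^~ om), adapted T H E
    & left_stochastic_integral P T E M (fun t om => E t om - 1)].

End processes.

Record market (R : realType) (d : measure_display) (Om : measurableType d) := Market {
  pr : probability Om R;
  horizon : R;
  W1 : R -> Om -> R;
  W2 : R -> Om -> R;
  N1 : R.-ker Om ~> (R * R)%type;
  N2 : R.-ker Om ~> (R * R)%type;
  G1 : {sigma_finite_measure set R -> \bar R};
  G2 : {sigma_finite_measure set R -> \bar R};
  exhaust : nat -> set R;
  filG1 : R -> set (set Om);
  filG2 : R -> set (set Om);
  filH : R -> set (set Om);
  Nh1 : R.-ker Om ~> (R * R)%type;
  Nh2 : R.-ker Om ~> (R * R)%type;
  rho : R;
  X0 : R;
  r_ : R -> Om -> R;
  mu_ : R -> R -> Om -> R;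
  sigma_ : R -> Om -> R;
  gamma1 : R -> R -> Om -> R;
  a_ : R -> Om -> R;
  b_ : R -> Om -> R;
  gamma2 : R -> R -> Om -> R;
  lambda_ : R -> Om -> R }.

Section model.
Context {R : realType} {d : measure_display} {Om : measurableType d}.
Variable m : market R Om.

Local Notation P := (pr m).
Local Notation T := (horizon m).
Local Notation H := (filH m).
Local Notation leb := (@lebesgue_measure R).
Local Notation fW1 := (fwdW P T (W1 m)).
Local Notation fW2 := (fwdW P T (W2 m)).
Local Notation fN1 := (fwdN P T (N1 m) (G1 m) (exhaust m)).
Local Notation fN2 := (fwdN P T (N2 m) (G2 m) (exhaust m)).
Local Notation int_W1 := (fwdW_integrable P T (W1 m)).
Local Notation int_W2 := (fwdW_integrable P T (W2 m)).
Local Notation int_N1 := (fwdN_integrable P T (N1 m) (G1 m) (exhaust m)).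
Local Notation int_N2 := (fwdN_integrable P T (N2 m) (G2 m) (exhaust m)).

(* The P-augmentation of the filtration generated by the four noises. *)
Definition filF (t : R) : set (set Om) :=
  <<s P.-negligible `|` sigma_gen (W1 m) `[0, t] `|` sigma_gen (W2 m) `[0, t]
      `|` sigma_gen_rm (N1 m) (`[0, t]%classic `*` R0)
      `|` sigma_gen_rm (N2 m) (`[0, t]%classic `*` R0) >>.

Definition noise_axioms :=
  [/\ 0 < T,
      [/\ brownian P (W1 m), brownian P (W2 m) &
          indep_systems P (sigma_gen (W1 m) `[0, +oo[) (sigma_gen (W2 m) `[0, +oo[)],
      levy_measure (G1 m) /\ levy_measure (G2 m),
      [/\ poisson_random_measure P (N1 m) (G1 m),
          poisson_random_measure P (N2 m) (G2 m) &
          indep_systems P (sigma_gen_rm (N1 m) half_space)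
            (sigma_gen_rm (N2 m) half_space)]
    & [/\ forall n, compact (exhaust m n) /\ exhaust m n `<=` exhaust m n.+1,
          \bigcup_n exhaust m n = R0
        & forall n, (G1 m (exhaust m n) < +oo)%E /\ (G2 m (exhaust m n) < +oo)%E]].

Definition information_axioms :=
  [/\ usual_filtration P T (filG1 m), usual_filtration P T (filG2 m),
      usual_filtration P T H,
      forall t, 0 <= t <= T ->
        [/\ filF t `<=` filG1 m t, filF t `<=` filG2 m t,
            filG1 m t `<=` H t & filG2 m t `<=` H t]
    & compensator P T H (N1 m) (Nh1 m) /\ compensator P T H (N2 m) (Nh2 m)].

(* \int_0^T f_s ds, \int_0^T \int f(s,z) G(dz) ds and \int f dN for nonnegative
   integrands *)
Definition ds (f : R -> R) : \bar R :=
  (\int[leb]_(s in `[0%R, T]) (f s)%:E)%E.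
Definition dGds (G : {measure set R -> \bar R}) (f : R -> R -> R) : \bar R :=
  (\int[leb]_(s in `[0%R, T]) \int[G]_(z in R0) (f s z)%:E)%E.
Definition dN (N : {measure set (R * R) -> \bar R}) (f : R -> R -> R) : \bar R :=
  (\int[N]_(x in `[0%R, T]%classic `*` R0) (f x.1 x.2)%:E)%E.

(* "a.e. for dt x G(dz)" and "a.e. for N(dt,dz)" over [0,T] x (R \ {0}) *)
Definition ae_dtG (G : {sigma_finite_measure set R -> \bar R}) (Q : R -> R -> Prop) :=
  {ae (leb \x G)%E, forall x : R * R, (`[0, T]%classic `*` R0) x -> Q x.1 x.2}.
Definition ae_dN (N : {measure set (R * R) -> \bar R}) (Q : R -> R -> Prop) :=
  {ae N, forall x : R * R, (`[0, T]%classic `*` R0) x -> Q x.1 x.2}.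

Definition coefficient_axioms :=
  [/\ -1 < rho m <= 0 /\ 0 < X0 m,
      [/\ caglad_adapted T (filG1 m) (r_ m),
          forall x, caglad_adapted T (filG1 m) (fun t => mu_ m t x),
          forall t om, 0 <= t <= T ->
            (forall x, derivable (fun y => mu_ m t y om) x 1) /\
            continuous (derive1 (fun y => mu_ m t y om)),
          caglad_adapted T (filG1 m) (sigma_ m)
        & caglad_adapted_field T (filG1 m) (gamma1 m)],
      [/\ caglad_adapted T (filG2 m) (a_ m), caglad_adapted T (filG2 m) (b_ m),
          caglad_adapted_field T (filG2 m) (gamma2 m),
          caglad_adapted T (filG2 m) (lambda_ m) &
          {ae P, forall om, (ds (fun s => `|lambda_ m s om|)%R < +oo)%E} /\
          forall t, 0 <= t <= T ->
            {ae P, forall om, 0 < a_ m t om < lambda_ m t om}],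
      exists e : R, [/\ 0 < e,
          (forall t, 0 <= t <= T -> {ae P, forall om, e <= sigma_ m t om}) /\
            int_W1 (sigma_ m),
          int_W1 (b_ m) /\ int_W2 (b_ m),
          [/\ forall t z, 0 <= t <= T -> z != 0 ->
                {ae P, forall om, -1 < gamma1 m t z om},
              continuous_around_zero P T (fun t z om => ln (1 + gamma1 m t z om)) &
              int_N1 (fun t z om => ln (1 + gamma1 m t z om))] &
          [/\ forall t z, 0 <= t <= T -> z != 0 ->
                {ae P, forall om, e <= gamma2 m t z om},
              continuous_around_zero P T (gamma2 m) & int_N2 (gamma2 m)]]
    & forall (pi : R -> Om -> R) (k : nat), caglad_adapted T H pi ->
        k = 1%N \/ k = 2%N ->
        {ae P, forall om,
          (ds (fun t => `|r_ m t om| + `|mu_ m t (pi t om) om| + `|a_ m t om|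
                        + sigma_ m t om ^+ 2 + b_ m t om ^+ 2)%R
           + dGds (G1 m) (fun t z => (`|ln (1 + gamma1 m t z om)| ^+ 2
               + `|gamma1 m t z om| ^+ k
               + `|ln (1 + gamma1 m t z om) - gamma1 m t z om|)%R)
           + dGds (G2 m) (fun t z => `|gamma2 m t z om| ^+ k)%R
           + dN (Nh1 m om) (fun t z => `|gamma1 m t z om| ^+ k)%R
           + dN (Nh2 m om) (fun t z => `|gamma2 m t z om| ^+ k)%R < +oo)%E}].

(* u = (pi, kappa) *)
Definition strategy : Type := ((R -> Om -> R) * (R -> Om -> R))%type.

Definition A1 (u : strategy) :=
  let pi := u.1 in let kappa := u.2 in
  [/\ caglad_adapted T H pi /\ caglad_adapted T H kappa,
      [/\ int_W1 (fun t om => sigma_ m t om * pi t om),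
          int_W1 (fun t om => b_ m t om * kappa t om)
        & int_W2 (fun t om => b_ m t om * kappa t om)],
      exists epi ekappa : R, [/\ 0 < epi < 1, 0 < ekappa < 1,
        {ae P, forall om,
          ae_dtG (G1 m) (fun t z => -1 + epi < pi t om * gamma1 m t z om) /\
          ae_dN (Nh1 m om) (fun t z => -1 + epi < pi t om * gamma1 m t z om)}
        & {ae P, forall om,
          ae_dtG (G2 m) (fun t z => kappa t om * gamma2 m t z om < 1 - ekappa) /\
          ae_dN (Nh2 m om) (fun t z => kappa t om * gamma2 m t z om < 1 - ekappa)}],
      [/\ continuous_around_zero P T (fun t z om => ln (1 + pi t om * gamma1 m t z om)),
          int_N1 (fun t z om => ln (1 + pi t om * gamma1 m t z om)),
          continuous_around_zero P T (fun t z om => ln (1 - kappa t om * gamma2 m t z om))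
        & int_N2 (fun t z om => ln (1 - kappa t om * gamma2 m t z om))]
    & forall k : nat, k = 1%N \/ k = 2%N -> {ae P, forall om,
        let f1 t z := `|ln (1 + pi t om * gamma1 m t z om)| ^+ k
                      + `|pi t om * gamma1 m t z om| ^+ k in
        let f2 t z := `|ln (1 - kappa t om * gamma2 m t z om)| ^+ k
                      + `|kappa t om * gamma2 m t z om| ^+ k in
        [/\ (ds (fun t => (`|mu_ m t (pi t om) om - r_ m t om| * `|pi t om|
                + `|lambda_ m t om - a_ m t om| * `|kappa t om|
                + `|sigma_ m t om * b_ m t om * pi t om * kappa t om|
                + sigma_ m t om ^+ 2 * pi t om ^+ 2
                + b_ m t om ^+ 2 * kappa t om ^+ 2)%R) < +oo)%E,
            (dGds (G1 m) f1 < +oo)%E, (dN (Nh1 m om) f1 < +oo)%E,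
            (dGds (G2 m) f2 < +oo)%E & (dN (Nh2 m om) f2 < +oo)%E]}].

Definition log_return (u : strategy) : R -> Om -> R := fun t om =>
  let pi := u.1 in let kappa := u.2 in
  \int[leb]_(s in `[0, t]) (r_ m s om + (mu_ m s (pi s om) om - r_ m s om) * pi s om
     + (lambda_ m s om - a_ m s om) * kappa s om
     - 2^-1 * sigma_ m s om ^+ 2 * pi s om ^+ 2
     + rho m * sigma_ m s om * b_ m s om * pi s om * kappa s om
     - 2^-1 * b_ m s om ^+ 2 * kappa s om ^+ 2)
  + fW1 (fun s om => sigma_ m s om * pi s om - rho m * b_ m s om * kappa s om) t om
  - fW2 (fun s om => Num.sqrt (1 - rho m ^+ 2) * b_ m s om * kappa s om) t om
  + fN1 (fun s z om => ln (1 + pi s om * gamma1 m s z om)) t om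
  + fN2 (fun s z om => ln (1 - kappa s om * gamma2 m s z om)) t om
  + \int[leb]_(s in `[0, t]) \int[G1 m]_(z in R0)
      (ln (1 + pi s om * gamma1 m s z om) - pi s om * gamma1 m s z om)
  + \int[leb]_(s in `[0, t]) \int[G2 m]_(z in R0)
      (ln (1 - kappa s om * gamma2 m s z om) + kappa s om * gamma2 m s z om).

Definition wealth (u : strategy) : R -> Om -> R :=
  fun t om => X0 m * expR (log_return u t om).

Definition perturb (u : strategy) (y : R) (alpha : strategy) : strategy :=
  (fun t om => u.1 t om + y * alpha.1 t om, fun t om => u.2 t om + y * alpha.2 t om).

(* d/dy of [log_return (perturb u y alpha) T] at y = 0, computed by
   differentiating under the integrals, and the existence of the integrals of
   the differentiated integrands; the integrands of [fW1] and [fW2] are linear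
   in the strategy. *)
Definition dlog_drift (u alpha : strategy) (s : R) (om : Om) : R :=
  let pi := u.1 in let kappa := u.2 in
  (mu_ m s (pi s om) om - r_ m s om) * alpha.1 s om
  + derive1 (fun x => mu_ m s x om) (pi s om) * alpha.1 s om * pi s om
  + (lambda_ m s om - a_ m s om) * alpha.2 s om
  - sigma_ m s om ^+ 2 * pi s om * alpha.1 s om
  + rho m * sigma_ m s om * b_ m s om
      * (alpha.1 s om * kappa s om + pi s om * alpha.2 s om)
  - b_ m s om ^+ 2 * kappa s om * alpha.2 s om.

Definition dlog_jump1 (u alpha : strategy) (s z : R) (om : Om) : R :=
  alpha.1 s om * gamma1 m s z om / (1 + u.1 s om * gamma1 m s z om).

Definition dlog_jump2 (u alpha : strategy) (s z : R) (om : Om) : R :=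
  - (alpha.2 s om * gamma2 m s z om) / (1 - u.2 s om * gamma2 m s z om).

Definition dlog_return (u alpha : strategy) (om : Om) : R :=
  \int[leb]_(s in `[0, T]) dlog_drift u alpha s om
  + fW1 (fun s om => sigma_ m s om * alpha.1 s om - rho m * b_ m s om * alpha.2 s om) T om
  - fW2 (fun s om => Num.sqrt (1 - rho m ^+ 2) * b_ m s om * alpha.2 s om) T om
  + fN1 (dlog_jump1 u alpha) T om
  + fN2 (dlog_jump2 u alpha) T om
  + \int[leb]_(s in `[0, T]) \int[G1 m]_(z in R0)
      (dlog_jump1 u alpha s z om - alpha.1 s om * gamma1 m s z om)
  + \int[leb]_(s in `[0, T]) \int[G2 m]_(z in R0)
      (dlog_jump2 u alpha s z om + alpha.2 s om * gamma2 m s z om).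

Definition dlog_integrable (u alpha : strategy) :=
  [/\ {ae P, forall om, (ds (fun s => `|dlog_drift u alpha s om|%R) < +oo)%E},
      int_N1 (dlog_jump1 u alpha), int_N2 (dlog_jump2 u alpha),
      {ae P, forall om, (dGds (G1 m) (fun s z =>
        `|dlog_jump1 u alpha s z om - alpha.1 s om * gamma1 m s z om|%R) < +oo)%E}
    & {ae P, forall om, (dGds (G2 m) (fun s z =>
        `|dlog_jump2 u alpha s z om + alpha.2 s om * gamma2 m s z om|%R) < +oo)%E}].

Definition prior : Type := R -> Om -> (R * R * R * R)%type.
Definition th1 (v : prior) t om : R := (v t om).1.1.1.
Definition th2 (v : prior) t om : R := (v t om).1.1.2.
Definition th3 (v : prior) t om : R := (v t om).1.2.
Definition th4 (v : prior) t om : R := (v t om).2.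

Definition prior_process (v : prior) : R -> Om -> R := fun t om =>
  fW1 (th1 v) t om + fW2 (th2 v) t om
  + fN1 (fun s z om => th3 v s om) t om + fN2 (fun s z om => th4 v s om) t om.

Definition A2 (v : prior) :=
  [/\ [/\ caglad_adapted T H (th1 v), caglad_adapted T H (th2 v),
          caglad_adapted T H (th3 v), caglad_adapted T H (th4 v)
        & forall t, 0 <= t <= T ->
            {ae P, forall om, -1 < th3 v t om /\ -1 < th4 v t om}],
      [/\ int_W1 (th1 v), int_W2 (th2 v),
          int_N1 (fun s z om => th3 v s om) & int_N2 (fun s z om => th4 v s om)],
      forall k : nat, k = 1%N \/ k = 2%N ->
        (\int[P]_om
           (let f3 (s z : R) := (`|ln (1 + th3 v s om)| ^+ k + `|th3 v s om| ^+ k)%R in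
            let f4 (s z : R) := (`|ln (1 + th4 v s om)| ^+ k + `|th4 v s om| ^+ k)%R in
            ds (fun s => th1 v s om ^+ 2 + th2 v s om ^+ 2)%R
            + dGds (G1 m) f3 + dN (Nh1 m om) f3
            + dGds (G2 m) f4 + dN (Nh2 m om) f4) < +oo)%E
    & exists M A, special_decomposition P T H (prior_process v) M A /\
                  novikov P T H M].

(* [E] is eps^v and [Q] the prior, a probability equivalent to P, of density
   [E T]; equivalence and the martingale property follow from [novikov], which
   includes that the jumps are larger than -1. *)
Definition prior_density (v : prior) (E : R -> Om -> R) (Q : probability Om R) :=
  [/\ exists M A, special_decomposition P T H (prior_process v) M A /\
                  doleans_dade P T H M E,
      martingale P T H E,
      forall B, measurable B -> Q B = (\int[P]_(om in B) (E T om)%:E)%E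
    & P `<< Q].

Definition utility (U : R -> R) :=
  [/\ forall x y, 0 < x -> x < y -> U x < U y,
      forall x y t, 0 < x -> 0 < y -> 0 <= t <= 1 ->
        t * U x + (1 - t) * U y <= U (t * x + (1 - t) * y),
      forall x, 0 < x -> derivable U x 1
    & forall x y, 0 < x -> x < y -> derive1 U y < derive1 U x].

Definition penalty (g : R -> R * R * R * R -> Om -> R) :=
  measurable_fun ((`[0, T]%classic `*` setT) `*` setT)
    (fun x : (R * (R * R * R * R)) * Om => g x.1.1 x.1.2 x.2) /\
  forall t w om, 0 <= t <= T -> differentiable (fun w => g t w om) w.

Definition admissible_strategies (U : R -> R) (A1' : set strategy) :=
  forall u, A1' u -> A1 u /\
    (\int[P]_om (`|U (wealth u T om)| ^+ 2
                 + `|derive1 U (wealth u T om) * wealth u T om| ^+ 2)%:E < +oo)%E.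

Definition admissible_priors (g : R -> R * R * R * R -> Om -> R)
    (eps : prior -> R -> Om -> R) (A2' : set prior) :=
  forall v, A2' v -> A2 v /\
    (\int[P]_om ((`|eps v T om| ^+ 2)%:E
                 + ds (fun s => `|g s (v s om) om| ^+ 2)%R) < +oo)%E.

Definition payoff (U : R -> R) (g : R -> R * R * R * R -> Om -> R)
    (eps : prior -> R -> Om -> R) (u : strategy) (v : prior) : \bar R :=
  'E_P[fun om => eps v T om * U (wealth u T om)
                 + \int[leb]_(s in `[0, T]) (eps v s om * g s (v s om) om)].

(* In J(u*,v* ) = sup_u inf_v J = inf_v sup_u J the extrema are understood to be
   attained at the pair. Without attainment the equalities do not make u* a best
   response to v*: with two strategies and two priors, J(1,1) = J(1,2) =
   J(2,2) = 0 and J(2,1) = 5, the pair (1,1) satisfies them. *)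
Definition optimal_pair (J : strategy -> prior -> \bar R)
    (A1' : set strategy) (A2' : set prior) (u : strategy) (v : prior) :=
  [/\ A1' u /\ A2' v,
      J u v = ereal_sup [set ereal_inf [set J u' v' | v' in A2'] | u' in A1'],
      J u v = ereal_inf [set ereal_sup [set J u' v' | u' in A1'] | v' in A2'],
      J u v = ereal_sup [set J u' v | u' in A1']
    & J u v = ereal_inf [set J u v' | v' in A2']].

Definition bounded_strategy (alpha : strategy) :=
  exists C : R, forall t om, 0 <= t <= T ->
    `|alpha.1 t om| <= C /\ `|alpha.2 t om| <= C.

Definition indicator_strategy (B1 B2 : set Om) (t h : R) : strategy :=
  (fun s om => \1_B1 om * \1_(`]t, t + h]%classic) s,
   fun s om => \1_B2 om * \1_(`]t, t + h]%classic) s).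

(* For each y the terminal wealth is defined up to a null set only; the
   derivative in y is that of a version X_0 exp(L_y) of the family. *)
Definition u_regular (U : R -> R) (A1' : set strategy) (u : strategy)
    (E : R -> Om -> R) :=
  (forall alpha, A1' alpha -> bounded_strategy alpha ->
    exists delta : R, [/\ 0 < delta,
      forall y, `|y| < delta -> A1' (perturb u y alpha)
      & exists L : R -> Om -> R, let X y om := X0 m * expR (L y om) in [/\
        forall y, `|y| < delta -> measurable_fun setT (L y) /\
          {ae P, forall om, L y om = log_return (perturb u y alpha) T om},
        {ae P, forall om, forall y, `|y| < delta -> derivable (X ^~ om) y 1},
        forall y, `|y| < delta -> dlog_integrable (perturb u y alpha) alpha /\
          {ae P, forall om, derive1 (X ^~ om) y =
             X y om * dlog_return (perturb u y alpha) alpha om}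
        & uniformly_integrable P [set y | `|y| < delta]
            (fun y om => E T om * derive1 U (X y om) * derive1 (X ^~ om) y)]]) /\
  (forall t h B1 B2, 0 <= t -> 0 < h -> t + h <= T -> H t B1 -> H t B2 ->
    A1' (indicator_strategy B1 B2 t h)).

Definition m1 (u : strategy) : R -> Om -> R := fun t om =>
  let pi := u.1 in let kappa := u.2 in
  \int[leb]_(s in `[0, t]) (mu_ m s (pi s om) om - r_ m s om
     + derive1 (fun x => mu_ m s x om) (pi s om) * pi s om
     - sigma_ m s om ^+ 2 * pi s om
     + rho m * sigma_ m s om * b_ m s om * kappa s om)
  + fW1 (sigma_ m) t om
  + fN1 (fun s z om => gamma1 m s z om / (1 + pi s om * gamma1 m s z om)) t om
  - \int[leb]_(s in `[0, t]) \int[G1 m]_(z in R0)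
      (pi s om * gamma1 m s z om ^+ 2 / (1 + pi s om * gamma1 m s z om)).

Definition m2 (u : strategy) : R -> Om -> R := fun t om =>
  let pi := u.1 in let kappa := u.2 in
  \int[leb]_(s in `[0, t]) (lambda_ m s om - a_ m s om
     + rho m * sigma_ m s om * b_ m s om * pi s om
     - b_ m s om ^+ 2 * kappa s om)
  - fW1 (fun s om => rho m * b_ m s om) t om
  - fW2 (fun s om => Num.sqrt (1 - rho m ^+ 2) * b_ m s om) t om
  - fN2 (fun s z om => gamma2 m s z om / (1 - kappa s om * gamma2 m s z om)) t om
  - \int[leb]_(s in `[0, t]) \int[G2 m]_(z in R0)
      (kappa s om * gamma2 m s z om ^+ 2 / (1 - kappa s om * gamma2 m s z om)).

End model.

(* Main.v *)
Require Import Defs.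
From HB Require Import structures.
From mathcomp Require Import all_boot all_order all_algebra.
From mathcomp Require Import all_classical all_reals all_analysis measurable_realfun.
From mathcomp Require Import ring lra.
Set Implicit Arguments.
Unset Strict Implicit.
Unset Printing Implicit Defensive.
Import Order.TTheory GRing.Theory Num.Theory.
Import numFieldNormedType.Exports.
Local Open Scope classical_set_scope.
Local Open Scope ring_scope.

(** Against the optimal prior the strategy [us] maximises the expected utility
    E[eps_T U(X^u_T)]. Along a bounded admissible direction alpha the function
    y |-> E[eps_T U(X^(us + y alpha)_T)] is therefore maximal at y = 0, and
    differentiating under the expectation gives E[Z D_alpha] = 0, where
    Z = eps_T U'(X_T) X_T and D_alpha is the derivative of the logarithm of the
    terminal wealth ([first_order_condition]). For the direction that raises
    the i-th control by 1 during ]t, t + h] on an event B of H_t and leaves the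
    other control alone, D_alpha is 1_B (m_i(t + h) - m_i(t)) almost surely
    ([dlog_return_unit_pi], [dlog_return_unit_kappa]). So the increments
    of m_i have mean zero on the events of H_t under the density Z / E Z. That
    density and its conditional expectation F_T given H_T have the same integrals
    against H_T-measurable variables, and m_i is adapted: m_i is a martingale
    under F_T dP ([change_of_measure], [martingale_change_of_measure]).

    Differentiation under the expectation ([mean_derivative_at_max]) has neither
    a dominating function nor continuity of the derivative to rely on, only
    uniform integrability of the derivatives. The difference quotient at y is
    bounded by K plus the mean over [0, y] of the part of the derivatives beyond
    the level K, whose expectation is small uniformly in y. Up to that error the
    quotient may be truncated at K, and bounded convergence applies. The bound is
    an integral estimate for functions that are differentiable everywhere, with a
    derivative that need not be locally bounded ([abs_increment_le_integral]).

    A forward integral is a limit uniform in probability of approximations. Along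
    a subsequence the approximations converge almost surely, and their relations
    pass to the limit. For Poisson random measures the approximations of the
    integral of 1_B 1_]t, t'] zeta are 1_B times the increments of those of the
    integral of zeta ([fwdN_increment]). For Brownian motion they differ by the
    effect of stopping the noise at the horizon, which vanishes because the noise
    is continuous and the integrand left-continuous ([forward_sum_horizon],
    [fwdW_indicator]). As H_0 contains the null sets, almost sure limits of
    H_t-measurable variables are H_t-measurable, and forward integrals are adapted.

    The expected utility can be split off the payoff because the running penalty
    is integrable: eps_s is a conditional expectation of eps_T, hence bounded in
    L^2 ([cond_exp_sq_le], [integrable_running_penalty]). *)

(** * Increments of everywhere differentiable functions *)

(** Induction along an interval: the supremum of the points reached from [a] is
    reached, and can be passed unless it is [b]. *)
Lemma chain_locally (R : realType) (a b : R) (Q : R -> R -> Prop) :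
  a <= b ->
  (forall x y z, a <= x -> x <= y -> y <= z -> z <= b -> Q x y -> Q y z -> Q x z) ->
  (forall x, a <= x <= b -> exists2 r : R, 0 < r &
     forall y, a <= y <= b -> `|y - x| < r -> (y <= x -> Q y x) /\ (x <= y -> Q x y)) ->
  Q a b.
Proof.
move=> ab Qtr Qloc.
pose S := [set x | a <= x <= b /\ Q a x].
have aab : a <= a <= b by rewrite lexx.
have Sa : S a.
  split=> //; have [r r0 /(_ a aab)] := Qloc _ aab.
  by rewrite subrr normr0 => /(_ r0)[/(_ (lexx _))].
have bS : ubound S b by move=> x [/andP[]].
have hS : has_sup S by split; [exists a|exists b].
pose s := sup S.
have sb : s <= b by apply: ge_sup => //; exists a.
have as_ : a <= s by apply: ub_le_sup => //; exists b.
have asb : a <= s <= b by rewrite as_.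
have [r r0 Qr] := Qloc _ asb.
have [x Sx xs] := sup_adherent r0 hS.
have xs' : x <= s by apply: ub_le_sup => //; exists b.
have [/andP[ax xb] Qax] := Sx.
have Qs : Q a s.
  apply: (Qtr a x s) => //; apply: (Qr x _ _).1 => //; first by rewrite ax.
  by rewrite ler0_norm ?subr_le0// opprB ltrBlDr addrC -ltrBlDr.
have [sltb|] := ltP s b; last first.
  by move=> bs; have <- : s = b by apply/eqP; rewrite eq_le sb.
pose y := Num.min b (s + r / 2).
have sy : s < y by rewrite /y lt_min sltb/= ltrDl divr_gt0.
have yb : y <= b by rewrite /y ge_min lexx.
have ys : y <= s + r / 2 by rewrite /y ge_min lexx orbT.
have ay : a <= y by rewrite (le_trans as_)// ltW.
suff : S y by move=> /(ub_le_sup (ex_intro _ b bS)); rewrite leNgt sy.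
split; first by rewrite ay.
apply: (Qtr a s y) => //; first exact: ltW.
apply: (Qr y _ _).2; first by rewrite ay.
- by rewrite gtr0_norm ?subr_gt0// ltrBlDl (le_lt_trans ys)// ltrD2l ltr_pdivrMr// ltr_pMr// ltr1n.
- exact: ltW.
Qed.

Lemma derivable_increment_le (R : realType) (phi : R -> R) (x c : R) :
  derivable phi x 1 -> `|derive1 phi x| < c ->
  exists2 r : R, 0 < r & forall y, `|y - x| < r -> `|phi y - phi x| <= c * `|y - x|.
Proof.
move=> dx dc.
have : h^-1 *: (phi (h *: 1 + x) - phi x) @[h --> 0^'] --> derive1 phi x.
  by rewrite derive1E; exact: dx.
have c0 : 0 < c - `|derive1 phi x| by rewrite subr_gt0.
move=> /cvgrPdist_lt /(_ _ c0); rewrite near_withinE near_simpl => -[r /= r0 rP].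
exists r => // y yx.
have [->|ynx] := eqVneq y x; first by rewrite !subrr !normr0 mulr0.
have := rP (y - x); rewrite /ball_/= sub0r normrN => /(_ yx).
rewrite subr_eq0 => /(_ ynx).
rewrite /GRing.scale /= mulr1 subrK => h.
have : `|(y - x)^-1 * (phi y - phi x)| < c.
  rewrite -[X in `|X|](subrK (derive1 phi x)) (le_lt_trans (ler_normD _ _))//.
  by rewrite distrC -ltrBrDr.
rewrite normrM normfV => /ltW.
by rewrite ler_pdivrMl ?normr_gt0 ?subr_eq0// mulrC.
Qed.

Local Notation leb := lebesgue_measure.

(** The derivative may be unbounded, so that increments are controlled only near
    each point, at a rate that depends on the point. The set where the absolute
    derivative lies in [k e, (k + 1) e[ is covered by an open set that is hardly
    larger. Near a point of this set an increment of [phi] is at most (k + 1) e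
    times the length, hence at most the integral of the majorant w, which is the
    sum of (k + 1) e over the open sets; [chain_locally] chains these local
    estimates, and the integral of w exceeds that of the absolute derivative by
    little. *)
Lemma abs_increment_le_integral (R : realType) (phi : R -> R) (a b : R) :
  a <= b -> (forall x, a <= x <= b -> derivable phi x 1) ->
  measurable_fun `[a, b] (derive1 phi) ->
  (`|phi b - phi a|%:E <= \int[lebesgue_measure]_(x in `[a, b]) `|derive1 phi x|%:E)%E.
Proof.
move=> ab dphi mdphi.

pose g x := `|derive1 phi x|.
have mab : measurable (`[a, b]%classic : set R) by [].
have mg : measurable_fun `[a, b] g by exact/measurableT_comp.
apply/lee_addgt0Pr => eps eps0.
have ba0 : 0 <= b - a by rewrite subr_ge0.
(* The final error is e (b - a) + 2 e at most. *)
pose e := eps / (b - a + 2).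
have e0 : 0 < e by rewrite divr_gt0// ltr_wpDl.
pose c (k : nat) := k.+1%:R * e.
have c0 k : 0 < c k by rewrite mulr_gt0.
pose E k := `[a, b]%classic `&` g @^-1` `[k%:R * e, k.+1%:R * e[%classic.
have mE k : measurable (E k) by exact: mg.
have finE k : (leb (E k) < +oo)%E.
  apply: (@le_lt_trans _ _ (leb `[a, b]%classic)).
  move: (mE k) => ?; apply: (@le_measure _ _ _ leb); rewrite ?inE//. exact: subIsetl.
  by rewrite lebesgue_measure_itv/=; case: ifPn => // _; rewrite ltry.
have tE : trivIset setT E.
  apply/trivIsetP => i j _ _ ij; apply/seteqP; split=> // x [[_ /= +] [_ /= +]].
  rewrite !in_itv/= => /andP[ig gi] /andP[jg gj].
  have := le_lt_trans ig gj; rewrite ltr_pM2r// ltr_nat ltnS => ij'.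
  have := le_lt_trans jg gi; rewrite ltr_pM2r// ltr_nat ltnS => ji.
  by move: ij; rewrite eqn_leq ij' ji.
have Ex x : a <= x <= b -> E (Num.truncn (g x / e)) x.
  move=> xab; split; rewrite /= in_itv//=.
  have ge0 : 0 <= g x / e by apply: divr_ge0; [exact: normr_ge0|exact: ltW].
  have /andP[h1 h2] := truncn_itv ge0.
  by rewrite -ler_pdivlMr// h1 -ltr_pdivrMr.
(* The excess of the k-th open set, weighted by [c k], sums to at most e. *)
pose eta k := e / (2 ^ k.+1)%:R / c k.
have eta0 k : 0 < eta k.
  by apply: divr_gt0 => //; apply: divr_gt0 => //; rewrite ltr0n expn_gt0.
have /choice[V Vprop] : forall k, exists U : set R,
    [/\ open U, E k `<=` U & (leb (U `\` E k) < (eta k)%:E)%E].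
  by move=> k; apply: lebesgue_regularity_outer; [exact: mE|exact: finE|exact: eta0].
have oV k : open (V k) by case: (Vprop k).
have EV k : E k `<=` V k by case: (Vprop k).
have Veta k : (leb (V k `\` E k) < (eta k)%:E)%E by case: (Vprop k).
have mV k : measurable (V k) by exact: open_measurable.
pose wk k x := ((c k)%:E * (\1_(V k) x)%:E)%E.
have wk0 k x : (0 <= wk k x)%E by rewrite mule_ge0// lee_fin // ltW.
have mwk k (D : set R) : measurable_fun D (wk k).
  apply/measurable_funTS/emeasurable_funM => //.
  exact/measurable_EFinP/measurable_indic.
pose w x := (\sum_(0 <= k <oo) wk k x)%E.
have mw (D : set R) : measurable D -> measurable_fun D w.
  by move=> mD; exact: ge0_emeasurable_sum.
have w0 x : (0 <= w x)%E by apply: nneseries_ge0.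
pose Q x y := (`|phi y - phi x|%:E <= \int[leb]_(t in `]x, y]) w t)%E.
have Qab : Q a b.
  apply: (@chain_locally R a b Q) => //.
    move=> x y z ax xy yz zb Qxy Qyz; rewrite /Q.
    rewrite (_ : `]x, z]%classic = `]x, y] `|` `]y, z]); last first.
      by apply: itv_bndbnd_setU; rewrite bnd_simp.
    rewrite ge0_integral_setU//=; last 2 first.
    - apply: mw; exact: measurableU.
    - apply/disj_setPS => t; rewrite /= !in_itv/= => -[/andP[_ ty] /andP[yt _]].
      by move: (lt_le_trans yt ty); rewrite ltxx.
    apply: le_trans (leeD Qxy Qyz).
    rewrite -EFinD lee_fin [leRHS]addrC; exact: ler_distD.
  move=> x xab; pose k := Num.truncn (g x / e).
  have Ekx : E k x by exact: Ex.
  have [_ /=] := Ekx; rewrite in_itv/= => /andP[_ gc].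
  have [r r0 rP] := derivable_increment_le (dphi _ xab) gc.
  have /= := oV k; rewrite openE => /(_ x (EV _ _ Ekx)) [r' /= r'0 r'P].
  exists (Num.min r r'); first by rewrite lt_min r0.
  move=> y yab; rewrite lt_min => /andP[yr yr'].
  have key u v : u <= v -> `]u, v]%classic `<=` V k ->
      ((c k * (v - u))%:E <= \int[leb]_(t in `]u, v]) w t)%E.
    move=> uv uvV.
    have -> : (c k * (v - u))%:E = (\int[leb]_(t in `]u, v]) (cst (c k)%:E t))%E.
      rewrite integral_cst//= lebesgue_measure_itv/= lte_fin.
      have [uv'|] := ltP u v; first by rewrite EFinM EFinB.
      move=> vu; have -> : u = v by apply/eqP; rewrite eq_le uv.
      by rewrite subrr mulr0 mule0.
    apply: ge0_le_integral => //=.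
    - by move=> t _; rewrite lee_fin ltW.
    - exact: mw.
    - move=> t tuv; rewrite /w.
      apply: (@le_trans _ _ (\sum_(0 <= i < k.+1) wk i t)%E); last first.
        exact: nneseries_lim_ge.
      rewrite big_nat_recr//= (_ : wk k t = (c k)%:E) ?leeDr//; last first.
        by rewrite /wk indicE mem_set ?mule1//; exact: uvV.
      by apply: sume_ge0.
  have ball_V u v : u <= v -> `|u - x| < r' -> `|v - x| < r' -> `]u, v]%classic `<=` V k.
    move=> uv ux vx t /=; rewrite in_itv/= => /andP[ut tv]; apply: r'P => /=.
    rewrite distrC; move: ux vx; rewrite !ltr_norml => /andP[? ?] /andP[? ?].
    apply/andP; split; lra.
  split=> yx.
  - rewrite /Q distrC; apply: le_trans (key y x yx _); last first.
      by apply: ball_V => //; rewrite subrr normr0.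
    rewrite lee_fin (le_trans (rP _ yr))//.
    by rewrite distrC ger0_norm// subr_ge0.
  - rewrite /Q; apply: le_trans (key x y yx _); last first.
      by apply: ball_V => //; rewrite subrr normr0.
    rewrite lee_fin (le_trans (rP _ yr))//.
    by rewrite ger0_norm// subr_ge0.
apply: (le_trans Qab).
rewrite integral_nneseries; [|by []|by move=> n; exact: mwk|by move=> n x _; exact: wk0].
apply: (@le_trans _ _ (\sum_(0 <= k <oo)
    ((c k)%:E * leb (E k) + (e / (2 ^ k.+1)%:R)%:E))%E).
  apply: lee_nneseries => //; first by move=> n *; apply: integral_ge0 => x _; exact: wk0.
  move=> k _; rewrite /wk ge0_integralZl_EFin//=; last 2 first.
  - by apply/measurable_EFinP; apply: measurable_indic; exact: mV.
  - exact: ltW.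
  rewrite integral_indic; [|by []|exact: mV].
  apply: (@le_trans _ _ ((c k)%:E * (leb (E k) + leb (V k `\` E k)))%E).
    rewrite lee_wpmul2l// ?lee_fin ?(ltW (c0 k))//.
    apply: (@le_trans _ _ (leb (V k))).
      apply: (@le_measure _ _ _ leb); rewrite ?inE;
        [apply: measurableI => //; exact: mV|exact: mV|exact: subIsetl].
    rewrite -[X in (leb X <= _)%E](@setDUK _ (E k))//.
    by apply: measureU2; [exact: mE|apply: measurableD; [exact: mV|exact: mE]].
  rewrite ge0_muleDr//; apply: leeD2l.
  have -> : e / (2 ^ k.+1)%:R = c k * eta k.
    by rewrite /eta mulrCA divff ?mulr1// gt_eqF.
  rewrite [leRHS]EFinM; apply: lee_wpmul2l; last exact: ltW (Veta _).
  by rewrite lee_fin ltW.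
have cE0 k : (0 <= (c k)%:E * leb (E k))%E.
  by apply: mule_ge0 => //; rewrite lee_fin ltW.
apply: (le_trans (epsilon_trick predT cE0 (ltW e0))).
have mh : measurable_fun `[a, b] (fun x => ((g x)%:E + e%:E)%E).
  by apply: emeasurable_funD => //; exact/measurable_EFinP.
apply: (@le_trans _ _ (\int[leb]_(x in `[a, b]) ((g x)%:E + e%:E) + e%:E)%E).
  apply: leeD2r.
  apply: (@le_trans _ _ (\int[leb]_(x in \bigcup_k E k) ((g x)%:E + e%:E))%E); last first.
    apply: ge0_subset_integral => //.
    - by apply: bigcup_measurable => k _; exact: mE.
    - by move=> x _; apply: adde_ge0; rewrite lee_fin; [exact: normr_ge0|exact: ltW].
    - by apply: bigcup_sub => k _; exact: subIsetl.
  rewrite ge0_integral_bigcup//=; last 2 first.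
  - apply: measurable_funS mh => //; apply: bigcup_sub => k _; exact: subIsetl.
  - by move=> x _; apply: adde_ge0; rewrite lee_fin; [exact: normr_ge0|exact: ltW].
  apply: lee_nneseries => //.
  move=> k _.
  have -> : ((c k)%:E * leb (E k) = \int[leb]_(x in E k) (cst (c k)%:E x))%E.
    by rewrite integral_cst//; exact: mE.
  apply: ge0_le_integral => //=.
  - exact: mE.
  - by move=> x _; rewrite lee_fin ltW.
  - by apply: measurable_funS mh => //; exact: subIsetl.
  - move=> x [_ /=]; rewrite in_itv/= => /andP[+ _].
    rewrite -EFinD lee_fin /c -natr1 mulrDl mul1r => ?.
    by rewrite lerD2r.
rewrite ge0_integralD//=; last 2 first.
- exact/measurable_EFinP.
- by move=> x _; rewrite lee_fin ltW.
rewrite integral_cst//= -addeA; apply: leeD2l.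
rewrite lebesgue_measure_itv/= lte_fin.
have -> : eps = e * (b - a) + 2 * e.
  rewrite (mulrC 2) -mulrDr /e divfK// gt_eqF// ltr_wpDl//.
case: ifPn => _.
  by rewrite -EFinB -!EFinM -EFinD lee_fin; lra.
rewrite mule0 add0e lee_fin; have := mulr_ge0 (ltW e0) ba0; lra.
by move=> x _; rewrite lee_fin; exact: normr_ge0.
Qed.

(** * Joint measurability and integrals with parameters *)

Section joint_measurability.
Context {R : realType}.

(** Discretised processes are of this form, with [k] the index of the cell of a
    grid. *)
Lemma measurable_select (d1 d2 : measure_display) (A : measurableType d1)
    (B : measurableType d2) (I : countType) (k : A -> I) (h : I -> A -> B) :
  (forall i, measurable (k @^-1` [set i])) ->
  (forall i, measurable_fun setT (h i)) ->
  measurable_fun setT (fun a => h (k a) a).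
Proof.
move=> mk mh _ Y mY; rewrite setTI.
rewrite (_ : _ @^-1` Y = \bigcup_i ((k @^-1` [set i]) `&` (h i @^-1` Y))).
  apply: countable_bigcupT_measurable; first exact: countableP.
  by move=> i; apply: measurableI => //; rewrite -[X in measurable X]setTI; exact: mh.
apply/seteqP; split=> a /=.
  by move=> ?; exists (k a).
by move=> [i _ [/= <-]].
Qed.

Lemma measurable_preimage_floor (d1 : measure_display) (A : measurableType d1)
    (g : A -> R) : measurable_fun setT g ->
  forall i : int, measurable ((fun a => Num.floor (g a)) @^-1` [set i]).
Proof.
move=> mg i.
rewrite (_ : _ @^-1` _ = setT `&` g @^-1` `[i%:~R, (i + 1)%:~R[%classic).
  by apply: mg.
rewrite setTI; apply/seteqP; split=> a /=; rewrite in_itv/=.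
  by move=> <-; exact: floor_itv.
by move=> h; exact: floor_def.
Qed.

Lemma measurable_preimage_ceil (d1 : measure_display) (A : measurableType d1)
    (g : A -> R) : measurable_fun setT g ->
  forall i : int, measurable ((fun a => Num.ceil (g a)) @^-1` [set i]).
Proof.
move=> mg i.
rewrite (_ : _ @^-1` _ = setT `&` g @^-1` `](i - 1)%:~R, i%:~R]%classic).
  by apply: mg.
rewrite setTI; apply/seteqP; split=> a /=; rewrite in_itv/=.
  by move=> <-; exact: ceil_itv.
by move=> h; exact: ceil_def.
Qed.

Lemma natS_gt0 (n : nat) : 0 < n.+1%:R :> R.
Proof. by rewrite ltr0n. Qed.

Lemma cvg_within_harmonic (u : nat -> R) (x : R) :
  (forall n, `|x - u n| <= harmonic n) -> u n @[n --> \oo] --> x.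
Proof.
move=> ux; apply/cvgrPdist_le => e e0.
have /cvgrPdist_le /(_ e e0) := @cvg_harmonic R.
apply: filterS => n; rewrite sub0r normrN ger0_norm ?harmonic_ge0//.
exact: le_trans.
Qed.

Lemma floor_grid_dist (n : nat) (x : R) :
  x - n.+1%:R^-1 <= (Num.floor (n.+1%:R * x))%:~R / n.+1%:R <= x.
Proof.
have /andP[h1 h2] := floor_itv (n.+1%:R * x).
rewrite ler_pdivrMr ?natS_gt0// ler_pdivlMr ?natS_gt0// mulrBl mulVf ?pnatr_eq0//.
by rewrite (mulrC x) h1 andbT lerBlDr -[1]/(1%:~R) -intrD ltW.
Qed.

(** The argument [g a] is rounded down to the grid of mesh 1/(n+1), where
    [measurable_select] applies, and continuity removes the rounding. *)
Lemma measurable_caratheodory (d1 : measure_display) (A : measurableType d1)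
    (h : A -> R -> R) (g : A -> R) :
  (forall y, measurable_fun setT (h ^~ y)) -> measurable_fun setT g ->
  (forall a, {for g a, continuous (h a)}) ->
  measurable_fun setT (fun a => h a (g a)).
Proof.
move=> mh mg ch.
pose gr n (i : int) : R := i%:~R / n.+1%:R.
apply: (@measurable_fun_cvg _ _ _ _
  (fun n a => h a (gr n (Num.floor (n.+1%:R * g a))))) => [n|a _].
  apply: (measurable_select (k := fun a => Num.floor (n.+1%:R * g a))
    (h := fun i a => h a (gr n i))) => [|i]; last exact: mh.
  by apply: measurable_preimage_floor; exact: measurable_funM.
apply: (@continuous_cvg _ _ _ _ _ _ (h a)); first exact: ch.
apply: cvg_within_harmonic => n.
have /andP[h1 h2] := floor_grid_dist n (g a).
by rewrite /gr ger0_norm ?subr_ge0// lerBlDr -lerBlDl.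
Qed.

Lemma measurable_derive1_comp (d1 : measure_display) (A : measurableType d1)
    (h : A -> R -> R) (g : A -> R) :
  (forall y, measurable_fun setT (h ^~ y)) -> measurable_fun setT g ->
  (forall a y, derivable (h a) y 1) ->
  measurable_fun setT (fun a => derive1 (h a) (g a)).
Proof.
move=> mh mg dh.
have ch a : continuous (h a).
  by move=> y; apply: differentiable_continuous; apply/derivable1_diffP; exact: dh.
have mhg (g' : A -> R) : measurable_fun setT g' -> measurable_fun setT (fun a => h a (g' a)).
  by move=> mg'; apply: measurable_caratheodory => // a; exact: ch.
apply: (@measurable_fun_cvg _ _ _ _ (fun (n : nat) a =>
    (n.+1%:R : R) * (h a (n.+1%:R^-1 + g a) - h a (g a)))) => [n|a _].
  apply: measurable_funM => //; apply: measurable_funB; apply: mhg => //.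
  exact: measurable_funD.
have := dh a (g a); rewrite /derivable => /cvg_ex[l hl].
have -> : derive1 (h a) (g a) = l.
  by rewrite derive1E; apply/cvg_lim.
move/cvgr_dnbhsP : hl => /(_ (fun n => n.+1%:R^-1)).
rewrite (_ : (fun n => n.+1%:R * _) = (fun n => (n.+1%:R^-1)^-1 *: ((h a \o shift (g a)) (n.+1%:R^-1 *: 1) - h a (g a)))).
  apply; split; first by move=> n; rewrite invr_eq0 pnatr_eq0.
  exact: cvg_harmonic.
by apply/funext => n; rewrite /GRing.scale/= mulr1 invrK.
Qed.

(** The process [fun s => f (clamp t s)] extends the part of [f] on [0, t] to
    all times, so that joint measurability on [0, t] becomes measurability on a
    whole product space. *)
Definition clamp (t s : R) := Num.min (Num.max s 0) t.

Lemma clamp_itv t s : 0 <= t -> 0 <= clamp t s <= t.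
Proof. by move=> t0; rewrite /clamp le_min le_max lexx orbT t0 ge_min lexx orbT. Qed.

Lemma clamp_id t s : 0 <= s <= t -> clamp t s = s.
Proof. by move=> /andP[s0 st]; rewrite /clamp (max_idPl s0) (min_idPl st). Qed.

Lemma clamp_dist t s s' : 0 <= s <= t -> `|s - clamp t s'| <= `|s - s'|.
Proof.
move=> /andP[s0 st]; rewrite /clamp; case: (leP 0 s') => h; last first.
  rewrite min_l ?(le_trans s0 st)// !ger0_norm; lra.
case: (leP s' t) => // h2.
by rewrite !ler0_norm; lra.
Qed.

Lemma measurable_clamp t : measurable_fun setT (clamp t).
Proof. by apply: measurable_minr => //; exact: measurable_maxr. Qed.

Lemma measurable_clamp_fst (d1 : measure_display) (X : measurableType d1) t :
  measurable_fun setT (fun p : R * X => clamp t p.1).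
Proof. exact: (measurableT_comp (measurable_clamp t) measurable_fst). Qed.

(** Sampling at the grid point strictly before the current time recovers a
    left-continuous path in the limit. At time 0 no earlier time exists, and the
    clamped grid point is 0 itself. *)
Lemma caglad_jointly_measurable (d1 : measure_display) (X : measurableType d1)
    (f : R -> X -> R) (t : R) :
  0 <= t ->
  (forall s, 0 <= s <= t -> measurable_fun setT (f s)) ->
  (forall x s, 0 < s <= t -> f u x @[u --> s^'-] --> f s x) ->
  measurable_fun setT (fun p : R * X => f (clamp t p.1) p.2).
Proof.
move=> t0 mf lf.
pose gr n (i : int) : R := clamp t ((i - 1)%:~R / n.+1%:R).
apply: (@measurable_fun_cvg _ _ _ _ (fun n (p : R * X) =>
   f (gr n (Num.ceil (n.+1%:R * clamp t p.1))) p.2)) => [n|[s x] _ /=].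
  apply: (measurable_select (k := fun p : R * X => Num.ceil (n.+1%:R * clamp t p.1))
    (h := fun i (p : R * X) => f (gr n i) p.2)) => [|i].
    apply: measurable_preimage_ceil; apply: measurable_funM => //.
    exact: measurable_clamp_fst.
  by apply: measurableT_comp => //; apply: mf; exact: clamp_itv.
set c := clamp t s; have /andP[c0 ct] : 0 <= c <= t by exact: clamp_itv.
have [c0'|c0'] := eqVneq c 0.
  rewrite (_ : (fun n => _) = cst (f c x)); first exact: cvg_cst.
  apply/funext => n /=; congr (f _ x).
  rewrite c0' mulr0 ceil0 /gr sub0r mulrNz mulN1r /clamp.
  by rewrite (max_idPr _) ?(min_idPl _)// oppr_le0 invr_ge0.
have {}c0 : 0 < c by rewrite lt_neqAle eq_sym c0'.
have := lf x c; rewrite c0 ct => /(_ isT) /cvg_at_leftP; apply; split.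
  move=> n; have /andP[h1 h2] := ceil_itv (n.+1%:R * c).
  rewrite /gr /clamp gt_min; apply/orP; left; rewrite gt_max c0 andbT.
  by rewrite ltr_pdivrMr ?natS_gt0// (mulrC c).
apply: cvg_within_harmonic => n.
have /andP[h1 h2] := ceil_itv (n.+1%:R * c).
apply: le_trans (clamp_dist _ _) _; first by rewrite (ltW c0).
rewrite ger0_norm; last by rewrite subr_ge0 ler_pdivrMr ?natS_gt0// (mulrC c) ltW.
rewrite lerBlDr -lerBlDl ler_pdivlMr ?natS_gt0// mulrBl mulVf ?pnatr_eq0//.
by rewrite intrB (mulrC c) lerB.
Qed.

(** The mirror image of [caglad_jointly_measurable]: grid points strictly after
    the current time, clamped to [t] at the right end. *)
Lemma cadlag_jointly_measurable (d1 : measure_display) (X : measurableType d1)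
    (f : R -> X -> R) (t : R) :
  0 <= t ->
  (forall s, 0 <= s <= t -> measurable_fun setT (f s)) ->
  (forall x s, 0 <= s < t -> f u x @[u --> s^'+] --> f s x) ->
  measurable_fun setT (fun p : R * X => f (clamp t p.1) p.2).
Proof.
move=> t0 mf lf.
pose gr n (i : int) : R := clamp t ((i + 1)%:~R / n.+1%:R).
apply: (@measurable_fun_cvg _ _ _ _ (fun n (p : R * X) =>
   f (gr n (Num.floor (n.+1%:R * clamp t p.1))) p.2)) => [n|[s x] _ /=].
  apply: (measurable_select (k := fun p : R * X => Num.floor (n.+1%:R * clamp t p.1))
    (h := fun i (p : R * X) => f (gr n i) p.2)) => [|i].
    apply: measurable_preimage_floor; apply: measurable_funM => //.
    exact: measurable_clamp_fst.
  by apply: measurableT_comp => //; apply: mf; exact: clamp_itv.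
set c := clamp t s; have /andP[c0 ct] : 0 <= c <= t by exact: clamp_itv.
have lt_gr n : c < (Num.floor (n.+1%:R * c) + 1)%:~R / n.+1%:R.
  have /andP[h1 h2] := floor_itv (n.+1%:R * c).
  by rewrite ltr_pdivlMr ?natS_gt0// mulrC.
have [ct'|ct'] := eqVneq c t.
  rewrite (_ : (fun n => _) = cst (f c x)); first exact: cvg_cst.
  apply/funext => n /=; congr (f _ x).
  have h := lt_gr n; rewrite /gr /clamp (max_idPl _) ?(le_trans c0 (ltW h))//.
  by rewrite [RHS]ct' (min_idPr _)// -{1}ct' ltW.
have {}ct : c < t by rewrite lt_neqAle ct'.
have := lf x c; rewrite c0 ct => /(_ isT) /cvg_at_rightP; apply; split.
  by move=> n; rewrite /gr /clamp lt_min lt_max lt_gr ct.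
apply: cvg_within_harmonic => n.
have /andP[h1 h2] := floor_itv (n.+1%:R * c).
apply: le_trans (clamp_dist _ _) _; first by rewrite c0 ltW.
rewrite distrC ger0_norm; last by rewrite subr_ge0 ltW.
rewrite lerBlDr ler_pdivrMr ?natS_gt0// mulrDl mulVf ?pnatr_eq0//.
by rewrite intrD addrC lerD2l (mulrC c).
Qed.

Lemma measurable_Rintegral_family (d1 d2 : measure_display) (X : measurableType d1)
    (Y : measurableType d2) (l : X -> {measure set Y -> \bar R}) (D : set Y)
    (f : X * Y -> R) :
  (forall g : X * Y -> \bar R, measurable_fun setT g -> (forall z, (0 <= g z)%E) ->
    measurable_fun setT (fun x => \int[l x]_(y in D) g (x, y))%E) ->
  measurable_fun setT f ->
  measurable_fun setT (fun x => \int[l x]_(y in D) f (x, y)).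
Proof.
move=> hl mf; rewrite /Rintegral.
apply: measurableT_comp; first exact: fine_measurable.
under eq_fun do rewrite integralE.
have mEf : measurable_fun setT (EFin \o f) by exact/measurable_EFinP.
apply: emeasurable_funB.
  have -> : (fun x => \int[l x]_(y in D) ((fun y => (f (x, y))%:E)^\+ y))%E =
      (fun x => \int[l x]_(y in D) ((EFin \o f)^\+ (x, y)))%E.
    by apply/funext => x; apply: eq_integral => y _; rewrite !funeposE.
  by apply: hl; [exact: measurable_funepos|move=> z; exact: funepos_ge0].
have -> : (fun x => \int[l x]_(y in D) ((fun y => (f (x, y))%:E)^\- y))%E =
    (fun x => \int[l x]_(y in D) ((EFin \o f)^\- (x, y)))%E.
  by apply/funext => x; apply: eq_integral => y _; rewrite !funenegE.
by apply: hl; [exact: measurable_funeneg|move=> z; exact: funeneg_ge0].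
Qed.

Lemma measurable_integral_param (d1 d2 : measure_display) (X : measurableType d1)
    (Y : measurableType d2) (mu : {sigma_finite_measure set Y -> \bar R}) (D : set Y)
    (g : X * Y -> \bar R) :
  measurable D -> measurable_fun setT g -> (forall z, (0 <= g z)%E) ->
  measurable_fun setT (fun x => \int[mu]_(y in D) g (x, y))%E.
Proof.
move=> mD mg g0.
have -> : (fun x => \int[mu]_(y in D) g (x, y))%E =
    fubini_F mu (g \_ (setT `*` D)).
  apply/funext => x; rewrite /fubini_F [LHS]integral_mkcond; apply: eq_integral => y _ /=.
  rewrite /patch; congr (if _ then _ else _).
  by apply/idP/idP; rewrite !inE => //= -[].
apply: measurable_fun_fubini_tonelli_F.
  apply/(measurable_restrictT _ _).1 => //; first exact: measurableX.
  exact: measurable_funTS.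
by move=> z; rewrite /patch; case: ifPn.
Qed.

Lemma measurable_Rintegral_param (d1 d2 : measure_display) (X : measurableType d1)
    (Y : measurableType d2) (mu : {sigma_finite_measure set Y -> \bar R}) (D : set Y)
    (f : X * Y -> R) :
  measurable D -> measurable_fun setT f ->
  measurable_fun setT (fun x => \int[mu]_(y in D) f (x, y)).
Proof.
move=> mD mf; apply: (measurable_Rintegral_family (l := fun=> mu)) => // g mg g0.
exact: measurable_integral_param.
Qed.

End joint_measurability.

Lemma ge0_integral_mrestr (R : realType) (d : measure_display) (Y : measurableType d)
    (mu : {measure set Y -> \bar R}) (D : set Y) (mD : measurable D) (g : Y -> \bar R) :
  measurable_fun setT g -> (forall y, (0 <= g y)%E) ->
  (\int[mrestr mu mD]_y g y = \int[mu]_(y in D) g y)%E.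
Proof.
move=> mg g0.
rewrite (@ge0_negligible_integral _ _ _ (mrestr mu mD) setT (~` D))//; last 2 first.
- exact: measurableC.
- by rewrite /= /mrestr setICl measure0.
rewrite setTD setCK; apply: eq_measure_integral => A mA AD.
by rewrite /= /mrestr (setIidl AD).
Qed.

Section finite_random_measure.
Import HBNNSimple.
Context {R : realType} d1 d2 (X : measurableType d1) (Y : measurableType d2).
Variables (l : X -> {measure set Y -> \bar R}) (C : set Y) (mC : measurable C).
Hypothesis ml : forall A, measurable A -> A `<=` C -> measurable_fun setT (fun x => l x A).
Hypothesis lfin : forall x, (l x C < +oo)%E.

Let lC (x : X) : {measure set Y -> \bar R} := mrestr (l x) mC.

Let measurable_lC U : measurable U -> measurable_fun setT (lC ^~ U).
Proof. by move=> mU; apply: ml; [exact: measurableI|exact: subIsetr]. Qed.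

HB.instance Definition _ := isKernel.Build _ _ _ _ _ lC measurable_lC.

(** Restricted to [C] the random measure is a finite kernel, for which the
    section integrals are measurable. *)
Lemma measurable_integral_random_measure (g : X * Y -> \bar R) :
  measurable_fun setT g -> (forall z, (0 <= g z)%E) ->
  measurable_fun setT (fun x => \int[l x]_(y in C) g (x, y))%E.
Proof.
move=> mg g0.
have -> : (fun x => \int[l x]_(y in C) g (x, y))%E = (fun x => \int[lC x]_y g (x, y))%E.
  apply/funext => x; rewrite /lC ge0_integral_mrestr//.
  by apply: measurableT_comp => //; exact: pair1_measurable.
apply: (measurable_fun_xsection_integral g lC (nnsfun_approx measurableT mg)).
- by move=> a b ab; exact/nd_nnsfun_approx.
- by move=> z; exact/cvg_nnsfun_approx.
move=> n r.
set A := _ @^-1` _.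
have mA : measurable A by exact: measurable_funPTI.
have lT x : (lC x setT < +oo)%E by rewrite /lC/= /mrestr setTI; exact: lfin.
have := @measurable_prod_subset_xsection_kernel _ _ X Y R lC setT measurableT.
have h : forall x : X, exists M : R, forall Z : set Y, measurable Z ->
   (mrestr (lC x) measurableT Z < M%:E)%E.
  move=> x.
  exists (fine (lC x setT) + 1) => Z mZ.
  apply: (@le_lt_trans _ _ (lC x setT)).
    by rewrite /mrestr; apply: le_measure; rewrite ?inE//; exact: measurableI.
  have fT : lC x setT \is a fin_num by rewrite ge0_fin_numE//; exact: lT.
  by rewrite -[ltLHS](fineK fT) lte_fin ltrDl.
move=> /(_ h A mA)[_].
by under eq_fun do rewrite /mrestr setIT.
Qed.

End finite_random_measure.

Lemma tonelli_swap (R : realType) (d1 d2 : measure_display) (X : measurableType d1)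
    (Y : measurableType d2) (mu : {sigma_finite_measure set X -> \bar R})
    (nu : {sigma_finite_measure set Y -> \bar R}) (D : set X) (g : X * Y -> \bar R) :
  measurable D -> measurable_fun setT g -> (forall z, (0 <= g z)%E) ->
  (\int[nu]_y \int[mu]_(x in D) g (x, y) = \int[mu]_(x in D) \int[nu]_y g (x, y))%E.
Proof.
move=> mD mg g0.
pose h := g \_ (D `*` setT).
have mh : measurable_fun setT h.
  apply/(measurable_restrictT _ _).1 => //; first exact: measurableX.
  exact: measurable_funTS.
have h0 z : (0 <= h z)%E by rewrite /h /patch; case: ifPn.
have hE x y : h (x, y) = if x \in D then g (x, y) else 0%E.
  rewrite /h /patch; congr (if _ then _ else _).
  by apply/idP/idP; rewrite !inE => //= -[].
transitivity (\int[nu]_y \int[mu]_x h (x, y))%E.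
  apply: eq_integral => y _; rewrite integral_mkcond; apply: eq_integral => x _.
  by rewrite hE.
rewrite -(@fubini_tonelli _ _ X Y R mu nu h)// [RHS]integral_mkcond.
apply: eq_integral => x _; rewrite /patch; case: ifPn => xD.
  by apply: eq_integral => y _; rewrite hE xD.
by apply: integral0_eq => y _; rewrite hE (negbTE xD).
Qed.

Section lebesgue_parameter.
Context {R : realType}.

Lemma measurable_lebesgue_integral_param (d : measure_display) (X : measurableType d)
    (D : set R) (g : R * X -> \bar R) :
  measurable D -> measurable_fun setT g -> (forall z, (0 <= g z)%E) ->
  measurable_fun setT (fun x => \int[lebesgue_measure]_(s in D) g (s, x))%E.
Proof.
move=> mD mg g0.
have h := @measurable_integral_param R _ _ X (measurableTypeR R) lebesgue_measure D
  (fun a => g (a.2, a.1)) mD _ (fun a => g0 _).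
apply: h; apply: (measurableT_comp mg).
exact: measurable_swap.
Qed.

Lemma measurable_lebesgue_Rintegral_param (d : measure_display) (X : measurableType d)
    (D : set R) (f : R * X -> R) :
  measurable D -> measurable_fun setT f ->
  measurable_fun setT (fun x => \int[lebesgue_measure]_(s in D) f (s, x)).
Proof.
move=> mD mf.
have h := @measurable_Rintegral_param R _ _ X (measurableTypeR R) lebesgue_measure D
  (fun a => f (a.2, a.1)) mD.
apply: h; apply: (measurableT_comp mf).
exact: measurable_swap.
Qed.

End lebesgue_parameter.

Lemma ae_eq_integrable (R : realType) (d : measure_display) (Y : measurableType d)
    (mu : {measure set Y -> \bar R}) (D : set Y) (f g : Y -> \bar R) :
  measurable D -> measurable_fun D g -> ae_eq mu D f g ->
  mu.-integrable D f -> mu.-integrable D g.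
Proof.
move=> mD mg fg /integrableP[mf fi]; apply/integrableP; split => //.
suff -> : (\int[mu]_(x in D) `|g x| = \int[mu]_(x in D) `|f x|)%E by [].
apply: ae_eq_integral => //.
- exact: measurableT_comp.
- exact: measurableT_comp.
- by move: fg; apply: filterS => x /[apply] ->.
Qed.

(** * The derivative of an expectation at a maximum *)

Section differentiation_under_expectation.
Context {R : realType} {d : measure_display} {Om : measurableType d}.
Variable P : probability Om R.
Local Notation leb := (@lebesgue_measure R).

(** The part of [x] beyond the level [K]; uniform integrability bounds its
    expectation. *)
Definition excess (K x : R) : R := if K < `|x| then `|x| else 0.
Definition trunc (K x : R) : R := Num.max (- K) (Num.min K x).

Lemma excess_ge0 K x : 0 <= excess K x.
Proof. by rewrite /excess; case: ifPn. Qed.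

Lemma measurable_excess (K : R) : measurable_fun setT (excess K).
Proof.
by apply: measurable_fun_ifT => //; apply: measurable_fun_ltr.
Qed.

Lemma measurable_trunc (K : R) : measurable_fun setT (trunc K).
Proof. by apply: measurable_maxr => //; exact: measurable_minr. Qed.

Lemma trunc_dist (K x : R) : 0 <= K -> `|x - trunc K x| <= `|x| - Num.min K `|x|.
Proof.
move=> K0; rewrite /trunc; case: (leP K x) => Kx.
  rewrite max_r; last lra.
  by rewrite !ger0_norm ?min_l //; lra.
case: (leP (- K) x) => Kx'; first by rewrite subrr normr0 subr_ge0 ge_min lexx orbT.
by rewrite ler0_norm ?[`|x|]ler0_norm ?min_l; lra.
Qed.

Lemma trunc_dist_excess (K x : R) : 0 <= K -> `|x - trunc K x| <= excess K x.
Proof.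
move=> K0; apply: le_trans (trunc_dist _ K0) _.
rewrite /excess; case: ifPn => [h|]; last by rewrite -leNgt => h; rewrite min_r// subrr.
by rewrite min_l ?(ltW h)//; lra.
Qed.

Lemma norm_trunc (K x : R) : 0 <= K -> `|trunc K x| <= K.
Proof.
move=> K0; rewrite ler_norml /trunc le_max lexx/= ge_max ge_min lexx/= andbT.
by rewrite ge0_cp.
Qed.

Lemma continuous_trunc (K : R) : continuous (trunc K).
Proof.
move=> x; apply: (@continuous_max R R (fun=> - K) (fun x => Num.min K x)).
  exact: cvg_cst.
by apply: (@continuous_min R R (fun=> K) id); [exact: cvg_cst|exact: cvg_id].
Qed.

Lemma integral_excess (f : Om -> R) (K : R) :
  (\int[P]_(om in [set om | (K < `|f om|)%R]) `|f om|%:E =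
   \int[P]_om (excess K (f om))%:E)%E.
Proof.
rewrite integral_mkcond; apply: eq_integral => om _; rewrite /patch /excess.
case: ifPn => [/set_mem/= ->//|/negP h]; case: ifPn => // h'.
by exfalso; apply: h; exact: mem_set.
Qed.

Lemma excess_le (K K' x : R) : K <= K' -> excess K' x <= excess K x.
Proof.
move=> KK; rewrite /excess; case: ifPn => [h|_]; first by rewrite (le_lt_trans KK h).
by case: ifPn.
Qed.

Lemma norm_le_excess (K x : R) : 0 <= K -> `|x| <= K + excess K x.
Proof.
move=> K0; rewrite /excess; case: ifPn => [_|]; first by rewrite lerDr.
by rewrite -leNgt addr0.
Qed.

Lemma integrable_of_excess (f : Om -> R) (K e : R) : 0 <= K ->
  measurable_fun setT f ->
  (\int[P]_om (excess K (f om))%:E <= e%:E)%E ->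
  P.-integrable setT (EFin \o f).
Proof.
move=> K0 mf fe; apply/integrableP; split; first exact/measurable_EFinP.
apply: (@le_lt_trans _ _ (\int[P]_om (K%:E + (excess K (f om))%:E))%E).
  apply: ge0_le_integral => //=.
  - by apply/measurable_EFinP; exact: measurableT_comp.
  - apply: emeasurable_funD => //; apply/measurable_EFinP.
    by apply: measurableT_comp => //; exact: measurable_excess.
  - by move=> om _; rewrite -EFinD lee_fin; exact: norm_le_excess.
rewrite ge0_integralD//=; last 2 first.
- by move=> om _; rewrite lee_fin; exact: excess_ge0.
- by apply/measurable_EFinP; apply: measurableT_comp => //; exact: measurable_excess.
rewrite integral_cst//= probability_setT mule1.
by apply: (@le_lt_trans _ _ (K%:E + e%:E)%E); [exact: leeD2l|rewrite -EFinD ltry].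
Qed.

Section one_sided.
Variables (psi : R -> Om -> R) (delta : R).
Hypothesis delta0 : 0 < delta.
Hypothesis mpsi : forall y, measurable_fun setT (psi y).
Hypothesis ipsi : forall y, `|y| < delta -> P.-integrable setT (EFin \o psi y).
Hypothesis dpsi : forall om y, `|y| < delta -> derivable (psi ^~ om) y 1.
Hypothesis uipsi : forall e : R, 0 < e -> exists K : R, forall y, `|y| < delta ->
  (\int[P]_om (excess K (derive1 (psi ^~ om) y))%:E <= e%:E)%E.

Let cpsi om y : `|y| < delta -> {for y, continuous (psi ^~ om)}.
Proof.
by move=> yd; apply: differentiable_continuous; apply/derivable1_diffP; exact: dpsi.
Qed.

Let mpsi_comp (g : R * Om -> R) : measurable_fun setT g ->
  (forall a, `|g a| < delta) -> measurable_fun setT (fun a => psi (g a) a.2).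
Proof.
move=> mg gd; apply: (measurable_caratheodory (h := fun a y => psi y a.2)) => //.
- by move=> y; exact: measurableT_comp.
- by move=> a; apply: cpsi.
Qed.

Let diff_quot (y : R) om := (psi y om - psi 0 om) / y.

Let mDpsi (y : R) : 0 <= y < delta ->
  measurable_fun setT (fun a : R * Om => derive1 (psi ^~ a.2) (clamp y a.1)).
Proof.
move=> /andP[y0 yd].
pose tau n : R := (delta - y) / n.+2%:R.
have dy : 0 < delta - y by rewrite subr_gt0.
have tau0 n : 0 < tau n by rewrite divr_gt0.
have tau_lt n : tau n < delta - y.
  by rewrite /tau ltr_pdivrMr// ltr_pMr// ltr1n.
have cl (a : R * Om) : 0 <= clamp y a.1 <= y by exact: clamp_itv.
have clt (a : R * Om) : `|clamp y a.1| < delta.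
  by have /andP[? ?] := cl a; rewrite ger0_norm// (le_lt_trans _ yd).
apply: (@measurable_fun_cvg _ _ _ _ (fun (n : nat) (a : R * Om) =>
    (tau n)^-1 * (psi (tau n + clamp y a.1) a.2 - psi (clamp y a.1) a.2))) => [n|a _].
  apply: measurable_funM => //; apply: measurable_funB; apply: mpsi_comp => //.
  - by apply: measurable_funD => //; exact: measurable_clamp_fst.
  - move=> a; have /andP[? ?] := cl a; have := tau_lt n; have := tau0 n => ? ?.
    by rewrite ger0_norm; lra.
  - exact: measurable_clamp_fst.
have := @dpsi a.2 _ (clt a); rewrite /derivable => /cvg_ex[l hl].
have -> : derive1 (psi ^~ a.2) (clamp y a.1) = l.
  by rewrite derive1E; apply/cvg_lim.
move/cvgr_dnbhsP : hl => /(_ tau).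
rewrite (_ : (fun n => (tau n)^-1 * _) = (fun n => (tau n)^-1 *:
    (((psi ^~ a.2) \o shift (clamp y a.1)) (tau n *: 1) - psi (clamp y a.1) a.2))).
  apply; split; first by move=> n; rewrite gt_eqF.
  rewrite -(mulr0 (delta - y)); apply: cvgM; first exact: cvg_cst.
  by have := @cvg_harmonic R; rewrite -cvg_shiftS.
by apply/funext => n; rewrite /GRing.scale/= mulr1.
Qed.

Let mD0 : measurable_fun setT (fun om => derive1 (psi ^~ om) 0).
Proof.
have d0 : (0 : R) <= 0 < delta by rewrite lexx.
have := measurableT_comp (mDpsi d0) (@pair1_measurable _ _ R Om (0 : R)).
apply: eq_measurable_fun => om _ /=.
by rewrite clamp_id ?lexx.
Qed.

(** Since the absolute derivative is at most [K] plus its excess,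
    [abs_increment_le_integral] bounds the difference quotient by [K] plus the
    mean of the excess over [0, y]; truncation at [K] removes at most that
    mean. *)
Let quot_excess (K y : R) om : 0 <= K -> 0 < y < delta ->
  (`|diff_quot y om - trunc K (diff_quot y om)|%:E <=
   (y^-1)%:E * \int[leb]_(s in `[0%R, y]) (excess K (derive1 (psi ^~ om) (clamp y s)))%:E)%E.
Proof.
move=> K0 /andP[y0 yd].
have y0d : 0 <= y < delta by rewrite (ltW y0).
have yE : y \in Num.pos by rewrite posrE.
have in_delta x : 0 <= x <= y -> `|x| < delta.
  by move=> /andP[x0 xy]; rewrite ger0_norm// (le_lt_trans xy).
have mD : measurable_fun setT (fun s => derive1 (psi ^~ om) (clamp y s)).
  exact: (measurableT_comp (mDpsi y0d) (pair2_measurable om)).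
have mD' : measurable_fun `[0, y] (derive1 (psi ^~ om)).
  apply: (eq_measurable_fun (fun s => derive1 (psi ^~ om) (clamp y s))); last first.
    exact: measurable_funTS.
  by move=> s /set_mem/=; rewrite in_itv/= => ?; rewrite clamp_id.
set J := (X in (_ <= _ * X)%E).
have := abs_increment_le_integral (ltW y0) (fun x xy => @dpsi om _ (in_delta x xy)) mD'.
set I := (X in (_ <= X)%E) => hI.
have mex : measurable_fun `[0, y]%classic (fun s => (excess K (derive1 (psi ^~ om) (clamp y s)))%:E).
  apply/measurable_EFinP/measurable_funTS; apply: measurableT_comp => //.
  exact: measurable_excess.
have IJ : (I <= K%:E * y%:E + J)%E.
  apply: (@le_trans _ _ (\int[leb]_(s in `[0%R, y]) (K%:E + (excess K (derive1 (psi ^~ om) (clamp y s)))%:E))%E).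
    apply: ge0_le_integral => //.
    - by apply/measurable_EFinP; exact: measurableT_comp.
    - exact: emeasurable_funD.
    - move=> s; rewrite /= in_itv/= => sy.
      by rewrite clamp_id// -EFinD lee_fin; exact: norm_le_excess.
  rewrite ge0_integralD//=; last first.
    by move=> s _; rewrite lee_fin; exact: excess_ge0.
  apply: leeD2r; rewrite integral_cst//= lebesgue_measure_itv/= lte_fin y0.
  by rewrite oppr0 adde0.
have J0 : (0 <= J)%E by apply: integral_ge0 => s _; rewrite lee_fin; exact: excess_ge0.
case: J J0 IJ => [j| |] // J0 IJ; last first.
  by rewrite gt0_muley ?leey// lte_fin invr_gt0.
move: J0; rewrite lee_fin => J0.
have /= := le_trans hI IJ; rewrite -EFinM -EFinD lee_fin => hle.
rewrite -EFinM lee_fin.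
apply: le_trans (trunc_dist _ K0) _.
have hq : `|diff_quot y om| <= K + y^-1 * j.
  by rewrite /diff_quot normrM normfV (gtr0_norm y0) ler_pdivrMr// mulrDl mulrAC mulVf ?mul1r// gt_eqF.
have hj : 0 <= y^-1 * j by rewrite mulr_ge0// invr_ge0 ltW.
by case: (leP K `|diff_quot y om|) => h; [lra|rewrite subrr].
Qed.

Let mDy (y : R) : 0 <= y < delta ->
  measurable_fun setT (fun om => derive1 (psi ^~ om) y).
Proof.
move=> yd; have := measurableT_comp (mDpsi yd) (@pair1_measurable _ _ R Om y).
apply: eq_measurable_fun => om _ /=.
by rewrite clamp_id ?lexx ?andbT//; case/andP: yd.
Qed.

Let excess_nneg (e : R) : 0 < e -> exists2 K : R, 0 <= K & forall y, 0 <= y < delta ->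
  (\int[P]_om (excess K (derive1 (psi ^~ om) y))%:E <= e%:E)%E.
Proof.
move=> /uipsi[K HK]; exists (Num.max K 0); first by rewrite le_max lexx orbT.
move=> y yd; have yd' : `|y| < delta by case/andP: yd => ? ?; rewrite ger0_norm.
apply: le_trans (HK _ yd'); apply: ge0_le_integral => //=.
- by move=> om _; rewrite lee_fin; exact: excess_ge0.
- by apply/measurable_EFinP/measurableT_comp; [exact: measurable_excess|exact: mDy].
- by apply/measurable_EFinP/measurableT_comp; [exact: measurable_excess|exact: mDy].
- by move=> om _; rewrite lee_fin; apply: excess_le; rewrite le_max lexx.
Qed.

Lemma integrable_derivative_at0 :
  P.-integrable setT (EFin \o (fun om => derive1 (psi ^~ om) 0)).
Proof.
have [K K0 HK] := excess_nneg (@ltr01 R).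
apply: (integrable_of_excess K0 mD0 (e := 1)).
by apply: HK; rewrite lexx.
Qed.

Let mdq y : measurable_fun setT (diff_quot y).
Proof. by apply: measurable_funM => //; exact: measurable_funB. Qed.

Let idq y : 0 < y < delta -> P.-integrable setT (EFin \o diff_quot y).
Proof.
move=> /andP[y0 yd].
have iy : P.-integrable setT (EFin \o psi y) by apply: ipsi; rewrite gtr0_norm.
have i0 : P.-integrable setT (EFin \o psi 0) by apply: ipsi; rewrite normr0.
have := integrableZl measurableT y^-1 (integrableB measurableT iy i0).
apply: eq_integrable => // om _ /=.
by rewrite -EFinB -EFinM mulrC.
Qed.

Let integrable_bounded (f : Om -> R) (K : R) : measurable_fun setT f ->
  (forall om, `|f om| <= K) -> P.-integrable setT (EFin \o f).
Proof.
move=> mf fK; apply: measurable_bounded_integrable => //.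
  by rewrite -ge0_fin_numE// fin_num_measure.
by exists K; split; [exact: num_real|move=> M KM om _ /=; exact: le_trans (fK om) (ltW KM)].
Qed.

Let mtr (f : Om -> R) K : measurable_fun setT f -> measurable_fun setT (fun om => trunc K (f om)).
Proof. by move=> mf; apply: measurableT_comp => //; exact: measurable_trunc. Qed.

Let itr (f : Om -> R) K : 0 <= K -> measurable_fun setT f ->
  P.-integrable setT (EFin \o (fun om => trunc K (f om))).
Proof.
move=> K0 mf; apply: integrable_bounded; first exact: mtr.
by move=> om; exact: norm_trunc.
Qed.

Let itrdist (f : Om -> R) K : 0 <= K -> P.-integrable setT (EFin \o f) ->
  P.-integrable setT (EFin \o (fun om => `|f om - trunc K (f om)|)).
Proof.
move=> K0 if_; have mf : measurable_fun setT f.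
  by apply/measurable_EFinP; exact: measurable_int if_.
have := integrable_norm (integrableB measurableT if_ (itr K0 mf)).
by apply: eq_integrable.
Qed.

(** Tonelli: the mean over [0, y] of expectations that are at most [e]. *)
Let integral_quot_dist (K e y : R) : 0 <= K -> 0 < y < delta ->
  (forall y, 0 <= y < delta ->
  (\int[P]_om (excess K (derive1 (psi ^~ om) y))%:E <= e%:E)%E) ->
  (\int[P]_om `|diff_quot y om - trunc K (diff_quot y om)|%:E <= e%:E)%E.
Proof.
move=> K0 y0d HK; have /andP[y0 yd] := y0d.
have yd' : 0 <= y < delta by rewrite (ltW y0).
pose g (a : R * Om) := (excess K (derive1 (psi ^~ a.2) (clamp y a.1)))%:E.
have mg : measurable_fun setT g.
  apply/measurable_EFinP/measurableT_comp; first exact: measurable_excess.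
  exact: mDpsi.
have g0 a : (0 <= g a)%E by rewrite lee_fin; exact: excess_ge0.
have mG : measurable_fun setT (fun om => \int[leb]_(s in `[0%R, y]) g (s, om))%E.
  exact: measurable_lebesgue_integral_param.
apply: (@le_trans _ _ (\int[P]_om ((y^-1)%:E * \int[leb]_(s in `[0%R, y]) g (s, om)))%E).
  apply: ge0_le_integral => //=.
  - apply/measurable_EFinP; apply: measurableT_comp => //.
    by apply: measurable_funB => //; exact: mtr.
  - by apply: emeasurable_funM.
  - by move=> om _; exact: quot_excess.
rewrite ge0_integralZl//=; last 2 first.
- by move=> om _; exact: integral_ge0.
- by rewrite lee_fin invr_ge0 ltW.
rewrite tonelli_swap//.
apply: (@le_trans _ _ ((y^-1)%:E * (e%:E * y%:E))%E); last first.
  by rewrite -!EFinM mulrCA mulVf ?mulr1// gt_eqF.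
rewrite lee_wpmul2l//; first by rewrite lee_fin invr_ge0 ltW.
have -> : (e%:E * y%:E = \int[leb]_(s in `[0%R, y]) (cst e%:E s))%E.
  by rewrite integral_cst//= lebesgue_measure_itv/= lte_fin y0 oppr0 adde0.
apply: ge0_le_integral => //=.
- by move=> s _; exact: integral_ge0.
- apply: measurable_funTS.
  exact: (@measurable_integral_param R _ _ R Om P setT g).
- move=> s _.
  have /andP[h1 h2] := clamp_itv s (ltW y0).
  have h3 : 0 <= clamp y s < delta by rewrite h1; exact: le_lt_trans h2 yd.
  exact: (HK _ h3).
Qed.

(** The quotients to the right of 0 have nonpositive expectations, hence the
    truncated quotients have expectations at most [e]; these converge boundedly,
    and the truncation of the limit costs another [e]. *)
Lemma mean_derivative_at0_le0 :
  (forall y, 0 < y < delta ->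
    (\int[P]_om (psi y om)%:E <= \int[P]_om (psi 0 om)%:E)%E) ->
  (\int[P]_om (derive1 (psi ^~ om) 0)%:E <= 0)%E.
Proof.
move=> hmax; apply/lee_addgt0Pr => e' e'0; rewrite add0e.
pose e := e' / 2.
have e0 : 0 < e by rewrite divr_gt0.
have [K K0 HK] := excess_nneg e0.
pose D0 om := derive1 (psi ^~ om) 0.
pose y n : R := delta / n.+2%:R.
have y0d n : 0 < y n < delta.
  by rewrite divr_gt0//= ltr_pdivrMr// ltr_pMr// ltr1n.
have step n : (\int[P]_om (trunc K (diff_quot (y n) om))%:E <= e%:E)%E.
  set q := diff_quot (y n).
  have iq : P.-integrable setT (EFin \o q) by exact: idq.
  apply: (@le_trans _ _ (\int[P]_om ((q om)%:E + `|q om - trunc K (q om)|%:E))%E).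
    apply: le_integral => //; first by apply: itr => //; exact: mdq.
      by apply: integrableD => //; exact: itrdist.
    move=> om _; rewrite -EFinD lee_fin.
    by rewrite -lerBlDl -normrN opprB ler_norm.
  rewrite integralD//; last exact: itrdist.
  rewrite -[leRHS]add0e; apply: leeD; last exact: integral_quot_dist.
  have /andP[y0 yd] := y0d n.
  have iy : P.-integrable setT (EFin \o psi (y n)) by apply: ipsi; rewrite gtr0_norm.
  have i0 : P.-integrable setT (EFin \o psi 0) by apply: ipsi; rewrite normr0.
  have -> : (\int[P]_om (q om)%:E = ((y n)^-1)%:E *
      (\int[P]_om (psi (y n) om)%:E - \int[P]_om (psi 0 om)%:E))%E.
    rewrite -integralB// -integralZl//; last exact: integrableB.
    by apply: eq_integral => om _; rewrite -EFinB -EFinM mulrC.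
  rewrite mule_ge0_le0 ?lee_fin ?invr_ge0 ?(ltW y0)//.
  by rewrite sube_le0; exact: hmax.
have cvq om : diff_quot (y n) om @[n --> \oo] --> D0 om.
  have d0 : `|0 : R| < delta by rewrite normr0.
  have := @dpsi om _ d0; rewrite /derivable => /cvg_ex[l hl].
  have -> : D0 om = l by rewrite /D0 derive1E; apply/cvg_lim.
  move/cvgr_dnbhsP : hl => /(_ y).
  rewrite (_ : (fun n => diff_quot _ _) = (fun n => (y n)^-1 *:
      (((psi ^~ om) \o shift 0) (y n *: 1) - psi 0 om))).
    apply; split; first by move=> n; rewrite gt_eqF//; have /andP[] := y0d n.
    rewrite -(mulr0 delta); apply: cvgM; first exact: cvg_cst.
    by have := @cvg_harmonic R; rewrite -cvg_shiftS.
  by apply/funext => n; rewrite /GRing.scale/= mulr1 addr0 mulrC.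
have limit : (\int[P]_om (trunc K (D0 om))%:E <= e%:E)%E.
  have [_ _ cv] : [/\ P.-integrable setT (fun om => (trunc K (D0 om))%:E),
      (fun n => \int[P]_om `|(trunc K (diff_quot (y n) om))%:E - (trunc K (D0 om))%:E|)%E @ \oo --> 0%E &
      (fun n => \int[P]_om (trunc K (diff_quot (y n) om))%:E)%E @ \oo -->
        (\int[P]_om (trunc K (D0 om))%:E)%E].
    apply: (@dominated_convergence _ Om R P setT measurableT
      (fun n om => (trunc K (diff_quot (y n) om))%:E) (fun om => (trunc K (D0 om))%:E)
      (cst K%:E)).
    - by move=> n; apply/measurable_EFinP; exact: mtr.
    - by apply/measurable_EFinP; exact: mtr.
    - apply: aeW => om _; apply: cvg_EFin; first exact: nearW.
      apply: (@continuous_cvg _ _ _ _ _ _ (trunc K)); first exact: continuous_trunc.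
      exact: cvq.
    - exact: finite_measure_integrable_cst.
    - by apply: aeW => om n _; rewrite lee_fin; exact: norm_trunc.
  rewrite -(cvg_lim _ cv)//; apply: lime_le; first by apply/cvg_ex; eexists; exact: cv.
  exact: nearW.
apply: (@le_trans _ _ (\int[P]_om ((trunc K (D0 om))%:E + `|D0 om - trunc K (D0 om)|%:E))%E).
  apply: le_integral => //; first exact: integrable_derivative_at0.
    apply: integrableD => //; [exact: itr|apply: itrdist => //].
    exact: integrable_derivative_at0.
  move=> om _; rewrite -EFinD lee_fin.
  by rewrite -lerBlDl ler_norm.
rewrite integralD//; [|exact: itr|by apply: itrdist => //; exact: integrable_derivative_at0].
have -> : e' = e + e by rewrite /e -splitr.
rewrite EFinD; apply: leeD => //.
apply: le_trans (HK 0 _); last by rewrite lexx.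
apply: ge0_le_integral => //=.
- apply/measurable_EFinP; apply: measurableT_comp => //.
  by apply: measurable_funB => //; exact: mtr.
- by apply/measurable_EFinP/measurableT_comp; [exact: measurable_excess|exact: mD0].
- by move=> om _; rewrite lee_fin; exact: trunc_dist_excess.
Qed.

End one_sided.
(** The null set where [phi] is not differentiable is removed by setting [psi]
    to 0 there; the same estimate for [psi (- y)] gives the opposite
    inequality. *)
Lemma mean_derivative_at_max (phi : R -> Om -> R) (delta : R) :
  0 < delta ->
  (forall y, `|y| < delta -> P.-integrable setT (EFin \o phi y)) ->
  {ae P, forall om, forall y, `|y| < delta -> derivable (phi ^~ om) y 1} ->
  (forall y, `|y| < delta -> measurable_fun setT (fun om => derive1 (phi ^~ om) y)) ->
  uniformly_integrable P [set y | `|y| < delta] (fun y om => derive1 (phi ^~ om) y) ->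
  (forall y, `|y| < delta -> (\int[P]_om (phi y om)%:E <= \int[P]_om (phi 0 om)%:E)%E) ->
  P.-integrable setT (EFin \o (fun om => derive1 (phi ^~ om) 0)) /\
  (\int[P]_om (derive1 (phi ^~ om) 0)%:E = 0)%E.
Proof.
move=> delta0 iphi [N [mN PN0 Nd]] mdphi ui hmax.
have nN om : ~ N om -> forall y, `|y| < delta -> derivable (phi ^~ om) y 1.
  by move=> nN; apply: contrapT => h; apply: nN; exact: Nd.
pose psi y om := if (`|y| < delta) && (om \notin N) then phi y om else 0.
have psiN y om : om \in N -> psi y om = 0 by move=> oN; rewrite /psi oN andbF.
have nearphi om y : `|y| < delta -> om \notin N -> \near y, psi y om = phi y om.
  move=> yd oN; rewrite /psi oN; near=> y'.
  suff -> : `|y'| < delta by [].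
  near: y'; have := @norm_continuous _ _ y; move/cvgr_lt; exact.
have mnN : measurable_fun setT (fun om => om \notin N).
  have := measurable_indic (D := setT) mN.
  move=> h; rewrite (_ : (fun om => _) = (fun om => (\1_N om : R) == 0)).
    exact: measurable_fun_eqr.
  by apply/funext => om; rewrite indicE pnatr_eq0 eqb0.
have psi_d om y : `|y| < delta -> derivable (psi ^~ om) y 1 /\
    derive1 (psi ^~ om) y = if om \notin N then derive1 (phi ^~ om) y else 0.
  move=> yd; case: ifPn => oN.
    have np := nearphi om y yd oN.
    split; last by rewrite !derive1E; apply: near_eq_derive => //; rewrite oner_eq0.
    apply: (near_eq_derivable _ (f := phi ^~ om)); rewrite ?oner_eq0//.
      by apply: filterS np => z ->.
    by apply: nN => // No; move/negP: oN; apply; exact: mem_set.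
  have -> : (psi ^~ om) = cst 0 by apply/funext => z; rewrite psiN// -[_ \in _]negbK.
  by split; [exact: derivable_cst|rewrite derive1_cst].
have mpsi y : measurable_fun setT (psi y).
  have [yd|/negbTE yd] := boolP (`|y| < delta); last first.
    by rewrite /psi; under eq_fun do rewrite yd/=; exact: measurable_cst.
  rewrite /psi; under eq_fun do rewrite yd/=.
  apply: measurable_fun_ifT => //.
  by apply/measurable_EFinP; exact: measurable_int (iphi y yd).

have ae_phi y : `|y| < delta -> ae_eq P setT (EFin \o phi y) (EFin \o psi y).
  move=> yd; exists N; split => // om /= h; apply: contrapT => oN; apply: h => _.
  by rewrite /psi yd/=; case: ifPn => // /negPn /set_mem.
have ipsi y : `|y| < delta -> P.-integrable setT (EFin \o psi y).
  move=> yd; apply: (ae_eq_integrable _ _ (ae_phi y yd)) => //; last exact: iphi.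
  by apply/measurable_EFinP.
have ae_D y : `|y| < delta -> ae_eq P setT (EFin \o (fun om => derive1 (psi ^~ om) y))
    (EFin \o (fun om => derive1 (phi ^~ om) y)).
  move=> yd; exists N; split => // om /= h; apply: contrapT => oN; apply: h => _.
  by rewrite (psi_d om y yd).2; case: ifPn => // /negPn /set_mem.
have mD y : `|y| < delta -> measurable_fun setT (fun om => derive1 (psi ^~ om) y).
  move=> yd; under eq_fun do rewrite (psi_d _ y yd).2.
  by apply: measurable_fun_ifT => //; exact: mdphi.
have uipsi (e : R) : 0 < e -> exists K : R, forall y, `|y| < delta ->
    (\int[P]_om (excess K (derive1 (psi ^~ om) y))%:E <= e%:E)%E.
  move=> /ui[K HK]; exists K => y yd.
  apply: le_trans (HK y yd); rewrite integral_excess; apply: ge0_le_integral => //.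
  - by move=> om _; rewrite lee_fin; exact: excess_ge0.
  - by apply/measurable_EFinP/measurableT_comp; [exact: measurable_excess|exact: mD].
  - by apply/measurable_EFinP/measurableT_comp; [exact: measurable_excess|exact: mdphi].
  - move=> om _; rewrite lee_fin (psi_d om y yd).2; case: ifPn => // _.
    by apply: le_trans (excess_ge0 K _); rewrite /excess normr0; case: ifP.
have d0 : `|0 : R| < delta by rewrite normr0.
have int_psi y : `|y| < delta -> (\int[P]_om (psi y om)%:E = \int[P]_om (phi y om)%:E)%E.
  move=> yd; apply: ae_eq_integral => //.
  - exact/measurable_EFinP.
  - exact: measurable_int (iphi y yd).
  - by have := ae_phi y yd; apply: filterS => om /[apply] /= ->.
have psimax y : `|y| < delta -> (\int[P]_om (psi y om)%:E <= \int[P]_om (psi 0 om)%:E)%E.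
  by move=> yd; rewrite !int_psi//; exact: hmax.
have dpsi om y : `|y| < delta -> derivable (psi ^~ om) y 1 by move=> /(psi_d om)[].
have iD0 := integrable_derivative_at0 delta0 mpsi dpsi uipsi.
have le0 : (\int[P]_om (derive1 (psi ^~ om) 0)%:E <= 0)%E.
  apply: (mean_derivative_at0_le0 delta0 mpsi ipsi dpsi uipsi) => y /andP[y0 yd].
  by apply: psimax; rewrite gtr0_norm.
pose chi y := psi (- y).
have normNd (y : R) : `|y| < delta -> `|- y| < delta by rewrite normrN.
have chi_is om (y : R) : `|y| < delta ->
    is_derive y 1 (chi ^~ om) (- derive1 (psi ^~ om) (- y)).
  move=> yd; rewrite -mulrN1.
  apply: (@is_derive1_comp _ (psi ^~ om) -%R).
    by rewrite derive1E; apply: DeriveDef => //; exact/dpsi/normNd.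

have chi_d om (y : R) : `|y| < delta -> derivable (chi ^~ om) y 1.
  by move=> /(chi_is om) [].
have chi_D om (y : R) : `|y| < delta -> derive1 (chi ^~ om) y = - derive1 (psi ^~ om) (- y).
  by move=> yd; rewrite derive1E; have [] := chi_is om y yd.
have uichi (e : R) : 0 < e -> exists K : R, forall y, `|y| < delta ->
    (\int[P]_om (excess K (derive1 (chi ^~ om) y))%:E <= e%:E)%E.
  move=> /uipsi[K HK]; exists K => y yd.
  under eq_integral do rewrite chi_D// /excess normrN.
  exact/HK/normNd.
have ge0 : (\int[P]_om (derive1 (chi ^~ om) 0)%:E <= 0)%E.
  apply: (mean_derivative_at0_le0 delta0 (fun y => mpsi (- y)) (fun y yd => ipsi (- y) (normNd y yd)) chi_d uichi) => y /andP[y0 yd].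
  by rewrite /chi oppr0; apply: psimax; rewrite normrN gtr0_norm.
have eqD : (\int[P]_om (derive1 (phi ^~ om) 0)%:E = \int[P]_om (derive1 (psi ^~ om) 0)%:E)%E.
  apply: ae_eq_integral => //.
  - by apply/measurable_EFinP; exact: mdphi.
  - by apply/measurable_EFinP; exact: mD.
  - by have := ae_D 0 d0; apply: filterS => om /[apply] /= ->.
split.
  apply: (ae_eq_integrable measurableT _ (ae_D 0 d0) iD0).
  by apply/measurable_EFinP; exact: mdphi.
rewrite eqD; apply/eqP; rewrite eq_le le0/=.
have E : (\int[P]_om (derive1 (chi ^~ om) 0)%:E =
    \int[P]_om (- (EFin \o (fun om => derive1 (psi ^~ om) 0)) om))%E.
  by apply: eq_integral => om _; rewrite (chi_D om 0 d0) oppr0.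
by move: ge0; rewrite E (integralN (integrable_add_def _ iD0))// leeNl oppe0.
Unshelve. all: by end_near.
Qed.

End differentiation_under_expectation.

(** * Sub-sigma-algebras, null sets and convergence in probability *)

Section sub_sigma_algebras.
Context {R : realType} {d : measure_display} {Om : measurableType d}.
Variable P : probability Om R.
Implicit Types (S : set (set Om)) (Z : Om -> R).

(** Measurability for the type whose measurable sets are generated by [S]: the
    closure properties of measurable functions apply to it. *)
Definition S_measurable S Z :=
  measurable_fun (setT : set (g_sigma_algebraType S)) (Z : g_sigma_algebraType S -> R).

Lemma S_measurableP S Z : sigma_algebra setT S ->
  S_measurable S Z <-> sub_measurable S Z.
Proof.
move=> sS; split=> mZ.
  move=> B mB; have := mZ measurableT B mB.
  by rewrite setTI /measurable/= sigma_algebra_id.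
move=> _ B mB; rewrite setTI; apply: sub_sigma_algebra; exact: mZ.
Qed.

Lemma S_measurable_sub S S' Z : S `<=` S' -> S_measurable S Z -> S_measurable S' Z.
Proof.
move=> SS' mZ _ B mB; have := mZ measurableT B mB.
exact: sub_sigma_algebra2.
Qed.

Lemma S_measurable_measurable S Z : sigma_algebra setT S -> S `<=` measurable ->
  S_measurable S Z -> measurable_fun setT Z.
Proof.
move=> sS Sm /(S_measurableP _ sS) mZ _ B mB; rewrite setTI.
exact/Sm/mZ.
Qed.

Definition contains_null S := forall A, P.-negligible A -> S A.

(** Off a null set, which belongs to [S], the variable is a pointwise limit; on
    the null set every subset belongs to [S]. *)
Lemma measurable_ae_cvg S (Zn : nat -> Om -> R) Z :
  contains_null S -> (forall n, S_measurable S (Zn n)) ->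
  {ae P, forall om, Zn n om @[n --> \oo] --> Z om} -> S_measurable S Z.
Proof.
move=> S0 mZn.
pose Om0 := [set om | Zn n om @[n --> \oo] --> Z om].
move=> aeZ.
have S_N : S (~` Om0) by exact: S0.
have mOm0 : measurable (Om0 : set (g_sigma_algebraType S)).
  by rewrite -[Om0]setCK; apply: measurableC; exact: sub_sigma_algebra.
pose Zlim om := if om \in Om0 then Z om else 0.
have mlim : S_measurable S Zlim.
  apply: (@measurable_fun_cvg _ (g_sigma_algebraType S) R setT
    (fun n om => if om \in Om0 then Zn n om else 0)).
    move=> n; apply: measurable_fun_ifT => //.
      rewrite (_ : (fun om => _) = (fun om => (\1_Om0 om : R) != 0)).
        by apply: measurable_neg; apply: measurable_fun_eqr => //; exact: measurable_indic.
      by apply/funext => om; rewrite indicE pnatr_eq0 eqb0 negbK.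
    exact: mZn.
  move=> om _; rewrite /Zlim; case: ifPn => [/set_mem//|_]; exact: cvg_cst.
move=> _ B mB; rewrite setTI.
rewrite (_ : _ @^-1` B = (Om0 `&` Zlim @^-1` B) `|` (~` Om0 `&` Z @^-1` B)).
  apply: measurableU.
    by apply: measurableI => //; rewrite -[X in measurable X]setTI; exact: mlim.
  apply: sub_sigma_algebra; apply: S0; apply: negligibleS aeZ; exact: subIsetl.
apply/seteqP; split=> om /=; rewrite /Zlim.
  move=> ZB; have [oO|oO] := pselect (Om0 om); [left|right] => //; split => //.
  by rewrite mem_set.
by case=> -[oO] //; rewrite mem_set.
Qed.

Lemma measurable_ae_eq S Z Z' :
  contains_null S -> S_measurable S Z ->
  {ae P, forall om, Z om = Z' om} -> S_measurable S Z'.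
Proof.
move=> S0 mZ ZZ'; apply: (@measurable_ae_cvg S (fun=> Z)) => //.
by move: ZZ'; apply: filterS => om ->; exact: cvg_cst.
Qed.

Section usual.
Variables (T : R) (H : R -> set (set Om)).
Hypothesis uH : usual_filtration P T H.

Lemma usual_sigma_algebra t : 0 <= t <= T -> sigma_algebra setT (H t).
Proof. by case: uH => h _ _ _ /h[]. Qed.

Lemma usual_measurable t : 0 <= t <= T -> H t `<=` measurable.
Proof. by case: uH => h _ _ _ /h[]. Qed.

Lemma usual_mono s t : 0 <= s -> s <= t -> t <= T -> H s `<=` H t.
Proof. by case: uH => _ h _ _; exact: h. Qed.

Lemma usual_null t : 0 <= t <= T -> contains_null (H t).
Proof.
move=> /andP[t0 tT] A A0; apply: (usual_mono (lexx 0) t0 tT).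
by case: uH => _ _ _; exact.
Qed.

Lemma usual_complete : 0 <= T -> measure_is_complete P.
Proof.
move=> T0 A A0; have h : (0 : R) <= 0 <= T by rewrite lexx.
exact: (usual_measurable h (usual_null h A0)).
Qed.

End usual.
End sub_sigma_algebras.

Section ucp_limits.
Context {R : realType} {d : measure_display} {Om : measurableType d}.
Variables (P : probability Om R) (T : R).

(** Borel-Cantelli along indices with errors summable in [n]. Two families that
    converge along the same filter get a common subsequence, so that a relation
    between their members carries over to the limits. *)
Lemma ucp_ae_subsequence (J : Type) (F : set_system J) {FF : ProperFilter F}
    (Xs Ys : J -> R -> Om -> R) (I K : R -> Om -> R) (B : nat -> set J) :
  (forall n, F (B n)) -> ucp P T F Xs I -> ucp P T F Ys K ->
  exists j : nat -> J, (forall n, B n (j n)) /\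
    {ae P, forall om, forall t, 0 <= t <= T ->
       Xs (j n) t om @[n --> \oo] --> I t om /\ Ys (j n) t om @[n --> \oo] --> K t om}.
Proof.
move=> FB uX uY.
pose e n : R := 1 / (2 ^ n.+1)%:R.
have e0 n : 0 < e n by rewrite divr_gt0// ltr0n expn_gt0.
have h0 n : 0 < (n.+1%:R^-1 : R) by rewrite invr_gt0.
have /choice[j hj] : forall n, exists j, B n j /\ exists A, [/\ measurable A,
    (P A <= (e n + e n)%:E)%E & forall om, ~ A om -> forall t, 0 <= t <= T ->
      `|Xs j t om - I t om| <= n.+1%:R^-1 /\ `|Ys j t om - K t om| <= n.+1%:R^-1].
  move=> n; have [j [[A [mA PA hA]] [[A' [mA' PA' hA']] Bj]]] :=
    filter_ex (filterI (uX _ _ (h0 n) (e0 n)) (filterI (uY _ _ (h0 n) (e0 n)) (FB n))).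
  exists j; split => //; exists (A `|` A'); split.
  - exact: measurableU.
  - by apply: le_trans (measureU2 _ mA mA') _; rewrite EFinD leeD// ltW.
  - by move=> om /not_orP[nA nA'] t t0T; split; [exact: hA|exact: hA'].
exists j; split; first by move=> n; case: (hj n).
have /choice[A hA] : forall n, exists A, [/\ measurable A,
    (P A <= (e n + e n)%:E)%E & forall om, ~ A om -> forall t, 0 <= t <= T ->
      `|Xs (j n) t om - I t om| <= n.+1%:R^-1 /\ `|Ys (j n) t om - K t om| <= n.+1%:R^-1].
  by move=> n; case: (hj n).
have mA n : measurable (A n) by case: (hA n).
exists (lim_sup_set A); split.
- by apply: bigcap_measurable => // n _; apply: bigcup_measurable => // k _; exact: mA.
- apply: lim_sup_set_cvg0 => //.
  apply: (@le_lt_trans _ _ (\sum_(0 <= n <oo) ((e n)%:E + (e n)%:E))%E).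
    by apply: lee_nneseries => // n _; case: (hA n).
  rewrite nneseriesD//; [|by move=> *; rewrite lee_fin ltW|by move=> *; rewrite lee_fin ltW].
  have h := @epsilon_trick0 R 1 predT ler01.
  by apply: (@le_lt_trans _ _ (1%:E + 1%:E)%E); [exact: leeD|rewrite -EFinD ltry].
- move=> om /= hom; apply: contrapT => nA; apply: hom.
  have [n0 hn0] : exists n0, forall n, (n0 <= n)%N -> ~ A n om.
    apply: contrapT => hn; apply: nA => n _; apply: contrapT => hk; apply: hn.
    by exists n => k nk Ak; apply: hk; exists k.
  move=> t tT; split; apply/cvgrPdist_le => eta eta0;
    have /cvgrPdist_le /(_ eta eta0) hh := @cvg_harmonic R;
    near=> n; have [_ _ hAn] := hA n;
    have nAn : ~ A n om by (apply: hn0; near: n; exact: nbhs_infty_ge).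
  + rewrite distrC; apply: le_trans (hAn _ nAn _ tT).1 _.
    have : `|0 - harmonic n| <= eta by near: n.
    by rewrite sub0r normrN ger0_norm ?harmonic_ge0.
  + rewrite distrC; apply: le_trans (hAn _ nAn _ tT).2 _.
    have : `|0 - harmonic n| <= eta by near: n.
    by rewrite sub0r normrN ger0_norm ?harmonic_ge0.
Unshelve. all: by end_near.
Qed.

Lemma ucp_ae_congr (J : Type) (F : set_system J) {FF : Filter F} (D : set J)
    (Xs Ys : J -> R -> Om -> R) (I : R -> Om -> R) :
  F D ->
  {ae P, forall om, forall j t, D j -> 0 <= t <= T -> Xs j t om = Ys j t om} ->
  ucp P T F Xs I -> ucp P T F Ys I.
Proof.
move=> FD [N [mN PN0 hN]] uX eta e eta0 e0.
near=> j.
have Dj : D j by near: j.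
have [A [mA PA hA]] : exists A, [/\ measurable A, (P A < e%:E)%E &
    forall om, ~ A om -> forall t, 0 <= t <= T -> `|Xs j t om - I t om| <= eta].
  by near: j; exact: uX.
exists (A `|` N); split.
- exact: measurableU.
- apply: le_lt_trans (measureU2 _ mA mN) _.
  by rewrite [X in (_ + X)%E](_ : _ = 0%E) ?adde0.
- move=> om /not_orP[nA nN] t tT; rewrite -(_ : Xs j t om = Ys j t om); first exact: hA.
  have : [set om | forall j t, D j -> 0 <= t <= T -> Xs j t om = Ys j t om] om.
    by apply: contrapT => h; apply: nN; exact: hN.
  exact.
Unshelve. all: by end_near.
Qed.

Lemma ucp_scale (J : Type) (F : set_system J) {FF : Filter F}
    (Xs : J -> R -> Om -> R) (I : R -> Om -> R) (c : R) :
  ucp P T F Xs I -> ucp P T F (fun j t om => c * Xs j t om) (fun t om => c * I t om).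
Proof.
move=> uX eta e eta0 e0.
have c0 : 0 < `|c| + 1 by rewrite ltr_wpDl.
have := uX (eta / (`|c| + 1)) e (divr_gt0 eta0 c0) e0.
apply: filterS => j [A [mA PA hA]]; exists A; split => // om nA t tT.
rewrite -mulrBr normrM; apply: (@le_trans _ _ (`|c| * (eta / (`|c| + 1)))).
  by apply: ler_wpM2l => //; exact: hA.
by rewrite mulrCA ger_pMr// ler_pdivrMr// mul1r lerDl.
Qed.

End ucp_limits.

(** * Forward integrals with respect to Brownian motion *)

Section forward_brownian_paths.
Context {R : realType}.
Local Notation leb := (@lebesgue_measure R).

Lemma indic_itvD (t t' s : R) : 0 <= s ->
  \1_(`[0, t']%classic `\` `[0, t]%classic) s = \1_(`]t, t']%classic) s :> R.
Proof.
move=> s0; rewrite !indicE; congr (_%:R); congr nat_of_bool.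
apply/idP/idP; rewrite !inE/= !in_itv/= s0/=.
  by move=> [-> /negP]; rewrite -ltNge => ->.
by move=> /andP[ts ->]; split => //; apply/negP; rewrite -ltNge.
Qed.

Lemma Rintegral_indic_diff (d : measure_display) (Y : measurableType d)
    (mu : {measure set Y -> \bar R}) (D A A' : set Y) (f h : Y -> R) (k : R) :
  measurable D -> measurable A -> measurable A' -> A `<=` A' -> A' `<=` D ->
  mu.-integrable D (EFin \o f) ->
  (forall x, D x -> h x = k * \1_(A' `\` A) x * f x) ->
  \int[mu]_(x in D) h x = k * (\int[mu]_(x in A') f x - \int[mu]_(x in A) f x).
Proof.
move=> mD mA mA' AA' A'D if_ hE.
have mAA : measurable (A' `\` A) by exact: measurableD.
have i' : mu.-integrable A' (EFin \o f) by exact: integrableS if_.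
have -> : \int[mu]_(x in A') f x = \int[mu]_(x in A) f x + \int[mu]_(x in A' `\` A) f x.
  rewrite -[X in \int[mu]_(x in X) _](setDUK AA') Rintegral_setU//.
    by rewrite setDUK.
  by apply/disj_setPS => x [Ax []].
rewrite addrAC subrr add0r.
rewrite -RintegralZl//; last by apply: integrableS i' => //; exact: subDsetl.
rewrite Rintegral_mkcond [RHS]Rintegral_mkcond; apply: eq_Rintegral => x _.
rewrite /patch; case: ifPn => [/set_mem Dx|/negP xD].
  rewrite hE// indicE; case: ifPn => _; first by rewrite mulr1.
  by rewrite mulr0 mul0r.
case: ifPn => // /set_mem [A'x _]; exfalso; apply: xD; apply/mem_set; exact: A'D.
Qed.

Lemma continuous_clamp (t : R) : continuous (clamp t).
Proof.
move=> x; apply: (@continuous_min R R (fun s => Num.max s 0) (fun=> t)).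
  by apply: (@continuous_max R R id (fun=> 0)); [exact: cvg_id|exact: cvg_cst].
exact: cvg_cst.
Qed.

Lemma continuous_comp_clamp (f : R -> R) (t : R) : 0 <= t ->
  {within `[0, +oo[, continuous f} -> continuous (fun s => f (clamp t s)).
Proof.
move=> t0 /subspace_continuousP cf x.
have x0 : `[0, +oo[%classic (clamp t x).
  by rewrite /= in_itv/= andbT; have /andP[] := clamp_itv x t0.
apply: (cvg_comp _ _ _ (cf _ x0)) => S [e /= e0 hS].
have /cvgrPdist_lt /(_ e e0) := @continuous_clamp t x.
apply: filterS => z hz.
apply: hS => //=; rewrite in_itv/= andbT.
by have /andP[] := clamp_itv z t0.
Qed.

Lemma bounded_comp_clamp (f : R -> R) (t : R) : 0 <= t ->
  continuous (fun s => f (clamp t s)) -> exists M, forall s, `|f (clamp t s)| <= M.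
Proof.
move=> t0 cf.
have cn : {within `[0, t], continuous (fun s => `|f (clamp t s)|)}.
  apply: continuous_subspaceT => s.
  by apply: (continuous_comp (cf s)); exact: norm_continuous.
have [c _ hc] := EVT_max t0 cn; exists `|f (clamp t c)| => s.
have cs := clamp_itv s t0.
have := hc (clamp t s); rewrite in_itv/= cs => /(_ isT).
by rewrite (clamp_id cs).
Qed.

Section path.
Variables (T : R) (x w : R -> R).
Hypothesis (T0 : 0 <= T).
Hypothesis ix : leb.-integrable `[0, T] (EFin \o x).
Hypothesis lx : forall s, 0 < s <= T -> x u @[u --> s^'-] --> x s.
Hypothesis cw : continuous w.
Hypothesis bw : exists M, forall s, `|w s| <= M.

Lemma integrable_times_increment (e t tau : R) : tau <= T ->
  leb.-integrable `[0, tau] (EFin \o (fun s => x s * (w (Num.min (s + e) t) - w s))).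
Proof.
move=> tT; have [M hM] := bw.
have i : leb.-integrable `[0, tau] (EFin \o x).
  apply: integrableS ix => //; apply: subset_itvl; by rewrite bnd_simp.
have mw : measurable_fun setT w by exact: continuous_measurable_fun.
have := @integrableMl _ _ R leb `[0, tau]%classic (measurable_itv _) (EFin \o x)
  (fun s => w (Num.min (s + e) t) - w s) i.
apply => //.
  apply: measurable_funTS; apply: measurable_funB => //.
  apply: measurableT_comp => //; apply: measurable_minr => //.
  exact: measurable_funD.
exists (M + M); split; first exact: num_real.
move=> N MN s _ /=; apply: le_trans (ltW MN).
by apply: (le_trans (ler_normB _ _)); exact: lerD.
Qed.

(** The approximations of a forward integral up to [tau] use the noise stopped
    at [tau]. Replacing this horizon by [T] changes the integrand only on ]tau -
    e, tau], where it is bounded by left-continuity at [tau] and the increment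
    of the continuous noise is small; the factor 1/e is compensated by the
    length of this interval. *)
Lemma forward_sum_horizon (tau : R) : 0 <= tau <= T ->
  e^-1 * (\int[leb]_(s in `[0, tau]) (x s * (w (Num.min (s + e) T) - w s)))
  - e^-1 * (\int[leb]_(s in `[0, tau]) (x s * (w (Num.min (s + e) tau) - w s)))
  @[e --> 0^'+] --> 0.
Proof.
move=> /andP[tau0 tauT].
have [->|tau_neq0] := eqVneq tau 0.
  rewrite set_itv1.
  under eq_fun do rewrite !Rintegral_set1 subrr.
  exact: cvg_cst.
have {}tau0 : 0 < tau by rewrite lt_neqAle eq_sym tau_neq0.
apply/cvgrPdist_le => eta eta0.
pose C := `|x tau| + 1.
have C0 : 0 < C by rewrite ltr_wpDl.
have etaC : 0 < eta / C by rewrite divr_gt0.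
have tau0T : 0 < tau <= T by rewrite tau0.
have /cvgrPdist_lt /(_ 1 ltr01) := lx tau0T.
move=> [r1 /= r10 h1].
have /cvgrPdist_le /(_ (eta / C) etaC) := @cw tau.
move=> [r2 /= r20 h2].
near=> e.
have e0 : 0 < e by near: e; exact: nbhs_right_gt.
have er1 : e < r1 by near: e; exact: nbhs_right_lt.
have er2 : e < r2 by near: e; exact: nbhs_right_lt.
rewrite sub0r normrN -mulrBr.
rewrite -RintegralB//; [|exact: integrable_times_increment|exact: integrable_times_increment].
set D := fun s => x s * (w (Num.min (s + e) T) - w s) - x s * (w (Num.min (s + e) tau) - w s).
have iD : leb.-integrable `[0, tau] (EFin \o D).
  have := @integrableB _ _ _ leb `[0, tau]%classic (measurable_itv _) _ _
    (integrable_times_increment e T tauT) (integrable_times_increment e tau tauT).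
  by apply: eq_integrable.
have Dle s : 0 <= s <= tau -> `|D s| <= eta * \1_(`]tau - e, tau]%classic) s.
  move=> /andP[s0 st].
  have DE : D s = x s * (w (Num.min (s + e) T) - w (Num.min (s + e) tau)).
    by rewrite /D; ring.
  rewrite DE indicE; have [se|se] := leP s (tau - e).
    rewrite !min_l; [|lra|lra].
    by rewrite subrr mulr0 normr0 mulr_ge0// ltW.
  rewrite mem_set/= ?in_itv/= ?se// mulr1 [X in _ - w X]min_r; last lra.
  rewrite normrM -[leRHS](@divfK _ C) ?gt_eqF// mulrC; apply: ler_pM => //.
    rewrite distrC; apply: h2 => /=.
    have [h|h] := leP (s + e) T; rewrite ler0_norm; lra.
  have [-> |st'] := eqVneq s tau; first by rewrite /C lerDl.
  have := h1 s; rewrite /ball_/= => /(_ _ _)/ltW h.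
  have : `|x tau - x s| <= 1.
    by apply: h; [rewrite ger0_norm; lra|rewrite lt_neqAle st' st].
  rewrite /C => h'; rewrite -[X in `|X|](subKr (x tau)).
  by apply: le_trans (ler_normB _ _) _; rewrite lerD2l.
rewrite normrM normfV (gtr0_norm e0) ler_pdivrMl//.
apply: (le_trans (le_normr_Rintegral _ iD)) => //.
apply: (@le_trans _ _ (\int[leb]_(s in `[0, tau]) (eta * \1_(`]tau - e, tau]%classic) s))).
  apply: le_Rintegral => //.
  - exact: integrable_norm.
  - have := @integrableZl _ _ R leb `[0, tau]%classic (measurable_itv _) eta
      (EFin \o \1_(`]tau - e, tau]%classic)).
    apply; apply: integrableS (@integrable_indic_itv R (tau - e) tau false false) => //.

rewrite /Rintegral.
have -> : (\int[leb]_(s in `[0%R, tau]) (eta * \1_(`](tau - e)%R, tau]%classic) s)%:E =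
    eta%:E * leb (`](tau - e)%R, tau]%classic `&` `[0%R, tau]))%E.
  under eq_integral do rewrite EFinM.
  rewrite ge0_integralZl_EFin ?(ltW eta0)//=; last first.
    by apply/measurable_EFinP; exact: measurable_indic.
  by rewrite integral_indic.
have le_e : (leb (`](tau - e)%R, tau]%classic `&` `[0%R, tau]) <= e%:E)%E.
  apply: (@le_trans _ _ (leb `](tau - e)%R, tau]%classic)).
    apply: (@le_measure _ _ _ leb); rewrite ?inE;
      [apply: measurableI; exact: measurable_itv|exact: measurable_itv|exact: subIsetl].
  rewrite lebesgue_measure_itv/= lte_fin; case: ifPn => _; last by rewrite lee_fin ltW.
  by rewrite -EFinB lee_fin; lra.
have fin : leb (`]tau - e, tau]%classic `&` `[0, tau]) \is a fin_num.
  by rewrite ge0_fin_numE// (le_lt_trans le_e)// ltry.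
rewrite -lee_fin fineK; last by rewrite fin_numM.
by rewrite mulrC EFinM lee_wpmul2l// lee_fin ltW.
Unshelve. all: by end_near.
Qed.

End path.
End forward_brownian_paths.

Section forward_brownian_integral.
Context {R : realType} {d : measure_display} {Om : measurableType d}.
Variables (P : probability Om R) (T : R) (H : R -> set (set Om)) (W : R -> Om -> R).
Local Notation leb := (@lebesgue_measure R).
Hypothesis T0 : 0 <= T.
Hypothesis uH : usual_filtration P T H.
Hypothesis adW : forall s t, 0 <= s -> s <= t -> t <= T -> sub_measurable (H t) (W s).
Hypothesis cW : {ae P, forall om, {within `[0, +oo[, continuous (W ^~ om)}}.

(** The forward integral is defined by choice; the choice is meaningful as soon
    as a limit exists. *)
Lemma fwdW_ucp (X : R -> Om -> R) :
  (exists I, fwdW_spec P T W X I) -> ucp P T (0 : R)^'+ (fwdW_approx W X) (fwdW P T W X).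
Proof. by move=> hI; exact: (getPex hI). Qed.

Lemma S_measurable_caglad (X : R -> Om -> R) t : caglad_adapted T H X -> 0 <= t <= T ->
  measurable_fun (setT : set (R * g_sigma_algebraType (H t))) (fun p => X (clamp t p.1) p.2).
Proof.
move=> [cX aX] /andP[t0 tT].
apply: (@caglad_jointly_measurable R _ (g_sigma_algebraType (H t)) X t t0).
  move=> s /andP[s0 st].
  apply/(S_measurableP _ (usual_sigma_algebra uH _)); first by rewrite t0.
  have sT : 0 <= s <= T by rewrite s0 (le_trans st).
  by move=> B mB; apply: (usual_mono uH s0 st tT); exact: aX.
move=> om s /andP[s0 st]; apply: (cX om).1.
by rewrite s0 (le_trans st).
Qed.

(** The noise is continuous only off a null set; there it is replaced by 0,
    after which it is jointly measurable in time and outcome. *)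
Lemma fwdW_approx_adapted (X : R -> Om -> R) e t : caglad_adapted T H X ->
  0 < e -> 0 <= t <= T -> S_measurable (H t) (fwdW_approx W X e t).
Proof.
move=> cX e0 /[dup] t0T /andP[t0 tT].
have sS := usual_sigma_algebra uH t0T.
have S0 := usual_null uH t0T.
pose Om0 := [set om | {within `[0, +oo[, continuous (W ^~ om)}].
have mOm0 : measurable (Om0 : set (g_sigma_algebraType (H t))).
  by rewrite -[Om0]setCK; apply: measurableC; apply: sub_sigma_algebra; exact: S0.
pose Wc y om := if om \in Om0 then W (clamp t y) om else 0.
have mWc y : S_measurable (H t) (Wc y).
  apply: measurable_fun_ifT => //.
    rewrite (_ : (fun om => _) = (fun om => (\1_Om0 om : R) != 0)).
      by apply: measurable_neg; apply: measurable_fun_eqr => //; exact: measurable_indic.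
    by apply/funext => om; rewrite indicE pnatr_eq0 eqb0 negbK.
  apply/(S_measurableP _ sS); have /andP[c0 ct] := clamp_itv y t0.
  exact: adW.
have cWc om : continuous (Wc ^~ om).
  rewrite (_ : Wc ^~ om = if om \in Om0 then (fun y => W (clamp t y) om) else cst 0).
    case: ifPn => [/set_mem o|_]; first exact: (@continuous_comp_clamp _ (W ^~ om)).
    by move=> ?; exact: cvg_cst.
  by apply/funext => y; rewrite /Wc; case: ifPn.
have mWcomp (g : R * g_sigma_algebraType (H t) -> R) : measurable_fun setT g ->
    measurable_fun setT (fun p => Wc (g p) p.2).
  move=> mg; apply: (measurable_caratheodory
    (h := fun (p : R * g_sigma_algebraType (H t)) y => Wc y p.2)) => //.
    by move=> y; exact: (measurableT_comp (mWc y) measurable_snd).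
  by move=> p; exact: cWc.
apply: (@measurable_ae_eq _ _ _ P (H t) (fun om => e^-1 * \int[leb]_(s in `[0, t])
  (X (clamp t s) om * (Wc (Num.min (s + e) t) om - Wc s om)))) => //.
  apply: measurable_funM => //.
  apply: (@measurable_lebesgue_Rintegral_param R _ (g_sigma_algebraType (H t)) `[0, t]%classic
    (fun p => X (clamp t p.1) p.2 * (Wc (Num.min (p.1 + e) t) p.2 - Wc p.1 p.2))) => //.
  apply: measurable_funM; first exact: S_measurable_caglad.
  apply: measurable_funB; apply: mWcomp; last exact: measurable_fst.
  by apply: measurable_minr => //; apply: measurable_funD => //; exact: measurable_fst.
have : {ae P, forall om, Om0 om} by exact: cW.
apply: filterS => om o; rewrite /fwdW_approx; congr (_ * _).
apply: eq_Rintegral => s; rewrite inE/= in_itv/= => /[dup] st /andP[s0 st'].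
rewrite /Wc (mem_set o) !clamp_id//.
by rewrite ge_min lexx orbT andbT le_min t0 andbT addr_ge0// ltW.
Qed.

Lemma fwdW_adapted (X : R -> Om -> R) t : caglad_adapted T H X ->
  (exists I, fwdW_spec P T W X I) -> 0 <= t <= T -> S_measurable (H t) (fwdW P T W X t).
Proof.
move=> cX /fwdW_ucp uI t0T.
have hB n : \forall e \near (0 : R)^'+, (0 < e /\ e < n.+1%:R^-1).
  near=> e; split; first by near: e; exact: nbhs_right_gt.
  by near: e; apply: nbhs_right_lt; rewrite invr_gt0.
have [j [hj ae_j]] := ucp_ae_subsequence hB uI uI.
apply: (measurable_ae_cvg (usual_null uH t0T) (Zn := fun n => fwdW_approx W X (j n) t)).
  by move=> n; apply: fwdW_approx_adapted => //; case: (hj n).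
by move: ae_j; apply: filterS => om /(_ _ t0T)[].
Unshelve. all: by end_near.
Qed.

Lemma fwdW_at0 (X : R -> Om -> R) : (exists I, fwdW_spec P T W X I) ->
  {ae P, forall om, fwdW P T W X 0 om = 0}.
Proof.
move=> /fwdW_ucp uI; have h0 : (0 : R) <= 0 <= T by rewrite lexx.
have [j [_ ae_j]] := ucp_ae_subsequence (fun=> filterT) uI uI.
move: ae_j; apply: filterS => om /(_ _ h0)[+ _].
rewrite (_ : (fun n => _) = cst 0).
  by move=> /cvg_lim <- //; rewrite lim_cst.
by apply/funext => n; rewrite /fwdW_approx set_itv1 Rintegral_set1 mulr0.
Qed.

Lemma fwdW_scale (X : R -> Om -> R) c : (exists I, fwdW_spec P T W X I) ->
  {ae P, forall om, leb.-integrable `[0, T] (EFin \o X ^~ om)} ->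
  exists I, fwdW_spec P T W (fun s om => c * X s om) I.
Proof.
move=> [I hI] iX; exists (fun t om => c * I t om).
have FF : Filter ((0 : R)^'+) by exact: at_right_proper_filter.
have h := @ucp_scale _ _ _ P T _ _ FF _ _ c hI.
have D0 : \forall e \near (0 : R)^'+, 0 < e by exact: nbhs_right_gt.
apply: (@ucp_ae_congr _ _ _ P T _ _ FF _ _ _ _ D0 _ h).
move: cW iX; apply: filterS2 => om cw ix e t e0 /andP[t0 tT].
rewrite /fwdW_approx mulrCA; congr (_ * _).
have cwT := @continuous_comp_clamp _ (W ^~ om) _ T0 cw.
have bwT := @bounded_comp_clamp _ (W ^~ om) _ T0 cwT.
rewrite -RintegralZl//.
  by apply: eq_Rintegral => s _; rewrite mulrA.
have := integrable_times_increment ix cwT bwT e t tT.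
apply: eq_integrable => // s; rewrite inE/= in_itv/= => /andP[s0 st].
rewrite !clamp_id//; first by rewrite s0 (le_trans st).
by rewrite ge_min tT orbT andbT le_min t0 andbT addr_ge0// ltW.
Qed.

(** For a fixed mesh the approximations of the left-hand side are the increments
    of the approximations with horizon [T]; by [forward_sum_horizon] these have
    the same limits as the approximations with horizons [t] and [t']. *)
Lemma fwdW_indicator (X Y : R -> Om -> R) (c t t' : R) (B : set Om) :
  0 <= t -> t <= t' -> t' <= T ->
  (forall s om, Y s om = c * (\1_B om * \1_(`]t, t']%classic) s) * X s om) ->
  (forall om, caglad T (X ^~ om)) ->
  {ae P, forall om, leb.-integrable `[0, T] (EFin \o X ^~ om)} ->
  (exists I, fwdW_spec P T W X I) -> (exists I, fwdW_spec P T W Y I) ->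
  {ae P, forall om, fwdW P T W Y T om =
    c * \1_B om * (fwdW P T W X t' om - fwdW P T W X t om)}.
Proof.
move=> t0 tt' t'T YE cX iX /fwdW_ucp uX /fwdW_ucp uY.
have hB n : \forall e \near (0 : R)^'+, (0 < e /\ e < n.+1%:R^-1).
  near=> e; split; first by near: e; exact: nbhs_right_gt.
  by near: e; apply: nbhs_right_lt; rewrite invr_gt0.
have [j [hj ae_j]] := ucp_ae_subsequence hB uX uY.
move: ae_j cW iX; apply: filterS3 => om hcv cw ix.
have cwT := @continuous_comp_clamp _ (W ^~ om) _ T0 cw.
have bwT := @bounded_comp_clamp _ (W ^~ om) _ T0 cwT.
have TT : 0 <= T <= T by rewrite T0 lexx.
have tT : 0 <= t <= T by rewrite t0 (le_trans tt').
have t'T' : 0 <= t' <= T by rewrite t'T (le_trans t0).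
have [_ cvY] := hcv _ TT.
have [cvt _] := hcv _ tT.
have [cvt' _] := hcv _ t'T'.
apply: (cvg_unique _ cvY) => //.
pose wc s := W (clamp T s) om.
pose J e tau := e^-1 * (\int[leb]_(s in `[0, tau]) (X s om * (wc (Num.min (s + e) T) - wc s))).
pose A e tau := e^-1 * (\int[leb]_(s in `[0, tau]) (X s om * (wc (Num.min (s + e) tau) - wc s))).
have AE n tau : 0 <= tau <= T -> A (j n) tau = fwdW_approx W X (j n) tau om.
  move=> /andP[tau0 tauT]; rewrite /A /fwdW_approx; congr (_ * _).
  apply: eq_Rintegral => s; rewrite inE/= in_itv/= => /andP[s0 st].
  have [j0 _] := hj n.
  rewrite /wc !clamp_id//; first by rewrite s0 (le_trans st).
  by rewrite ge_min tauT orbT andbT le_min tau0 andbT addr_ge0// ltW.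
have YJ n : fwdW_approx W Y (j n) T om = c * \1_B om * (J (j n) t' - J (j n) t).
  have [j0 _] := hj n.
  rewrite /J -mulrBr mulrCA /fwdW_approx; congr (_ * _).
  apply: (@Rintegral_indic_diff _ _ _ leb `[0, T]%classic `[0, t]%classic `[0, t']%classic
     (fun s => X s om * (wc (Num.min (s + j n) T) - wc s))) => //.
  - by apply: subset_itvl; rewrite bnd_simp.
  - by apply: subset_itvl; rewrite bnd_simp.
  - exact: (integrable_times_increment ix cwT bwT (j n) T (lexx T)).
  move=> s; rewrite /= in_itv/= => /andP[s0 sT].
  rewrite indic_itvD// YE /wc !clamp_id//; [by ring|by rewrite s0|].
  by rewrite ge_min lexx orbT andbT le_min T0 andbT addr_ge0// ltW.
have j0 : j n @[n --> \oo] --> (0 : R)^'+.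
  move=> S [r /= r0 hS]; suff : \forall n \near \oo, S (j n) by [].
  near=> n; have [jn0 jn1] := hj n.
  apply: hS => //=; rewrite sub0r normrN gtr0_norm//; apply: (lt_trans jn1).
  rewrite -[ltLHS]gtr0_norm ?invr_gt0// -normrN -sub0r; near: n.
  by have /cvgrPdist_lt /(_ r r0) := @cvg_harmonic R.
have JA tau : 0 <= tau <= T -> J (j n) tau @[n --> \oo] --> fwdW P T W X tau om.
  move=> tauT; have [cvtau _] := hcv _ tauT.
  have h0 := forward_sum_horizon ix (cX om).1 cwT bwT tauT.
  have h1 := cvg_comp _ _ j0 h0.
  have h2 := cvgD h1 cvtau; rewrite add0r in h2.
  rewrite (_ : (fun n => J (j n) tau) = (fun n => J (j n) tau - A (j n) tau +
    fwdW_approx W X (j n) tau om)); first exact: h2.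
  by apply/funext => n; rewrite AE// subrK.
rewrite (_ : (fun n => _) = (fun n => c * \1_B om * (J (j n) t' - J (j n) t))); last first.
  exact/funext.
by apply: cvgM; [exact: cvg_cst|apply: cvgB; exact: JA].
Unshelve. all: by end_near.
Qed.

End forward_brownian_integral.

(** * Forward integrals with respect to Poisson random measures *)

Section integrals_without_integrability.
Context {R : realType} {d : measure_display} {Y : measurableType d}.
Variable mu : {measure set Y -> \bar R}.

(** The real integral of a measurable function is 0 as soon as one of its parts
    has an infinite integral. This makes the scaling and comparison of real
    integrals valid for all measurable functions. *)
Lemma Rintegral_not_integrable (D : set Y) (f : Y -> R) :
  measurable D -> measurable_fun D f -> ~ mu.-integrable D (EFin \o f) ->
  \int[mu]_(y in D) f y = 0.
Proof.
move=> mD mf nf.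
have mEf : measurable_fun D (EFin \o f) by exact/measurable_EFinP.
rewrite /Rintegral integralE.
set a := (\int[mu]_(x in D) _)%E; set b := (\int[mu]_(x in D) _)%E.
have a0 : (0 <= a)%E by apply: integral_ge0 => x _; exact: funepos_ge0.
have b0 : (0 <= b)%E by apply: integral_ge0 => x _; exact: funeneg_ge0.
have ab : (a + b)%E = +oo%E.
  apply/eqP; rewrite -leye_eq leNgt; apply/negP => ablt; apply: nf.
  apply/integrableP; split => //; apply: le_lt_trans ablt.
  rewrite le_eqVlt; apply/orP; left; apply/eqP.
  rewrite /a /b -ge0_integralD//; [|exact: measurable_funepos|exact: measurable_funeneg].
  by apply: eq_integral => x _; have := congr1 (fun h => h x) (fune_abse (EFin \o f)).
by case: a a0 ab => [a| |] // _; case: b b0 => [b| |] //=.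
Qed.

Lemma RintegralZl_measurable (D : set Y) (f : Y -> R) (k : R) :
  measurable D -> measurable_fun D f ->
  \int[mu]_(y in D) (k * f y) = k * \int[mu]_(y in D) f y.
Proof.
move=> mD mf; have [if_|nf] := pselect (mu.-integrable D (EFin \o f)).
  by rewrite RintegralZl.
have [->|k0] := eqVneq k 0.
  rewrite mul0r; under eq_Rintegral do rewrite mul0r.
  by rewrite /Rintegral integral0.
rewrite (Rintegral_not_integrable mD mf nf) mulr0 Rintegral_not_integrable//.
  exact: measurable_funM.
move=> h; apply: nf; have := integrableZl mD k^-1 h.
by apply: eq_integrable => // y _ /=; rewrite -EFinM mulKf.
Qed.

Lemma abs_Rintegral_le (D : set Y) (f : Y -> R) :
  measurable D -> measurable_fun D f ->
  (`|\int[mu]_(y in D) f y|%:E <= \int[mu]_(y in D) `|f y|%:E)%E.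
Proof.
move=> mD mf; have [if_|nf] := pselect (mu.-integrable D (EFin \o f)).
  rewrite (EFin_normr_Rintegral mD if_).
  by apply: le_abse_integral => //; exact: measurable_int if_.
rewrite Rintegral_not_integrable// normr0.
by apply: integral_ge0 => x _; rewrite lee_fin.
Qed.

Lemma ae_eq_Rintegral (D : set Y) (f g : Y -> R) :
  measurable D -> measurable_fun D f -> measurable_fun D g ->
  ae_eq mu D f g -> \int[mu]_(y in D) f y = \int[mu]_(y in D) g y.
Proof.
move=> mD mf mg fg; rewrite /Rintegral; congr fine.
apply: ae_eq_integral => //.
- exact/measurable_EFinP.
- exact/measurable_EFinP.
- by move: fg; apply: filterS => x /[apply] /= ->.
Qed.

(** A finite measure with integer values gives mass 0 to sets of small mass, so
    that every measurable function is essentially bounded. *)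
Lemma integrable_integer_measure (D : set Y) (f : Y -> R) :
  measurable D -> (mu D < +oo)%E ->
  (forall C, measurable C -> C `<=` D -> mu C = +oo%E \/ exists n : nat, mu C = n%:R%:E) ->
  measurable_fun D f -> mu.-integrable D (EFin \o f).
Proof.
move=> mD Dfin hint mf.
pose E (k : nat) := D `&` (fun y => `|f y|) @^-1` `]k%:R, +oo[%classic.
have mE k : measurable (E k) by exact: measurableT_comp.
have ED k : E k `<=` D by exact: subIsetl.
have Efin k : (mu (E k) < +oo)%E.
  by apply: le_lt_trans Dfin; apply: le_measure; rewrite ?inE.
have Emono : nonincreasing_seq E.
  move=> m n mn; apply/subsetPset => y [Dy /=]; rewrite !in_itv/= !andbT => h; split => //=.
  by rewrite in_itv/= andbT; apply: le_lt_trans h; rewrite ler_nat.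
have E0 : \bigcap_n E n = set0.
  apply/seteqP; split=> // y /= h.
  have [_ /=] := h (Num.truncn `|f y|).+1 I; rewrite in_itv/= andbT.
  have := truncnS_gt `|f y|.
  by move=> /ltW h1 h2; move: (le_lt_trans h1 h2); rewrite ltxx.
have cvE : mu (E n) @[n --> \oo] --> 0%E.
  rewrite -(measure0 mu) -E0; apply: nonincreasing_cvg_mu => //.
  by rewrite E0.
have [k Ek] : exists k, mu (E k) = 0%E.
  have [k hk] : exists k, (mu (E k) < 1%:E)%E.
    have h1 : ereal_nbhs (0%E : \bar R) (fun u => (u < 1%:E)%E).
      by apply: open_ereal_lt'; rewrite lte_fin.
    have hlt : \forall n \near \oo, (mu (E n) < 1%:E)%E := cvE _ h1.
    by have [k hk] := filter_ex hlt; exists k.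
  exists k; have [h|[n hn]] := hint _ (mE k) (ED k).
    by move: hk; rewrite h.
  by move: hk; rewrite hn lte_fin (ltr_nat R n 1); case: n {hn}.
apply/integrableP; split; first exact/measurable_EFinP.
rewrite (@ge0_negligible_integral _ _ _ mu D (E k))//; last first.
  by apply/measurable_EFinP; exact: measurableT_comp.
have mDE : measurable (D `\` E k) by exact: measurableD.
apply: (@le_lt_trans _ _ (\int[mu]_(x in D `\` E k) (cst k%:R%:E) x)%E).
  apply: ge0_le_integral => //=.
  - apply/measurable_EFinP; apply: measurableT_comp => //.
    by apply: measurable_funS mf => //; exact: subDsetl.
  - move=> y [Dy nE]; rewrite lee_fin leNgt; apply/negP => h; apply: nE.
    by split => //=; rewrite in_itv/= andbT.
rewrite integral_cst//; apply: (@le_lt_trans _ _ (k%:R%:E * mu D)%E).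
  apply: lee_wpmul2l => //; apply: le_measure; rewrite ?inE//; exact: subDsetl.
by rewrite lte_mul_pinfty.
Qed.

End integrals_without_integrability.

Lemma measurable_invr (R : realType) : measurable_fun setT (fun x : R => x^-1).
Proof.
rewrite (_ : setT = [set 0] `|` [set~ 0]); last by rewrite setUv.
apply/measurable_funU => //; first exact: measurableC.
split; first exact: measurable_fun_set1.
apply: open_continuous_measurable_fun; first by apply: closed_openC; apply: accessible_closed_set1; exact: hausdorff_accessible.
by move=> x /=; rewrite inE => /eqP x0; exact: inv_continuous.
Qed.

Section field_measurability.
Context {R : realType} {d : measure_display} {Om : measurableType d}.
Variables (P : probability Om R) (T : R) (H : R -> set (set Om)).
Hypothesis uH : usual_filtration P T H.

(** Fields have no meaning at the mark 0, where the value is set to 0. *)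
Definition progressive_field (zeta : R -> R -> Om -> R) := forall t, 0 <= t <= T ->
  measurable_fun (setT : set (R * (R * g_sigma_algebraType (H t))))
    (fun p => if p.2.1 != 0 then zeta (clamp t p.1) p.2.1 p.2.2 else 0).

(** Joint measurability in mark and outcome at each time is part of adaptedness,
    and left-continuity brings in the time. *)
Lemma progressive_caglad_field (zeta : R -> R -> Om -> R) :
  caglad_adapted_field T H zeta -> progressive_field zeta.
Proof.
move=> [cz mz] t /andP[t0 tT].
apply: (@caglad_jointly_measurable R _ (R * g_sigma_algebraType (H t))%type
  (fun s x => if x.1 != 0 then zeta s x.1 x.2 else 0) t t0).
  move=> s /andP[s0 st].
  have sT : 0 <= s <= T by rewrite s0 (le_trans st).
  have mR0 : measurable ([set x : R * g_sigma_algebraType (H t) | x.1 != 0]).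
    rewrite (_ : [set x | _] = [set~ (0:R)] `*` setT).
      by apply: measurableX => //; exact: measurableC.
    by apply/seteqP; split => -[z om] /=; [move=> /eqP|move=> [/eqP]].
  move=> _ B mB; rewrite setTI.
  have := mz s sT B mB.
  set G := [set C | _] => hG.
  have sub : <<s R0 `*` setT, G >> `<=`
      (measurable : set (set (R * g_sigma_algebraType (H t)))).
    apply: smallest_sub.
      split; first exact: measurable0.
        move=> A mA; apply: measurableD => //; apply: measurableX => //.
        rewrite (_ : R0 = [set~ (0:R)]); first exact: measurableC.
        by apply/seteqP; split => z /= /eqP.
      by move=> A mA; exact: bigcupT_measurable.
    move=> _ [D [A [mD DR0 HA ->]]]; apply: measurableX => //.
    apply: sub_sigma_algebra; exact: (usual_mono uH s0 st tT).
  rewrite (_ : _ @^-1` B = [set x : R * Om | x.1 != 0 /\ B (zeta s x.1 x.2)] `|`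
     ([set x | x.1 == 0 /\ B 0])).
    apply: measurableU; first exact: sub.
    have [B0|nB0] := pselect (B 0).
      rewrite (_ : [set x | _] = ~` [set x : R * g_sigma_algebraType (H t) | x.1 != 0]).
        exact: measurableC.
      by apply/seteqP; split => -[z om] /=; [move=> [/eqP-> _]; rewrite eqxx|move=> /negP/negPn].
    rewrite (_ : [set x | _] = set0) //.
    by apply/seteqP; split => -[z om] //= -[].
  apply/seteqP; split=> -[z om] /=.
    have [z0|z0] := boolP (z != 0) => h; [by left|right].
    by split => //; rewrite negbK in z0.
  by case; [case=> ->|case=> /eqP ->; rewrite eqxx].
move=> [z om] s /andP[s0 st] /=; case: ifPn => z0; last exact: cvg_cst.
apply: (cz z om z0).1; by rewrite s0 (le_trans st).
Qed.

End field_measurability.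

Section forward_poisson_integral.
Context {R : realType} {d : measure_display} {Om : measurableType d}.
Variables (P : probability Om R) (T : R) (H : R -> set (set Om)).
Variables (N : Om -> {measure set (R * R) -> \bar R}).
Variables (G : {sigma_finite_measure set R -> \bar R}) (Un : nat -> set R).
Local Notation leb := (@lebesgue_measure R).
Hypothesis T0 : 0 <= T.
Hypothesis uH : usual_filtration P T H.
Hypothesis mUn : forall n, measurable (Un n).
Hypothesis Un0 : forall n, Un n `<=` R0.
Hypothesis adN : forall t, 0 <= t <= T -> forall C, measurable C ->
  C `<=` `[0, t]%classic `*` R0 -> forall B : set (\bar R), measurable B ->
  H t ((fun om => N om C) @^-1` B).
Hypothesis N_integer : {ae P, forall om, forall C, measurable C ->
  C `<=` half_space -> N om C = +oo%E \/ exists n : nat, N om C = n%:R%:E}.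
Hypothesis N_finite : {ae P, forall om, forall n, (N om (`[0%R, T]%classic `*` Un n) < +oo)%E}.
Hypothesis N_time0 : {ae P, forall om, N om ([set 0] `*` R0) = 0%E}.

Lemma measurable_R0 : measurable (R0 : set R).
Proof.
rewrite (_ : R0 = [set~ (0:R)]); first exact: measurableC.
by apply/seteqP; split => z /= /eqP.
Qed.

Let mstrip t : measurable (`[0, t]%classic `*` R0 : set (R * R)).
Proof. by apply: measurableX => //; exact: measurable_R0. Qed.

Let mstripn t n : measurable (`[0, t]%classic `*` Un n : set (R * R)).
Proof. exact: measurableX. Qed.

Lemma fwdN_ucp (zeta : R -> R -> Om -> R) : (exists I, fwdN_spec P T N G Un zeta I) ->
  ucp P T \oo (fwdN_approx N G Un zeta) (fwdN P T N G Un zeta).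
Proof. by move=> hI; exact: (getPex hI). Qed.

Let ext (zeta : R -> R -> Om -> R) (t : R) s z om :=
  if z != 0 then zeta (clamp t s) z om else 0.

(** The random measure may be infinite on a null set, where it is replaced by
    the zero measure. *)
Lemma jump_integral_adapted (zeta : R -> R -> Om -> R) n t :
  progressive_field T H zeta -> 0 <= t <= T ->
  S_measurable (H t) (fun om =>
    \int[N om]_(x in `[0, t]%classic `*` R0) (zeta x.1 x.2 om * \1_(Un n) x.2)).
Proof.
move=> pz t0T; have /andP[t0 tT] := t0T.
pose X := g_sigma_algebraType (H t).
pose C := (`[0, t]%classic `*` Un n : set (R * R)).
have CR : C `<=` `[0, t]%classic `*` R0 by move=> x [h1 h2]; split => //; exact: (Un0 h2).
have mNC A : measurable A -> A `<=` C -> measurable_fun (setT : set X) (fun om => N om A).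
  move=> mA AC _ B mB; rewrite setTI; apply: sub_sigma_algebra.
  by apply: adN => //; exact: subset_trans CR.
pose b (om : X) := (N om C < +oo)%E.
have mb : measurable_fun (setT : set X) b.
  apply: (measurable_fun_bool true).
  rewrite (_ : b @^-1` [set true] = (fun om : X => N om C) @^-1` [set x | (x < +oo)%E]).
    rewrite setTI -[X in measurable X]setTI; apply: mNC => //; first exact: mstripn.
    have := @emeasurable_fun_infty_o _ (\bar R)%type R setT id (@measurableT _ _) (@measurable_id _ _ _) +oo%E.
    by rewrite setTI.
  by apply/seteqP; split => om /=; rewrite /b.
pose l (om : X) : {measure set (R * R) -> \bar R} := if b om then N om else mzero.
have ml A : measurable A -> A `<=` C -> measurable_fun (setT : set X) (fun om => l om A).
  move=> mA AC; rewrite (_ : (fun om => l om A) = fun om => if b om then N om A else 0%E).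
    by apply: measurable_fun_ifT => //; exact: mNC.
  by apply/funext => om; rewrite /l; case: ifP.
have lfin om : (l om C < +oo)%E.
  by rewrite /l; case: ifPn => //; rewrite /mzero ltry.
have mz : measurable_fun (setT : set (X * (R * R)))
    (fun a => ext zeta t a.2.1 a.2.2 a.1).
  have h : measurable_fun (setT : set (X * (R * R))) (fun a => (a.2.1, (a.2.2, a.1))).
    apply: measurable_fun_pair.
      exact: (measurableT_comp measurable_fst measurable_snd).
    apply: measurable_fun_pair; last exact: measurable_fst.
    exact: (measurableT_comp measurable_snd measurable_snd).
  exact: (measurableT_comp (pz t t0T) h).
have mI : measurable_fun (setT : set X)
    (fun om => \int[l om]_(x in C) ext zeta t x.1 x.2 om).
  apply: (measurable_Rintegral_family (l := l) (D := C)
    (f := fun a : X * (R * R) => ext zeta t a.2.1 a.2.2 a.1)) => //.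
  by move=> g mg g0; apply: measurable_integral_random_measure => //; exact: mstripn.
apply: (measurable_ae_eq (usual_null uH t0T) mI).
move: N_finite; apply: filterS => om /(_ n) Nfin.
have bom : b om.
  apply: le_lt_trans Nfin; apply: le_measure; rewrite ?inE; [exact: mstripn|exact: mstripn|].
  by move=> x [/= + ?]; rewrite !in_itv/= => /andP[-> h]; split => //; exact: le_trans tT.
rewrite /l bom Rintegral_mkcond [RHS]Rintegral_mkcond; apply: eq_Rintegral => -[s z] _.
rewrite /patch /= /ext; case: ifPn => [/set_mem[/= st zU]|nC].
  rewrite mem_set; last by split => //; exact: (Un0 zU).
  rewrite indicE mem_set// mulr1 (Un0 zU) clamp_id//.
case: ifPn => // /set_mem[/= st _].
rewrite indicE memNset ?mulr0// => zU; move/negP: nC; apply; exact/mem_set.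
Qed.

Lemma compensator_integral_adapted (zeta : R -> R -> Om -> R) t (b : R -> R) :
  measurable_fun setT b ->
  progressive_field T H zeta -> 0 <= t <= T ->
  S_measurable (H t) (fun om =>
    \int[leb]_(s in `[0, t]) \int[G]_(z in R0) (zeta s z om * b z)).
Proof.
move=> mb pz t0T; have /andP[t0 tT] := t0T.
pose X := g_sigma_algebraType (H t).
have mz : measurable_fun (setT : set ((R * X) * R))
    (fun a => ext zeta t a.1.1 a.2 a.1.2 * b a.2).
  apply: measurable_funM; last exact: (measurableT_comp mb measurable_snd).
  have h : measurable_fun (setT : set ((R * X) * R)) (fun a => (a.1.1, (a.2, a.1.2))).
    apply: measurable_fun_pair.
      exact: (measurableT_comp measurable_fst measurable_fst).
    apply: measurable_fun_pair; first exact: measurable_snd.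
    exact: (measurableT_comp measurable_snd measurable_fst).
  exact: (measurableT_comp (pz t t0T) h).
have m1 := measurable_Rintegral_param G measurable_R0 mz.
have m2 := measurable_lebesgue_Rintegral_param (measurable_itv `[0, t]%R) m1.
apply: (eq_measurable_fun _ _ m2) => om _.
apply: eq_Rintegral => s; rewrite inE/= in_itv/= => st.
by apply: eq_Rintegral => z /set_mem z0; rewrite /ext z0 clamp_id.
Qed.

Lemma fwdN_adapted (zeta : R -> R -> Om -> R) t : progressive_field T H zeta ->
  (exists I, fwdN_spec P T N G Un zeta I) -> 0 <= t <= T ->
  S_measurable (H t) (fwdN P T N G Un zeta t).
Proof.
move=> pz /fwdN_ucp uI t0T.
have [j [_ ae_j]] := ucp_ae_subsequence (fun=> filterT) uI uI.
apply: (measurable_ae_cvg (usual_null uH t0T) (Zn := fun n => fwdN_approx N G Un zeta (j n) t)).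
  move=> n; apply: measurable_funB; first exact: jump_integral_adapted.
  by apply: compensator_integral_adapted => //; exact: measurable_indic.
by move: ae_j; apply: filterS => om /(_ _ t0T)[].
Qed.

Section path.
Variables (om : Om) (zeta : R -> R -> Om -> R) (n : nat).
Hypothesis pz : progressive_field T H zeta.
Hypothesis N_int : forall C, measurable C ->
  C `<=` half_space -> N om C = +oo%E \/ exists n : nat, N om C = n%:R%:E.
Hypothesis N_fin : (N om (`[0%R, T]%classic `*` Un n) < +oo)%E.
Let TT : 0 <= T <= T. Proof. by rewrite T0 lexx. Qed.

Lemma measurable_path_ext : measurable_fun setT (fun x : R * R => ext zeta T x.1 x.2 om).
Proof.
have h : measurable_fun (setT : set (R * R))
    (fun x => (x.1, (x.2, (om : g_sigma_algebraType (H T))))).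
  by apply: measurable_fun_pair => //; apply: measurable_fun_pair.
exact: (measurableT_comp (pz TT) h).
Qed.

Lemma measurable_path_strip :
  measurable_fun (`[0, T]%classic `*` R0) (fun x : R * R => zeta x.1 x.2 om * \1_(Un n) x.2).
Proof.
apply: (eq_measurable_fun (fun x => ext zeta T x.1 x.2 om * \1_(Un n) x.2)).
  move=> x /set_mem[/=]; rewrite in_itv/= => h x0; rewrite /ext x0 clamp_id//.
apply: measurable_funTS; apply: measurable_funM; first exact: measurable_path_ext.
exact: (measurableT_comp (measurable_indic (mUn n)) measurable_snd).
Qed.

Lemma integrable_jump_path :
  (N om).-integrable (`[0, T]%classic `*` R0) (EFin \o (fun x => zeta x.1 x.2 om * \1_(Un n) x.2)).
Proof.
have sub : `[0, T]%classic `*` Un n `<=` `[0, T]%classic `*` R0.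
  by move=> x [h1 h2]; split => //; exact: (Un0 h2).
have i : (N om).-integrable (`[0, T]%classic `*` Un n) (EFin \o (fun x => zeta x.1 x.2 om * \1_(Un n) x.2)).
  apply: integrable_integer_measure => //.
    move=> C mC CD; apply: N_int => // x /CD[/=]; rewrite in_itv/= => /andP[x0 _] xU; split => //; exact: (Un0 xU).
  exact: measurable_funS measurable_path_strip.
have := (integrable_mkcond _ (mstripn T n)).1 i.
move=> /(integrableS measurableT (mstrip T) (@subsetT _ _)).
apply: eq_integrable => //.
move=> [s z] /set_mem[/= st z0]; rewrite /patch; case: ifPn => // /negP nC.
rewrite indicE memNset ?mulr0// => zU; apply: nC; exact/mem_set.
Qed.

Lemma measurable_compensator_path (b : R -> R) : measurable_fun setT b ->
  measurable_fun `[0, T] (fun s => \int[G]_(z in R0) (zeta s z om * b z)).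
Proof.
move=> mb.
have m : measurable_fun setT (fun x : R * R => ext zeta T x.1 x.2 om * b x.2).
  apply: measurable_funM; first exact: measurable_path_ext.
  exact: (measurableT_comp mb measurable_snd).
have m1 := measurable_Rintegral_param G measurable_R0 m.
apply: (eq_measurable_fun _ _ (measurable_funTS m1)) => s.
rewrite inE/= in_itv/= => st.
by apply: eq_Rintegral => z /set_mem z0; rewrite /ext z0 clamp_id.
Qed.

Lemma measurable_section_path s (b : R -> R) : measurable_fun setT b -> 0 <= s <= T ->
  measurable_fun R0 (fun z => zeta s z om * b z).
Proof.
move=> mb sT.
apply: (eq_measurable_fun (fun z => ext zeta T s z om * b z)).
  by move=> z /set_mem z0; rewrite /ext z0 clamp_id.
apply: measurable_funTS; apply: measurable_funM => //.
exact: (measurableT_comp measurable_path_ext (pair1_measurable s)).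
Qed.

Lemma integrable_compensator_path (b : R -> R) : measurable_fun setT b ->
  (\int[leb]_(s in `[0%R, T]) \int[G]_(z in R0) `|(zeta s z om * b z)%R|%:E < +oo)%E ->
  leb.-integrable `[0, T] (EFin \o (fun s => \int[G]_(z in R0) (zeta s z om * b z))).
Proof.
move=> mb fin; apply/integrableP; split.
  by apply/measurable_EFinP; exact: measurable_compensator_path.
apply: le_lt_trans fin; apply: ge0_le_integral => //.
- apply/measurable_EFinP; apply: measurableT_comp => //.
  exact: measurable_compensator_path.
- have m : measurable_fun setT (fun x : R * R => `|ext zeta T x.1 x.2 om * b x.2|%:E).
    apply/measurable_EFinP; apply: measurableT_comp => //; apply: measurable_funM.
      exact: measurable_path_ext.
    exact: (measurableT_comp mb measurable_snd).
  have m1 := measurable_integral_param G measurable_R0 m (fun _ => normr_ge0 _).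
  apply: (eq_measurable_fun _ _ (measurable_funTS m1)) => s.
  rewrite inE/= in_itv/= => st.
  by apply: eq_integral => z /set_mem z0; rewrite /ext z0 clamp_id.
- move=> s /=; rewrite in_itv/= => st; apply: abs_Rintegral_le => //.
    exact: measurable_R0.
  exact: measurable_section_path.
Qed.

End path.

(** Indicator strategies vanish at time 0, a negligible time. *)
Lemma integral_drop_time0 (F F' : R -> \bar R) : measurable_fun `[0, T] F ->
  (forall s, 0 < s <= T -> F' s = F s) -> F' 0 = 0%E ->
  (\int[leb]_(s in `[0%R, T]) F' s = \int[leb]_(s in `[0%R, T]) F s)%E.
Proof.
move=> mF F'F F'0.
transitivity (\int[leb]_(s in `[0%R, T]) (F \_ `]0%R, T]) s)%E.
  apply: eq_integral => s; rewrite inE/= in_itv/= => /andP[s0 sT]; rewrite /patch.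
  case: ifPn => [|/negP s0T]; first by rewrite inE/= in_itv/= => /F'F.
  have [->//|sn0] := eqVneq s 0.
  by exfalso; apply: s0T; rewrite inE/= in_itv/= sT lt_neqAle eq_sym sn0 s0.
rewrite -integral_mkcondr setIidr; last by apply: subset_itvr; rewrite bnd_simp.
by rewrite integral_itv_obnd_cbnd//; apply: measurable_funS mF => //; apply: subset_itvr; rewrite bnd_simp.
Qed.

Lemma measurable_integral_abs_path (om : Om) (zeta : R -> R -> Om -> R) (b : R -> R) :
  progressive_field T H zeta -> measurable_fun setT b ->
  measurable_fun `[0, T] (fun s => \int[G]_(z in R0) `|zeta s z om * b z|%:E)%E.
Proof.
move=> pz mb.
have m : measurable_fun setT (fun x : R * R => `|ext zeta T x.1 x.2 om * b x.2|%:E).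
  apply/measurable_EFinP; apply: measurableT_comp => //; apply: measurable_funM.
    exact: measurable_path_ext.
  exact: (measurableT_comp mb measurable_snd).
have m1 := measurable_integral_param G measurable_R0 m (fun _ => normr_ge0 _).
apply: (eq_measurable_fun _ _ (measurable_funTS m1)) => s.
rewrite inE/= in_itv/= => st.
by apply: eq_integral => z /set_mem z0; rewrite /ext z0 clamp_id.
Qed.

Definition locally_integrable (zeta : R -> R -> Om -> R) := forall n, {ae P, forall om,
  (\int[leb]_(s in `[0%R, T]) \int[G]_(z in R0) (`|zeta s z om| * \1_(Un n) z)%:E < +oo)%E}.

Lemma locally_integrable_drop_time0 (zeta Y : R -> R -> Om -> R) (c : R) : `|c| = 1 ->
  (forall s z om, z != 0 -> Y s z om = c * \1_(`]0, T]%classic) s * zeta s z om) ->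
  progressive_field T H zeta -> locally_integrable Y -> locally_integrable zeta.
Proof.
move=> c1 YE pz iY n; move: (iY n); apply: filterS => om; apply: le_lt_trans.
have mF : measurable_fun `[0, T] (fun s => \int[G]_(z in R0) (`|zeta s z om| * \1_(Un n) z)%:E)%E.
  apply: (eq_measurable_fun _ _ (measurable_integral_abs_path om pz (measurable_indic (mUn n)))).
  by move=> s _; apply: eq_integral => z _; rewrite normrM [X in _ * X]ger0_norm.
rewrite le_eqVlt; apply/orP; left; apply/eqP/esym.
apply: (integral_drop_time0 mF).
- move=> s s0T; apply: eq_integral => z /set_mem z0.
  by rewrite YE// indicE mem_set/= ?in_itv//= mulr1 !normrM c1 mul1r.
- apply: integral0_eq => z z0; rewrite YE// indicE memNset ?mulr0 ?mul0r ?normr0 ?mul0r//.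
  by rewrite /= in_itv/= ltxx.
Qed.

Section increments.
Variables (zeta Y : R -> R -> Om -> R) (c : R).
Hypothesis pz : progressive_field T H zeta.
Hypothesis iz : locally_integrable zeta.

Let path_facts : {ae P, forall om, [/\ forall C, measurable C -> C `<=` half_space ->
      N om C = +oo%E \/ exists n : nat, N om C = n%:R%:E,
    forall n, (N om (`[0%R, T]%classic `*` Un n) < +oo)%E,
    N om ([set 0] `*` R0) = 0%E &
    forall n, leb.-integrable `[0, T]
      (EFin \o (fun s => \int[G]_(z in R0) (zeta s z om * \1_(Un n) z)))]}.
Proof.
have h : {ae P, forall om, forall n, leb.-integrable `[0, T]
      (EFin \o (fun s => \int[G]_(z in R0) (zeta s z om * \1_(Un n) z)))}.
  apply/ae_foralln => n; move: (iz n); apply: filterS => om fin.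
  apply: (integrable_compensator_path pz (measurable_indic (mUn n))).
  apply: le_lt_trans fin; rewrite le_eqVlt; apply/orP; left; apply/eqP.
  apply: eq_integral => s _; apply: eq_integral => z _.
  by congr (_%:E); rewrite normrM [X in _ * X = _]ger0_norm.
near=> om; split; near: om => //.
Unshelve. all: by end_near.
Qed.

(** Here the approximations of the left-hand side are exactly the increments of
    those of [zeta], as the truncated jump integrals are integrals over nested
    strips. *)
Lemma fwdN_increment (B : set Om) (t t' : R) :
  0 <= t -> t <= t' -> t' <= T ->
  (forall s z om, z != 0 -> Y s z om = c * (\1_B om * \1_(`]t, t']%classic) s) * zeta s z om) ->
  (exists I, fwdN_spec P T N G Un zeta I) -> (exists I, fwdN_spec P T N G Un Y I) ->
  {ae P, forall om, fwdN P T N G Un Y T om =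
    c * \1_B om * (fwdN P T N G Un zeta t' om - fwdN P T N G Un zeta t om)}.
Proof.
move=> t0 tt' t'T YE /fwdN_ucp uz /fwdN_ucp uY.
have [j [_ ae_j]] := ucp_ae_subsequence (fun=> filterT) uz uY.
move: ae_j path_facts; apply: filterS2 => om hcv [Nint Nfin _ iG].
have TT : 0 <= T <= T by rewrite T0 lexx.
have tT : 0 <= t <= T by rewrite t0 (le_trans tt').
have t'T' : 0 <= t' <= T by rewrite t'T (le_trans t0).
have [_ cvY] := hcv _ TT.
have [cvt _] := hcv _ tT.
have [cvt' _] := hcv _ t'T'.
apply: (cvg_unique _ cvY) => //.
rewrite (_ : (fun n => _) = (fun n => c * \1_B om *
  (fwdN_approx N G Un zeta (j n) t' om - fwdN_approx N G Un zeta (j n) t om))); last first.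
  apply/funext => n; rewrite /fwdN_approx.
  have sub (u u' : R) : u <= u' -> `[0, u]%classic `<=` `[0, u']%classic.
    by move=> uu'; apply: subset_itvl; rewrite bnd_simp.
  have diffE s : 0 <= s <= T ->
      \1_(`[0, t']%classic `\` `[0, t]%classic) s = \1_(`]t, t']%classic) s :> R.
    by move=> /andP[s0 _]; exact: indic_itvD.
  have sub1 : `[0, t]%classic `*` (@R0 R) `<=` `[0, t']%classic `*` (@R0 R).
    by move=> [s z] [/= /(sub _ _ tt')].
  have sub2 : `[0, t']%classic `*` (@R0 R) `<=` `[0, T]%classic `*` (@R0 R).
    by move=> [s z] [/= /(sub _ _ t'T)].
  rewrite (Rintegral_indic_diff (h := fun x => Y x.1 x.2 om * \1_(Un (j n)) x.2)
     (k := c * \1_B om) (mstrip T) (mstrip t) (mstrip t') sub1 sub2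
     (integrable_jump_path pz Nint (Nfin (j n)))); last first.
    move=> [s z] [/=]; rewrite in_itv/= => st z0.
    rewrite YE//.
    have -> : \1_((`[0, t'] `*` R0) `\` (`[0, t] `*` R0)) (s, z) = \1_(`]t, t']%classic) s :> R.
      rewrite -diffE// !indicE; congr (_%:R); congr nat_of_bool; apply/idP/idP; rewrite !inE/=.
        by move=> [[? _] h]; split => // ?; exact: h.
      by move=> [? h]; split => // -[].
    by ring.
  have -> : \int[leb]_(s in `[0, T]) \int[G]_(z in R0) (Y s z om * \1_(Un (j n)) z) =
     c * \1_B om * (\int[leb]_(s in `[0, t']) \int[G]_(z in R0) (zeta s z om * \1_(Un (j n)) z) -
       \int[leb]_(s in `[0, t]) \int[G]_(z in R0) (zeta s z om * \1_(Un (j n)) z)).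
    apply: Rintegral_indic_diff => //; [exact: sub|exact: sub|].
    move=> s /=; rewrite in_itv/= => sT; rewrite diffE//.
    rewrite -RintegralZl_measurable//; last 2 first.
    - exact: measurable_R0.
    - by apply: measurable_section_path => //; exact: measurable_indic.
    by apply: eq_Rintegral => z /set_mem z0; rewrite YE//; ring.
  by ring.
by apply: cvgM; [exact: cvg_cst|exact: cvgB].
Qed.

Lemma fwdN_at0 : (exists I, fwdN_spec P T N G Un zeta I) ->
  {ae P, forall om, fwdN P T N G Un zeta 0 om = 0}.
Proof.
move=> /fwdN_ucp uI; have h0 : (0 : R) <= 0 <= T by rewrite lexx.
have [j [_ ae_j]] := ucp_ae_subsequence (fun=> filterT) uI uI.
move: ae_j path_facts; apply: filterS2 => om /(_ _ h0)[+ _] [Nint Nfin N0 iG].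
rewrite (_ : (fun n => _) = cst 0).
  by move=> /cvg_lim <- //; rewrite lim_cst.
apply/funext => n; rewrite /fwdN_approx !set_itv1 Rintegral_set1 subr0.
rewrite /Rintegral null_set_integral//.
- by apply: measurableX => //; exact: measurable_R0.
- apply/measurable_EFinP; apply: measurable_funS (measurable_path_strip om _ pz) => //.
  by move=> [s z] [/= -> z0]; split => //=; rewrite in_itv/= lexx.
Qed.

(** Almost surely there is no jump at time 0, and the compensator does not
    charge it: the approximations of [zeta] and of its restriction to ]0, T]
    agree up to the factor [c]. *)
Lemma fwdN_spec_drop_time0 : `|c| = 1 ->
  (forall s z om, z != 0 -> Y s z om = c * \1_(`]0, T]%classic) s * zeta s z om) ->
  (exists I, fwdN_spec P T N G Un Y I) -> (exists I, fwdN_spec P T N G Un zeta I).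
Proof.
move=> c1 YE [I hI]; exists (fun t om => c^-1 * I t om).
have c0 : c != 0 by rewrite -normr_gt0 c1.
have FF : Filter (\oo : set_system nat) by exact: eventually_filter.
have h := @ucp_scale _ _ _ P T _ _ FF _ _ c^-1 hI.
apply: (@ucp_ae_congr _ _ _ P T _ _ FF _ _ _ _ filterT _ h).
move: path_facts; apply: filterS => om [Nint Nfin N0 iG] n t _ tT.
have /andP[t0 tT'] := tT.
have sub : `[0, t]%classic `<=` `[0, T]%classic.
  by apply: subset_itvl; rewrite bnd_simp.
have sub0 : `[0, 0]%classic `<=` `[0, t]%classic.
  by apply: subset_itvl; rewrite bnd_simp.
have diffE s : 0 <= s <= t ->
    \1_(`[0, t]%classic `\` `[0, 0]%classic) s = \1_(`]0, T]%classic) s :> R.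
  move=> /andP[s0 st].
  rewrite !indicE; congr (_%:R); congr nat_of_bool; apply/idP/idP; rewrite !inE/= !in_itv/= s0 st/=.
    by move=> [_ /negP]; rewrite -ltNge => ->; rewrite (le_trans st).
  by move=> /andP[ts _]; split => //; apply/negP; rewrite -ltNge.
apply: (mulfI c0); rewrite mulVKf// /fwdN_approx.
have sub1 : `[0, 0]%classic `*` (@R0 R) `<=` `[0, t]%classic `*` (@R0 R).
  by move=> [s z] [/= /sub0].
have sub2 : `[0, t]%classic `*` (@R0 R) `<=` `[0, T]%classic `*` (@R0 R).
  by move=> [s z] [/= /sub].
rewrite (Rintegral_indic_diff (h := fun x => Y x.1 x.2 om * \1_(Un n) x.2)
  (k := c) (mstrip t) (mstrip 0) (mstrip t) sub1 (@subset_refl _ _)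
  (integrableS (mstrip T) (mstrip t) sub2 (integrable_jump_path pz Nint (Nfin n)))); last first.
  move=> [s z] [/=]; rewrite in_itv/= => st z0.
  rewrite YE//.
  have -> : \1_((`[0, t] `*` R0) `\` (`[0, 0] `*` R0)) (s, z) = \1_(`]0, T]%classic) s :> R.
    rewrite -diffE// !indicE; congr (_%:R); congr nat_of_bool; apply/idP/idP; rewrite !inE/=.
      by move=> [[? _] h']; split => // ?; exact: h'.
    by move=> [? h']; split => // -[].
  by ring.
have -> : \int[N om]_(x in `[0, 0] `*` R0) (zeta x.1 x.2 om * \1_(Un n) x.2) = 0.
  rewrite set_itv1 /Rintegral null_set_integral//.
  - by apply: measurableX => //; exact: measurable_R0.
  - apply/measurable_EFinP; apply: measurable_funS (measurable_path_strip om _ pz) => //.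
    by move=> [s z] [/= -> z0]; split => //=; rewrite in_itv/= lexx.
have -> : \int[leb]_(s in `[0, t]) \int[G]_(z in R0) (Y s z om * \1_(Un n) z) =
   c * (\int[leb]_(s in `[0, t]) \int[G]_(z in R0) (zeta s z om * \1_(Un n) z) -
     \int[leb]_(s in `[0, 0]) \int[G]_(z in R0) (zeta s z om * \1_(Un n) z)).
  apply: Rintegral_indic_diff => //; first exact: integrableS (iG n).
  move=> s /=; rewrite in_itv/= => st; rewrite diffE//.
  have sT : 0 <= s <= T by move: st => /andP[-> /le_trans->].
  rewrite -RintegralZl_measurable//; last 2 first.
  - exact: measurable_R0.
  - by apply: measurable_section_path => //; exact: measurable_indic.
  by apply: eq_Rintegral => z /set_mem z0; rewrite YE//; ring.
by rewrite set_itv1 Rintegral_set1; ring.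
Qed.

End increments.
End forward_poisson_integral.

(** * Measures with a density *)

Section density_measure.
Context {R : realType} {d : measure_display} {Om : measurableType d}.
Variables (P : {measure set Om -> \bar R}) (f : Om -> R).
Hypothesis mf : measurable_fun setT f.
Hypothesis f0 : forall om, 0 <= f om.
Import HBNNSimple.

Definition density_measure of measurable_fun setT f & (forall om, 0 <= f om) :=
  fun B : set Om => (\int[P]_(om in B) (f om)%:E)%E.

Local Notation nu := (density_measure mf f0).

Let nu0 : nu set0 = 0%E.
Proof. by rewrite /nu integral_set0. Qed.

Let nu_ge0 B : (0 <= nu B)%E.
Proof. by apply: integral_ge0 => om _; rewrite lee_fin. Qed.

Let nu_sigma_additive : semi_sigma_additive nu.
Proof.
move=> F mF tF mUF.
rewrite /nu ge0_integral_bigcup//; last 2 first.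
- by apply/measurable_EFinP; exact: measurable_funTS.
- by move=> om _; rewrite lee_fin.
apply: is_cvg_nneseries => n _ _.
by apply: integral_ge0 => om _; rewrite lee_fin.
Qed.

HB.instance Definition _ := isMeasure.Build _ _ _ nu nu0 nu_ge0 nu_sigma_additive.

(** Linearity gives it for simple functions, and monotone convergence for all
    others. *)
Lemma ge0_integral_density (g : Om -> \bar R) :
  measurable_fun setT g -> (forall om, (0 <= g om)%E) ->
  (\int[nu]_om g om = \int[P]_om (g om * (f om)%:E))%E.
Proof.
move=> mg g0.
have mEf : measurable_fun setT (EFin \o f) by exact/measurable_EFinP.
have simple (h : {nnsfun Om >-> R}) :
    (\int[nu]_om (h om)%:E = \int[P]_om ((h om)%:E * (f om)%:E))%E.
  have mA r : measurable (h @^-1` [set r]) by [].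
  have hE om : (h om)%:E = (\sum_(r \in range h) (r * \1_(h @^-1` [set r]) om)%:E)%E.
    by rewrite [in LHS]fimfunE fsumEFin.
  have t0 (r : R) om : (0 <= (r * \1_(h @^-1` [set r]) om)%:E)%E.
    by rewrite EFinM nnfun_muleindic_ge0.
  have t0' (r : R) om : (0 <= (r * \1_(h @^-1` [set r]) om)%:E * (f om)%:E)%E.
    by apply: mule_ge0 => //; rewrite lee_fin.
  have mt (r : R) : measurable_fun setT (fun om => (r * \1_(h @^-1` [set r]) om)%:E).
    by apply/measurable_EFinP/measurable_funM => //; exact: measurable_indic.
  transitivity (\int[nu]_om \sum_(r \in range h) (r * \1_(h @^-1` [set r]) om)%:E)%E.
    by apply: eq_integral => om _; exact: hE.
  under [RHS]eq_integral do rewrite hE ge0_mule_fsuml//.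
  rewrite ge0_integral_fsum// [RHS]ge0_integral_fsum//; last first.
    by move=> r; apply: emeasurable_funM.
  apply: eq_fsbigr => r /set_mem[x _ <-].
  rewrite (_ : (fun om => _) = (fun om => (h x)%:E * (\1_(h @^-1` [set h x]) om)%:E)%E)//.
  rewrite ge0_integralZl//; last 2 first.
  - by apply/measurable_EFinP; exact: measurable_indic.
  - by rewrite lee_fin.
  rewrite integral_indic// setIT.
  under eq_integral do rewrite EFinM -muleA.
  rewrite ge0_integralZl//; last 3 first.
  - apply: emeasurable_funM => //; apply/measurable_EFinP; exact: measurable_indic.
  - by move=> om _; rewrite mule_ge0 ?lee_fin.
  - by rewrite lee_fin.
  congr (_ * _)%E; rewrite [LHS]/= /density_measure [LHS]integral_mkcond.
  by apply: eq_integral => om _; rewrite patchE indicE; case: ifPn; rewrite ?mul1e ?mul0e.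
pose g_ := nnsfun_approx measurableT mg.
transitivity (limn (fun n => \int[nu]_om (g_ n om)%:E))%E.
  rewrite -monotone_convergence//.
  - by apply: eq_integral => om _; apply/esym/cvg_lim => //; exact: cvg_nnsfun_approx.
  - by move=> n; exact/measurable_EFinP.
  - by move=> n om _; rewrite lee_fin.
  - by move=> om _ m n mn; rewrite lee_fin; exact/lefP/nd_nnsfun_approx.
under eq_fun do rewrite simple.
rewrite -monotone_convergence//.
- apply: eq_integral => om _; apply/cvg_lim => //.
  by apply: cvgeZr => //; exact: cvg_nnsfun_approx.
- by move=> n; apply: emeasurable_funM => //; exact/measurable_EFinP.
- by move=> n om _; rewrite mule_ge0// lee_fin.
- move=> om _ m n mn; rewrite lee_wpmul2r// ?lee_fin//.
  exact/lefP/nd_nnsfun_approx.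
Qed.

Lemma integral_density (phi : Om -> R) : measurable_fun setT phi ->
  (\int[nu]_om (phi om)%:E = \int[P]_om (phi om * f om)%:E)%E.
Proof.
move=> mphi; rewrite [LHS]integralE [RHS]integralE.
have mEphi : measurable_fun setT (fun om => (phi om)%:E) by exact/measurable_EFinP.
rewrite !ge0_integral_density//; last 2 first.
- exact: measurable_funeneg.
- exact: measurable_funepos.
have E1 om : ((EFin \o phi)^\+ om * (f om)%:E = (EFin \o (fun om => phi om * f om)%R)^\+ om)%E.
  rewrite !funeposE /= -!EFin_max -EFinM; congr (_%:E).
  by rewrite maxr_pMl// mul0r.
have E2 om : ((EFin \o phi)^\- om * (f om)%:E = (EFin \o (fun om => phi om * f om)%R)^\- om)%E.
  rewrite !funenegE /= -!EFin_max -EFinM; congr (_%:E).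
  by rewrite maxr_pMl// mul0r mulNr.
congr (_ - _)%E; apply: eq_integral => om _; [exact: E1|exact: E2].
Qed.

End density_measure.

Section equal_on_sub_sigma_algebra.
Context {R : realType} {d : measure_display} {Om : measurableType d}.
Variables (nu1 nu2 : {measure set Om -> \bar R}) (S : set (set Om)).
Hypothesis nuE : forall A, S A -> nu1 A = nu2 A.

(** Both integrals are integrals over the real line against the image measures,
    which agree because the preimages of Borel sets belong to [S]. *)
Lemma eq_integral_sub_measurable (phi : Om -> R) :
  measurable_fun setT phi -> sub_measurable S phi ->
  (\int[nu1]_om (phi om)%:E = \int[nu2]_om (phi om)%:E)%E.
Proof.
move=> mphi Sphi.
have key (h : R -> \bar R) : measurable_fun setT h -> (forall x, (0 <= h x)%E) ->
    (\int[nu1]_om h (phi om) = \int[nu2]_om h (phi om))%E.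
  move=> mh h0.
  have pf nu := @ge0_integral_pushforward _ _ Om R R phi mphi nu setT h measurableT mh (fun x _ => h0 x).
  have := pf nu1; have := pf nu2; rewrite preimage_setT /= => <- <-.
  by apply: eq_measure_integral => A mA _; rewrite /pushforward; exact/nuE/Sphi.
rewrite integralE [RHS]integralE; congr (_ - _)%E.
  under eq_integral do rewrite funeposE; under [RHS]eq_integral do rewrite funeposE.
  apply: (key (fun x => maxe x%:E 0%E)); last by move=> x; rewrite le_max lexx orbT.
  by apply: measurable_maxe => //; exact/measurable_EFinP.
under eq_integral do rewrite funenegE; under [RHS]eq_integral do rewrite funenegE.
apply: (key (fun x => maxe (- x%:E)%E 0%E)); last by move=> x; rewrite le_max lexx orbT.
by apply: measurable_maxe => //; apply: measurableT_comp => //; exact/measurable_EFinP.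
Qed.

End equal_on_sub_sigma_algebra.

(** * Poisson random measures *)

Section poisson_facts.
Context {R : realType} {d : measure_display} {Om : measurableType d}.
Variables (P : probability Om R) (N : R.-ker Om ~> (R * R)%type).
Variables (G : {sigma_finite_measure set R -> \bar R}).
Hypothesis hN : poisson_random_measure P (fun om => N om) G.

(** The Poisson probabilities of the natural numbers sum to 1. *)
Lemma poisson_ae_nat (C : set (R * R)) (c : R) : measurable C -> C `<=` half_space ->
  (lebesgue_measure \x G)%E C = c%:E ->
  {ae P, forall om, exists n : nat, N om C = n%:R%:E}.
Proof.
move=> mC Ch hc; case: hN => _ hP _ _.
have mNn (n : nat) : measurable [set om | N om C = n%:R%:E].
  have := measurable_kernel N C mC measurableT _ (emeasurable_set1 (n%:R%:E : \bar R)).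
  by rewrite setTI.
exists (~` \bigcup_n [set om | N om C = n%:R%:E]); split.
- by apply: measurableC; exact: bigcup_measurable.
- rewrite probability_setC; last exact: bigcup_measurable.
  rewrite measure_bigcup//; last first.
    apply/trivIsetP => i j _ _ ij; apply/seteqP; split=> // om [/= -> /eqP].
    by rewrite eqe eqr_nat (negbTE ij).
  rewrite (eq_eseriesr (g := fun n => poisson_prob c 0 [set n])); last first.
    by move=> n _; exact: hP.
  rewrite -measure_bigcup//; last first.
    by apply/trivIsetP => i j _ _ ij; apply/seteqP; split=> // n [/= -> /eqP]; rewrite (negbTE ij).
  rewrite (_ : \bigcup_n [set n] = setT); last by apply/seteqP; split => // n _; exists n.
  by rewrite [X in (_ - X)%E](@probability_setT _ _ _ (poisson_prob c 0)) subee.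
- by move=> om /= h [n _ hn]; apply: h; exists n.
Qed.

Lemma poisson_finite (T : R) (U : set R) : 0 <= T -> measurable U -> U `<=` R0 ->
  (G U < +oo)%E -> {ae P, forall om, (N om (`[0%R, T]%classic `*` U) < +oo)%E}.
Proof.
move=> T0 mU U0 GU.
have fGU : G U \is a fin_num by rewrite ge0_fin_numE.
have h : {ae P, forall om, exists n : nat, N om (`[0%R, T]%classic `*` U) = n%:R%:E}.
  apply: (@poisson_ae_nat _ (T * fine (G U))); first exact: measurableX.
    by move=> [s z] [/=]; rewrite in_itv/= => /andP[s0 _] /U0.
  rewrite product_measure1E// EFinM fineK//; congr (_ * _)%E.
  rewrite /= lebesgue_measure_itv/= lte_fin; case: ifPn => [_|]; first by rewrite oppr0 adde0.
  by rewrite -leNgt => T0'; congr EFin; apply/eqP; rewrite eq_le T0 T0'.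
by move: h; apply: filterS => om [n ->]; rewrite ltry.
Qed.

(** The set has intensity 0, and a Poisson variable of parameter 0 vanishes. *)
Lemma poisson_time0 : {ae P, forall om, N om ([set 0] `*` R0) = 0%E}.
Proof.
case: hN => _ hP _ _.
have mR0 : measurable (@R0 R) by exact: measurable_R0.
have mC : measurable ([set 0 : R] `*` @R0 R) by exact: measurableX.
have C0 : (lebesgue_measure \x G)%E ([set 0 : R] `*` @R0 R) = 0%:E.
  by rewrite product_measure1E//= lebesgue_measure_set1 mul0e.
have Ch : [set 0 : R] `*` @R0 R `<=` half_space.
  by move=> [s z] [/= -> z0]; split => //=; rewrite lexx.
have := hP _ _ mC Ch C0 0%N; rewrite /poisson_prob ltxx diracE mem_set// => h.
have m0 : measurable [set om | N om ([set 0 : R] `*` @R0 R) = 0%:R%:E].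
  have := measurable_kernel N _ mC measurableT _ (emeasurable_set1 (0%:R%:E : \bar R)).
  by rewrite setTI.
exists (~` [set om | N om ([set 0 : R] `*` @R0 R) = 0%:R%:E]); split => //.
- exact: measurableC.
- by rewrite probability_setC// h subee.
Qed.

End poisson_facts.

(** * Conditional expectations and change of measure *)

Section conditional_expectation.
Context {R : realType} {d : measure_display} {Om : measurableType d}.
Variables (P : probability Om R) (S : set (set Om)) (Z Y : Om -> R).
Hypothesis sS : sigma_algebra setT S.
Hypothesis Sm : S `<=` measurable.
Hypothesis ZY : is_cond_exp P S Z Y.
Hypothesis Z0 : {ae P, forall om, 0 < Z om}.

Let mZ : measurable_fun setT Z.
Proof. by case: ZY => /integrableP[/measurable_EFinP]. Qed.

Let mY : measurable_fun setT Y.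
Proof. by case: ZY => _ /integrableP[/measurable_EFinP]. Qed.

(** The event where the conditional expectation is nonpositive belongs to [S];
    the integral of the positive variable over it is nonpositive, so that it is
    a null set. *)
Lemma cond_exp_gt0 : {ae P, forall om, 0 < Y om}.
Proof.
case: ZY => iZ iY SY ZYE.
pose A := Y @^-1` `]-oo, 0]%classic.
have SA : S A by exact: SY.
have mA := Sm SA.
have mAZ : measurable_fun A (EFin \o Z).
  by apply/measurable_EFinP; exact: measurable_funTS.
have A0 : (\int[P]_(om in A) `|(Z om)%:E| = 0)%E.
  apply/eqP; rewrite eq_le; apply/andP; split; last exact: integral_ge0.
  rewrite (ae_eq_integral (EFin \o Z))//; last 2 first.
  - exact: measurableT_comp.
  - by move: Z0; apply: filterS => om z0 _; rewrite gee0_abs// lee_fin ltW.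
  rewrite -ZYE//.
  under eq_integral do rewrite -[X in X%:E]opprK EFinN.
  rewrite integral_ge0N.
    by rewrite oppe_le0; apply: integral_ge0 => om; rewrite /A/= in_itv/= => ?; rewrite lee_fin oppr_ge0.
  by move=> om; rewrite /A/= in_itv/= => ?; rewrite lee_fin oppr_ge0.
move: A0 => /(ae_eq_integral_abs P mA mAZ) A0.
move: A0 Z0; apply: filterS2 => om /= A0 z0; rewrite ltNge; apply/negP => Y0.
have Aom : A om by rewrite /A/= in_itv.
by move: (A0 Aom) z0 => [->]; rewrite ltxx.
Qed.

(** The measures with densities [Y] and [Z] agree on [S], and
    [eq_integral_sub_measurable] applies. The common value may be infinite. *)
Lemma integral_cond_exp (phi : Om -> R) : measurable_fun setT phi ->
  sub_measurable S phi ->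
  (\int[P]_om (phi om * Y om)%:E = \int[P]_om (phi om * Z om)%:E)%E.
Proof.
case: (ZY) => iZ iY SY ZYE mphi Sphi.
have mpos (f : Om -> R) : measurable_fun setT f ->
    measurable_fun setT (fun om => Num.max (f om) 0).
  by move=> mf; exact: measurable_maxr.
have pos0 (f : Om -> R) om : 0 <= Num.max (f om) 0 by rewrite le_max lexx orbT.
have aepos (f k : Om -> R) D : measurable D -> measurable_fun setT f -> measurable_fun setT k ->
    {ae P, forall om, 0 < f om} ->
    (\int[P]_(om in D) (k om * Num.max (f om) 0)%:E = \int[P]_(om in D) (k om * f om)%:E)%E.
  move=> mD mf mk f0; apply: ae_eq_integral => //.
  - by apply/measurable_EFinP/measurable_funTS/measurable_funM => //; exact: mpos.
  - exact/measurable_EFinP/measurable_funTS/measurable_funM.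
  - by move: f0; apply: filterS => om f0 _; rewrite max_l// ltW.
pose nu1 := density_measure P (mpos _ mY) (pos0 Y).
pose nu2 := density_measure P (mpos _ mZ) (pos0 Z).
have nuE A : S A -> nu1 A = nu2 A.
  move=> SA; rewrite /nu1 /nu2 /density_measure.
  have mA := Sm SA.
  have := ZYE _ SA.
  have := aepos Y (cst 1) A mA mY (measurable_cst _) cond_exp_gt0.
  have := aepos Z (cst 1) A mA mZ (measurable_cst _) Z0.
  have E (f : Om -> R) : (\int[P]_(om in A) (cst (1 : R) om * f om)%:E = \int[P]_(om in A) (f om)%:E)%E.
    by apply: eq_integral => om _; rewrite mul1r.
  by rewrite !E => -> ->.
have := @eq_integral_sub_measurable _ _ _ nu1 nu2 S nuE phi mphi Sphi.
by rewrite !integral_density// (aepos Y)//; [rewrite (aepos Z)|exact: cond_exp_gt0].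
Qed.

(** With phi_n = min(Y, n) one has E phi_n^2 <= E[phi_n Y] = E[phi_n Z] <= (E
    phi_n^2 + E Z^2) / 2. The truncation makes E phi_n^2 finite, so that it can
    be subtracted; monotone convergence removes it. *)
Lemma cond_exp_sq_le :
  (\int[P]_om (Y om ^+ 2)%:E <= \int[P]_om (Z om ^+ 2)%:E)%E.
Proof.
have [->|Z2] := eqVneq (\int[P]_om (Z om ^+ 2)%:E)%E +oo%E; first exact: leey.
case: ZY => iZ iY SY ZYE.
pose phi (n : nat) om := Num.min (Num.max (Y om) 0) n%:R.
have mphi n : measurable_fun setT (phi n).
  by apply: measurable_minr => //; exact: measurable_maxr.
have Sphi n : sub_measurable S (phi n).
  apply/(S_measurableP _ sS).
  by apply: measurable_minr => //; apply: measurable_maxr => //; exact/(S_measurableP _ sS).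
have phi0 n om : 0 <= phi n om by rewrite le_min ler0n andbT le_max lexx orbT.
have phin n om : phi n om <= n%:R by rewrite ge_min lexx orbT.
have msq (f : Om -> R) : measurable_fun setT f ->
    measurable_fun setT (fun om => (f om ^+ 2)%:E).
  by move=> mf; apply/measurable_EFinP; exact: measurable_funX.
have bound n : (\int[P]_om (phi n om ^+ 2)%:E <= \int[P]_om (Z om ^+ 2)%:E)%E.
  have fin : (\int[P]_om (phi n om ^+ 2)%:E)%E \is a fin_num.
    rewrite ge0_fin_numE; last by apply: integral_ge0 => om _; rewrite lee_fin sqr_ge0.
    apply: (@le_lt_trans _ _ (\int[P]_om (n%:R ^+ 2)%:E)%E).
      apply: ge0_le_integral => //.
      - by move=> om _; rewrite lee_fin sqr_ge0.
      - exact: msq.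
      - by move=> om _; rewrite lee_fin ler_pXn2r// nnegrE.
    by rewrite integral_cst//= probability_setT mule1 ltry.
  have Zfin : (\int[P]_om (Z om ^+ 2)%:E)%E \is a fin_num.
    rewrite ge0_fin_numE ?lt_neqAle ?Z2 ?leey//.
    by apply: integral_ge0 => om _; rewrite lee_fin sqr_ge0.
  have absE (f : Om -> R) : measurable_fun setT f -> {ae P, forall om, 0 < f om} ->
      (\int[P]_om (phi n om * f om)%:E = \int[P]_om `|phi n om * f om|%:E)%E.
    move=> mf f0; apply: ae_eq_integral => //.
    - exact/measurable_EFinP/measurable_funM.
    - by apply/measurable_EFinP/measurableT_comp => //; exact: measurable_funM.
    - by move: f0; apply: filterS => om f0 _; rewrite ger0_norm// mulr_ge0// ltW.
  have le1 : (\int[P]_om (phi n om ^+ 2)%:E <= \int[P]_om (phi n om * Z om)%:E)%E.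
    rewrite -integral_cond_exp// (absE Y mY cond_exp_gt0).
    apply: ae_ge0_le_integral => //.
    - by move=> om _; rewrite lee_fin sqr_ge0.
    - exact: msq.
    - by apply/measurable_EFinP/measurableT_comp => //; exact: measurable_funM.
    - move: cond_exp_gt0; apply: filterS => om Y0 _.
      rewrite lee_fin (le_trans _ (ler_norm _))// expr2 ler_wpM2l//.
      by rewrite /phi max_l ?ge_min ?lexx// ltW.
  have le2 : (\int[P]_om (phi n om * Z om)%:E <=
      2^-1%:E * (\int[P]_om (phi n om ^+ 2)%:E + \int[P]_om (Z om ^+ 2)%:E))%E.
    rewrite -ge0_integralD//; last 4 first.
    - by move=> om _; rewrite lee_fin sqr_ge0.
    - exact: msq.
    - by move=> om _; rewrite lee_fin sqr_ge0.
    - exact: msq.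
    rewrite -ge0_integralZl//; last 2 first.
    - by apply: emeasurable_funD; exact: msq.
    - by move=> om _; rewrite -EFinD lee_fin addr_ge0// sqr_ge0.
    rewrite absE//; apply: ae_ge0_le_integral => //.
    - by apply/measurable_EFinP/measurableT_comp => //; exact: measurable_funM.
    - by move=> om _; rewrite -EFinD -EFinM lee_fin mulr_ge0// addr_ge0// sqr_ge0.
    - by apply: measurable_funeM; apply: emeasurable_funD; exact: msq.
    - apply: aeW => om _; rewrite -EFinD -EFinM lee_fin ler_norml.
      have := sqr_ge0 (phi n om - Z om); have := sqr_ge0 (phi n om + Z om).
      by move=> h1 h2; apply/andP; split; nra.
  have := le_trans le1 le2.
  rewrite -(fineK fin) -(fineK Zfin) -EFinD -EFinM !lee_fin; lra.
have limE om : limn (fun n => (phi n om ^+ 2)%:E) = (Num.max (Y om) 0 ^+ 2)%:E.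
  apply/cvg_lim => //; apply: cvg_near_cst; near=> n; congr (_%:E); congr (_ ^+ 2).
  by rewrite /phi min_l//; near: n; exact: nbhs_infty_ger.
rewrite (ae_eq_integral (fun om => (Num.max (Y om) 0 ^+ 2)%:E))//; last 3 first.
- exact: msq.
- by apply: msq; exact: measurable_maxr.
- by move: cond_exp_gt0; apply: filterS => om Y0 _; rewrite max_l// ltW.
under eq_integral do rewrite -limE.
rewrite monotone_convergence//; last 3 first.
- by move=> n; exact: msq.
- by move=> n om _; rewrite lee_fin sqr_ge0.
- move=> om _ i j ij; rewrite lee_fin ler_pXn2r ?nnegrE//.
  by rewrite le_min2 ?ler_nat.
apply: lime_le; last exact: nearW.
apply: ereal_nondecreasing_is_cvgn => i j ij; apply: ge0_le_integral => //.
- by move=> om _; rewrite lee_fin sqr_ge0.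
- exact: msq.
- exact: msq.
- move=> om _; rewrite lee_fin ler_pXn2r ?nnegrE//.
  by rewrite le_min2 ?ler_nat.
Unshelve. all: by end_near. Qed.

End conditional_expectation.

Lemma density_probability (R : realType) (d : measure_display) (Om : measurableType d)
    (P : probability Om R) (f : Om -> R) :
  measurable_fun setT f -> (forall om, 0 <= f om) -> (\int[P]_om (f om)%:E = 1)%E ->
  exists Q : probability Om R,
    forall B, measurable B -> Q B = (\int[P]_(om in B) (f om)%:E)%E.
Proof.
move=> mf f0 f1.
pose nu : {measure set Om -> \bar R} := density_measure P mf f0.
have nu1 : nu setT = 1%E by exact: f1.
have nuE B : mnormalize nu P B = nu B.
  by rewrite /mnormalize nu1 eqe oner_eq0/= invr1 mule1.
by exists (mnormalize nu P) => B mB; exact: nuE.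
Qed.

Section change_of_measure.
Context {R : realType} {d : measure_display} {Om : measurableType d}.
Variables (P : probability Om R) (T : R) (H : R -> set (set Om)).
Variables (D : Om -> R) (F : R -> Om -> R).
Hypothesis T0 : 0 <= T.
Hypothesis uH : usual_filtration P T H.
Hypothesis D0 : {ae P, forall om, 0 < D om}.
Hypothesis D1 : (\int[P]_om (D om)%:E = 1)%E.
Hypothesis DF : is_cond_exp P (H T) D (F T).

Let TT : 0 <= T <= T. Proof. by rewrite T0 lexx. Qed.
Let sH := usual_sigma_algebra uH TT.
Let mH := @usual_measurable _ _ _ _ _ _ uH T TT.

Let F0 : {ae P, forall om, 0 < F T om}.
Proof. exact: (cond_exp_gt0 mH DF D0). Qed.

Let mF : measurable_fun setT (F T).
Proof. by case: DF => _ /integrableP[/measurable_EFinP]. Qed.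

(** The density is F_T, and against H_T-measurable variables it acts as [D], of
    which it is the conditional expectation. *)
Lemma change_of_measure : exists Q : probability Om R,
  [/\ forall B, measurable B -> Q B = (\int[P]_(om in B) (F T om)%:E)%E,
      P `<< Q /\ Q `<< P
    & forall phi, measurable_fun setT phi -> sub_measurable (H T) phi ->
        (\int[Q]_om (phi om)%:E = \int[P]_om (phi om * D om)%:E)%E].
Proof.
have mFp : measurable_fun setT (fun om => Num.max (F T om) 0) by exact: measurable_maxr.
have Fp0 om : 0 <= Num.max (F T om) 0 by rewrite le_max lexx orbT.
have E (k : Om -> R) B : measurable B -> measurable_fun setT k ->
    (\int[P]_(om in B) (k om * Num.max (F T om) 0)%:E = \int[P]_(om in B) (k om * F T om)%:E)%E.
  move=> mB mk; apply: ae_eq_integral => //.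
  - by apply/measurable_EFinP/measurable_funTS/measurable_funM.
  - exact/measurable_EFinP/measurable_funTS/measurable_funM.
  - by move: F0; apply: filterS => om f0 _; rewrite max_l// ltW.
have E1 B : measurable B ->
    (\int[P]_(om in B) (Num.max (F T om) 0)%:E = \int[P]_(om in B) (F T om)%:E)%E.
  move=> mB; have := E (cst 1) B mB (measurable_cst _).
  have h (f : Om -> R) : (\int[P]_(om in B) (cst (1 : R) om * f om)%:E = \int[P]_(om in B) (f om)%:E)%E.
    by apply: eq_integral => om _; rewrite mul1r.
  by rewrite !h.
have Fp1 : (\int[P]_om (Num.max (F T om) 0)%:E = 1)%E.
  rewrite E1//; case: DF => _ _ _ ->//.
  by case: sH => h0 hC _; rewrite -(setD0 setT); exact: hC.
have [Q QE] := density_probability mFp Fp0 Fp1.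
have QF B : measurable B -> Q B = (\int[P]_(om in B) (F T om)%:E)%E.
  by move=> mB; rewrite QE// E1.
exists Q; split => //.
- split; apply/null_content_dominatesP => B mB.
    move=> /(etrans (esym (QE B mB))) QB.
    have mFB : measurable_fun B (fun om => (Num.max (F T om) 0)%:E).
      by apply/measurable_EFinP; exact: measurable_funTS.
    have : (\int[P]_(om in B) `|(Num.max (F T om) 0)%:E| = 0)%E.
      by rewrite -QB; apply: eq_integral => om _; rewrite gee0_abs// lee_fin.
    move/(ae_eq_integral_abs P mB mFB) => h.
    have nB : P.-negligible B.
      have : {ae P, forall om, ~ B om}.
        move: h F0; apply: filterS2 => om /= h f0 Bom.
        by move: (h Bom) => -[e0]; move: f0; rewrite ltNge -e0 le_max lexx.
      by case=> A [mA PA AB]; exists A; split => // om Bom; apply: AB => /(_ Bom).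
    exact: measure_negligible.
  move=> PB; apply: etrans (QE B mB) _.
  by apply: null_set_integral => //; apply/measurable_EFinP; exact: measurable_funTS.
- move=> phi mphi Sphi; rewrite -(integral_cond_exp mH DF D0 mphi Sphi) -E//.
  rewrite -(integral_density P mFp Fp0)//; apply: eq_measure_integral => B mB _.
  exact: QE.
Qed.

(** All integrals that occur in the martingale property are integrals of
    H_T-measurable variables, hence can be computed with the density [D]. *)
Lemma martingale_change_of_measure (Q : probability Om R) (M : R -> Om -> R) :
  (forall phi, measurable_fun setT phi -> sub_measurable (H T) phi ->
    (\int[Q]_om (phi om)%:E = \int[P]_om (phi om * D om)%:E)%E) ->
  (forall t, 0 <= t <= T -> S_measurable (H t) (M t)) ->
  (forall t, 0 <= t <= T -> P.-integrable setT (EFin \o (fun om => D om * M t om))) ->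
  (forall s t A, 0 <= s -> s <= t -> t <= T -> H s A ->
     (\int[P]_om (D om * (\1_A om * (M t om - M s om)))%:E = 0)%E) ->
  martingale Q T H M.
Proof.
move=> QD SM iM mM s t s0 st tT.
have tI : 0 <= t <= T by rewrite (le_trans s0 st) tT.
have sI : 0 <= s <= T by rewrite s0 (le_trans st tT).
have mD : measurable_fun setT D by case: DF => /integrableP[/measurable_EFinP].
have SMT r : 0 <= r <= T -> S_measurable (H T) (M r).
  move=> /andP[r0 rT]; apply: S_measurable_sub (usual_mono uH r0 rT (lexx _)) _.
  by apply: SM; rewrite r0.
have mMt r : 0 <= r <= T -> measurable_fun setT (M r).
  by move=> rI; apply: S_measurable_measurable (SMT _ rI).
have iQ r : 0 <= r <= T -> Q.-integrable setT (EFin \o M r).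
  move=> rI; apply/integrableP; split; first exact/measurable_EFinP/mMt.
  have -> : (\int[Q]_om `|(EFin \o M r) om| = \int[Q]_om (`|M r om|)%:E)%E by [].
  rewrite QD; last 2 first.
  - by apply: measurableT_comp => //; exact: mMt.
  - apply/(S_measurableP _ sH); apply: measurableT_comp => //; exact: SMT.
  have /integrableP[_] := iM r rI; apply: le_lt_trans.
  rewrite (ae_eq_integral (fun om => `|(EFin \o (fun om => (D om * M r om)%R)) om|)%E)//.
  - apply/measurable_EFinP/measurable_funM => //; apply: measurableT_comp => //; exact: mMt.
  - apply: measurableT_comp => //; apply/measurable_EFinP/measurable_funM => //; exact: mMt.
  - move: D0; apply: filterS => om d0 _ /=.
    by rewrite normrM (gtr0_norm d0) mulrC.
split; [exact: iQ tI|exact: iQ sI|by apply/(S_measurableP _ (usual_sigma_algebra uH sI)); exact: SM|].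
move=> A HA.
have mA : measurable A by exact: (usual_measurable uH sI HA).
have HTA : H T A by apply: (usual_mono uH s0 _ (lexx T) HA); case/andP: sI.
have ind r : 0 <= r <= T -> (\int[Q]_(om in A) (M r om)%:E =
    \int[P]_om (D om * (\1_A om * M r om))%:E)%E.
  move=> rI; transitivity (\int[Q]_om (\1_A om * M r om)%:E)%E.
    rewrite integral_mkcond; apply: eq_integral => om _.
    by rewrite patchE indicE; case: ifP; rewrite ?mul1r ?mul0r.
  rewrite QD.
  - by apply: eq_integral => om _; rewrite mulrC.
  - by apply: measurable_funM => //; exact: mMt.
  - apply/(S_measurableP _ sH); apply: measurable_funM; last exact: SMT.
    by apply: measurable_indic; exact: sub_sigma_algebra.
have iA r : 0 <= r <= T -> P.-integrable setT (EFin \o (fun om => D om * (\1_A om * M r om))).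
  move=> rI; apply: le_integrable (iM r rI) => //.
    apply/measurable_EFinP/measurable_funM => //; apply: measurable_funM; last exact: mMt.
    exact: measurable_indic.
  move=> om _ /=; rewrite lee_fin !normrM ler_wpM2l// indicE.
  by case: (om \in A); rewrite /= ?normr1 ?mul1r// normr0 mul0r.
rewrite !ind//.
have := mM s t A s0 st tT HA.
under eq_integral do rewrite mulrBr mulrBr EFinB.
rewrite integralB//; [|exact: iA|exact: iA].
rewrite -(fineK (integrable_fin_num measurableT (iA t tI))).
rewrite -(fineK (integrable_fin_num measurableT (iA s sI))).
by rewrite -EFinB => -[/subr0_eq ->].
Qed.

End change_of_measure.

(** * Complete probability spaces and utility functions *)

Section complete_probability.
Context {R : realType} {d : measure_display} {Om : measurableType d}.
Variable P : probability Om R.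
Hypothesis cP : measure_is_complete P.

Lemma complete_measurable_ae_eq (f g : Om -> R) : measurable_fun setT f ->
  {ae P, forall om, f om = g om} -> measurable_fun setT g.
Proof.
have sm := @sigma_algebra_measurable _ Om.
move=> mf fg; apply: (S_measurable_measurable (S := measurable)) => //.
apply: (measurable_ae_eq cP) fg; apply/(S_measurableP _ sm) => B mB.
by rewrite -[X in measurable X]setTI; exact: mf.
Qed.

Lemma complete_measurable_ae_cvg (f : nat -> Om -> R) (g : Om -> R) :
  (forall n, measurable_fun setT (f n)) ->
  {ae P, forall om, f n om @[n --> \oo] --> g om} -> measurable_fun setT g.
Proof.
have sm := @sigma_algebra_measurable _ Om.
move=> mf fg; apply: (S_measurable_measurable (S := measurable)) => //.
apply: (measurable_ae_cvg cP) fg => n; apply/(S_measurableP _ sm) => B mB.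
by rewrite -[X in measurable X]setTI; exact: mf.
Qed.

(** The derivative is the almost sure limit of difference quotients with steps
    1/(n+1), those for which the step stays in the interval. *)
Lemma measurable_derive1_family (phi : R -> Om -> R) (delta y : R) :
  (forall y, `|y| < delta -> measurable_fun setT (phi y)) ->
  {ae P, forall om, forall y, `|y| < delta -> derivable (phi ^~ om) y 1} ->
  `|y| < delta -> measurable_fun setT (fun om => derive1 (phi ^~ om) y).
Proof.
move=> mphi dphi yd.
pose q n om := if `|y + n.+1%:R^-1| < delta
  then n.+1%:R * (phi (y + n.+1%:R^-1) om - phi y om) else 0.
apply: (@complete_measurable_ae_cvg q) => [n|].
  rewrite /q; have [yn|_] := boolP (`|y + n.+1%:R^-1| < delta); last exact: measurable_cst.
  apply: measurable_funM => //.
  by apply: measurable_funB; exact: mphi.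
move: dphi; apply: filterS => om /(_ y yd); rewrite /derivable => /cvg_ex[l hl].
have -> : derive1 (phi ^~ om) y = l by rewrite derive1E; apply/cvg_lim.
have hn : harmonic n @[n --> \oo] --> (0 : R) := @cvg_harmonic R.
move/cvgr_dnbhsP : hl => /(_ harmonic) hl.
have {}hl : (harmonic n)^-1 *: (((phi ^~ om) \o shift y) (harmonic n *: 1) - phi y om) @[n --> \oo] --> l.
  by apply: hl; split => // n; rewrite /harmonic /= invr_eq0 pnatr_eq0.
apply: cvg_trans hl; apply: near_eq_cvg; near=> n.
rewrite /q ifT; last first.
  apply: le_lt_trans (ler_normD _ _) _; rewrite -ltrBrDl.
  near: n; move/cvgrPdist_lt : hn => /(_ (delta - `|y|)); rewrite subr_gt0 => /(_ yd).
  by apply: filterS => n; rewrite sub0r normrN.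
by rewrite /harmonic /= invrK [_%:A]mulr1 (addrC y).
Unshelve. all: by end_near. Qed.

End complete_probability.

Lemma ae_uniformly_integrable (R : realType) (d : measure_display) (Om : measurableType d)
    (P : probability Om R) (J : Type) (D : set J) (f g : J -> Om -> R) :
  (forall j, D j -> measurable_fun setT (f j)) ->
  (forall j, D j -> measurable_fun setT (g j)) ->
  (forall j, D j -> {ae P, forall om, f j om = g j om}) ->
  uniformly_integrable P D f -> uniformly_integrable P D g.
Proof.
move=> mf mg fg ui e e0; have [K hK] := ui e e0; exists K => j Dj.
rewrite (le_trans _ (hK j Dj))// !integral_excess.
rewrite (ae_eq_integral (fun om => (excess K (f j om))%:E))//.
- by apply/measurable_EFinP/measurableT_comp; [exact: measurable_excess|exact: mg].
- by apply/measurable_EFinP/measurableT_comp; [exact: measurable_excess|exact: mf].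
- by move: (fg j Dj); apply: filterS => om -> _.
Qed.

Section utility_of_exponential.
Context {R : realType}.
Variables (U : R -> R) (x0 : R).
Hypothesis hU : utility U.
Hypothesis x00 : 0 < x0.

(** The derivative at [x] exceeds that at [x + 1], which is nonnegative because
    [U] increases. *)
Lemma utility_derive_gt0 x : 0 < x -> 0 < derive1 U x.
Proof.
move=> x_gt0; case: hU => Uinc _ dU dU'.
have ge0 y : 0 < y -> 0 <= derive1 U y.
  move=> y0; have := dU y y0; rewrite /derivable => /cvg_ex[l hl].
  have -> : derive1 U y = l by rewrite derive1E; apply/cvg_lim.
  move/cvgr_dnbhsP : hl => /(_ harmonic) hl.
  have {}hl : (harmonic n)^-1 *: ((U \o shift y) (harmonic n *: 1) - U y) @[n --> \oo] --> l.
    by apply: hl; split; [move=> n; rewrite /harmonic /= invr_eq0 pnatr_eq0|exact: cvg_harmonic].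
  rewrite -(cvg_lim _ hl)//; apply: limr_ge; first by apply/cvg_ex; exists l.
  apply: nearW => n; rewrite /GRing.scale/= mulr1 mulr_ge0 ?invr_ge0 ?invrK ?ler0n//.
  by rewrite subr_ge0 ltW// Uinc// ltrDr invr_gt0 ltr0n.
apply: le_lt_trans (ge0 (x + 1) _) (dU' x (x + 1) x_gt0 _); first by rewrite addr_gt0.
by rewrite ltrDl.
Qed.

Let X x := x0 * expR x.

Let X0 x : 0 < X x. Proof. by rewrite mulr_gt0// expR_gt0. Qed.

Lemma derivable_utility_exp x : derivable (fun x => U (x0 * expR x)) x 1.
Proof.
apply/derivable1_diffP; apply: (@differentiable_comp _ _ _ _ X U).
  by apply/derivable1_diffP.
by apply/derivable1_diffP; case: hU => _ _ h _; exact: h.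
Qed.

Lemma derive1_utility_exp x :
  derive1 (fun x => U (x0 * expR x)) x = derive1 U (x0 * expR x) * (x0 * expR x).
Proof.
have dX : derivable X x 1 by [].
rewrite (derive1_comp dX); last by case: hU => _ _ h _; exact: h.
by congr (_ * _); rewrite derive1E; apply: derive_val.
Qed.

Lemma measurable_utility_exp : measurable_fun setT (fun x => U (x0 * expR x)).
Proof.
apply: continuous_measurable_fun => x.
by apply: differentiable_continuous; apply/derivable1_diffP; exact: derivable_utility_exp.
Qed.

Lemma measurable_marginal_utility_exp :
  measurable_fun setT (fun x => derive1 U (x0 * expR x) * (x0 * expR x)).
Proof.
under eq_fun do rewrite -derive1_utility_exp.
apply: (measurable_derive1_comp (h := fun _ : R => fun x => U (x0 * expR x)) (g := id)).
- by move=> y; exact: measurable_cst.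
- exact: measurable_id.
by move=> _ y; exact: derivable_utility_exp.
Qed.

End utility_of_exponential.

(** * The first-order condition of the investor *)

Lemma derivable_scale (R : realType) (f : R -> R) (c y : R) : derivable f y 1 ->
  derivable (fun x => c * f x) y 1 /\ derive1 (fun x => c * f x) y = c * derive1 f y.
Proof. by move=> df; split; [exact: derivableM|rewrite derive1Ml]. Qed.

Section optimal_strategy.
Context {R : realType} {d : measure_display} {Om : measurableType d}.
Variables (m : market R Om) (U : R -> R) (g : R -> R * R * R * R -> Om -> R).
Variables (eps : @prior R d Om -> R -> Om -> R) (Q : probability Om R).
Variables (A1' : set (@strategy R d Om)) (A2' : set (@prior R d Om)).
Variables (us : @strategy R d Om) (vs : @prior R d Om).
Local Notation P := (pr m).
Local Notation T := (horizon m).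
Local Notation H := (filH m).
Local Notation leb := (@lebesgue_measure R).
Local Notation E := (eps vs).
Hypothesis T0 : 0 < T.
Hypothesis uH : usual_filtration P T H.
Hypothesis X00 : 0 < X0 m.
Hypothesis hU : utility U.
Hypothesis hg : penalty m g.
Hypothesis hE : prior_density m vs E Q.
Hypothesis adm1 : admissible_strategies m U A1'.
Hypothesis adm2 : admissible_priors m g eps A2'.
Hypothesis opt : optimal_pair (payoff m U g eps) A1' A2' us vs.
Hypothesis reg : u_regular m U A1' us E.

Let T00 : 0 <= T := ltW T0.

Let TT : 0 <= T <= T. Proof. by rewrite T00 lexx. Qed.

Let cP : measure_is_complete P.
Proof. exact: usual_complete uH T00. Qed.

Let A2vs : A2 m vs.
Proof. by case: opt => -[_ /adm2[]]. Qed.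

Lemma measurable_prior_density t : 0 <= t <= T -> measurable_fun setT (E t).
Proof.
case: hE => _ mE _ _ /andP[t0 tT].
by case: (mE t T t0 tT (lexx _)) => _ /integrableP[/measurable_EFinP].
Qed.

(** The prior gives mass 0 to the event where its density is nonpositive, and
    [P] is absolutely continuous with respect to the prior. *)
Lemma prior_density_gt0 : {ae P, forall om, 0 < E T om}.
Proof.
case: hE => _ _ QE PQ.
pose A := E T @^-1` `]-oo, 0]%classic.
have mA : measurable A.
  by rewrite -[A]setTI; apply: (measurable_prior_density TT).
have : Q A = 0%E.
  apply/eqP; rewrite eq_le measure_ge0 andbT QE//.
  under eq_integral do rewrite -[X in X%:E]opprK EFinN.
  rewrite integral_ge0N.
    by rewrite oppe_le0; apply: integral_ge0 => om; rewrite /A/= in_itv/= => ?; rewrite lee_fin oppr_ge0.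
  by move=> om; rewrite /A/= in_itv/= => ?; rewrite lee_fin oppr_ge0.
move/null_content_dominatesP : PQ => /(_ A mA) /[apply] PA.
exists A; split => // om /= /negP; rewrite -leNgt => h.
by rewrite /A/= in_itv.
Qed.

Lemma jointly_measurable_prior_density :
  measurable_fun (setT : set (R * Om)) (fun p => E (clamp T p.1) p.2).
Proof.
apply: cadlag_jointly_measurable => //; first exact: measurable_prior_density.
by case: hE => -[M [A [_ [cE _ _]]]] _ _ _ om s /(cE om).1.
Qed.

Lemma jointly_measurable_penalty :
  measurable_fun (setT : set (R * Om)) (fun p => g (clamp T p.1) (vs (clamp T p.1) p.2) p.2).
Proof.
case: A2vs => -[h1 h2 h3 h4 _] _ _ _.
have joint (X : R -> Om -> R) : caglad_adapted T H X ->
    measurable_fun (setT : set (R * Om)) (fun p => X (clamp T p.1) p.2).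
  move=> [cX aX]; apply: caglad_jointly_measurable => //.
    move=> s sI; apply: (S_measurable_measurable (usual_sigma_algebra uH sI) (@usual_measurable _ _ _ _ _ _ uH s sI)).
    apply/(S_measurableP _ (usual_sigma_algebra uH sI)); exact: aX.
  by move=> om s /(cX om).1.
have mv : measurable_fun (setT : set (R * Om)) (fun p => vs (clamp T p.1) p.2).
  rewrite (_ : (fun p => _) = (fun p => (((th1 vs (clamp T p.1) p.2, th2 vs (clamp T p.1) p.2),
     th3 vs (clamp T p.1) p.2), th4 vs (clamp T p.1) p.2))).
    by apply: measurable_fun_pair; [apply: measurable_fun_pair; [apply: measurable_fun_pair|]|]; exact: joint.
  by apply/funext => p; rewrite /th1 /th2 /th3 /th4; case: (vs _ _) => [[[]]].
apply: (@measurable_comp _ _ _ _ _ _ ((`[0, T]%classic `*` setT) `*` setT)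
  (fun x : (R * (R * R * R * R)) * Om => g x.1.1 x.1.2 x.2) setT
  (fun p : R * Om => ((clamp T p.1, vs (clamp T p.1) p.2), p.2))).
- by apply: measurableX => //; exact: measurableX.
- by move=> _ [p _ <-] /=; rewrite in_itv/= clamp_itv.
- by case: hg.
- apply: measurable_fun_pair => //; apply: measurable_fun_pair => //.
  exact: measurable_clamp_fst.
Qed.

Let measurable_square (f : R * Om -> R) : measurable_fun setT f ->
  measurable_fun setT (fun p => (f p ^+ 2)%:E).
Proof. by move=> mf; apply/measurable_EFinP; exact: measurable_funX. Qed.

Let measurable_time_integral_square (f : R * Om -> R) : measurable_fun setT f ->
  measurable_fun setT (fun om => \int[leb]_(s in `[0%R, T]) (f (s, om) ^+ 2)%:E)%E.
Proof.
move=> mf; apply: (measurable_lebesgue_integral_param (g := fun p => (f p ^+ 2)%:E)) => //.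
  exact: measurable_square.
by move=> p; rewrite lee_fin sqr_ge0.
Qed.

Let penalty_square om :
  (\int[leb]_(s in `[0%R, T]) (g (clamp T s) (vs (clamp T s) om) om ^+ 2)%:E =
   \int[leb]_(s in `[0%R, T]) (`|g s (vs s om) om| ^+ 2)%:E)%E.
Proof.
apply: eq_integral => s; rewrite inE/= in_itv/= => sI.
by rewrite clamp_id// -normrX ger0_norm// sqr_ge0.
Qed.

Let mpen := measurable_time_integral_square jointly_measurable_penalty.

Let square_integrable :
  (\int[P]_om ((`|E T om| ^+ 2)%:E +
     \int[leb]_(s in `[0%R, T]) (g (clamp T s) (vs (clamp T s) om) om ^+ 2)%:E) < +oo)%E.
Proof.
by case: opt => -[_ /adm2[_ h]] _ _ _ _; under eq_integral do rewrite penalty_square.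
Qed.

Let mE2 : measurable_fun setT (fun om => (`|E T om| ^+ 2)%:E).
Proof.
apply/measurable_EFinP/measurable_funX/measurableT_comp => //.
exact: measurable_prior_density.
Qed.

Lemma square_integrable_prior_density : (\int[P]_om (E T om ^+ 2)%:E < +oo)%E.
Proof.
apply: le_lt_trans square_integrable; apply: ge0_le_integral => //.
- by move=> om _; rewrite lee_fin sqr_ge0.
- by apply/measurable_EFinP/measurable_funX; exact: measurable_prior_density.
- exact: emeasurable_funD.
- move=> om _; rewrite -normrX ger0_norm ?sqr_ge0// leeDl//.
  by apply: integral_ge0 => s _; rewrite lee_fin sqr_ge0.
Qed.

Lemma square_integrable_penalty :
  (\int[P]_om \int[leb]_(s in `[0%R, T]) (g (clamp T s) (vs (clamp T s) om) om ^+ 2)%:E < +oo)%E.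
Proof.
apply: le_lt_trans square_integrable; apply: ge0_le_integral => //.
- by move=> om _; apply: integral_ge0 => s _; rewrite lee_fin sqr_ge0.
- exact: emeasurable_funD.
- by move=> om _; rewrite leeDr// lee_fin sqr_ge0.
Qed.

(** By 2 |eps g| <= eps^2 + g^2 and Tonelli, as E eps_s^2 <= E eps_T^2 for all
    s. *)
Lemma integrable_running_penalty : P.-integrable setT
  (EFin \o (fun om => \int[leb]_(s in `[0, T]) (E s om * g s (vs s om) om))).
Proof.
pose q (p : R * Om) := E (clamp T p.1) p.2 * g (clamp T p.1) (vs (clamp T p.1) p.2) p.2.
have mE := jointly_measurable_prior_density.
have mg := jointly_measurable_penalty.
have mq : measurable_fun setT q by exact: measurable_funM.
have qE om : \int[leb]_(s in `[0, T]) (E s om * g s (vs s om) om) =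
    \int[leb]_(s in `[0, T]) q (s, om).
  by apply: eq_Rintegral => s; rewrite inE/= in_itv/= => sI; rewrite /q/= clamp_id.
have mI : measurable_fun setT (fun om => \int[leb]_(s in `[0, T]) q (s, om)).
  exact: measurable_lebesgue_Rintegral_param.
have sq := measurable_square.
have msec (f : R * Om -> \bar R) om : measurable_fun setT f ->
    measurable_fun (`[0, T] : set (measurableTypeR R)) (fun s => f (s, om)).
  by move=> mf; apply: measurable_funTS; apply: measurableT_comp => //; exact: measurable_pair2.
under [X in P.-integrable _ (EFin \o X)]eq_fun do rewrite qE.
apply/integrableP; split; first exact/measurable_EFinP.
apply: (@le_lt_trans _ _ (\int[P]_om (\int[leb]_(s in `[0%R, T]) (E (clamp T s) om ^+ 2)%:E
   + \int[leb]_(s in `[0%R, T]) (g (clamp T s) (vs (clamp T s) om) om ^+ 2)%:E))%E).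
  apply: ge0_le_integral => //.
  - by apply: measurableT_comp => //; exact/measurable_EFinP.
  - apply: emeasurable_funD; first exact: (measurable_time_integral_square mE).
    exact: (measurable_time_integral_square mg).
  - move=> om _ /=.
    have mqs : measurable_fun (`[0, T] : set (measurableTypeR R)) (fun s => q (s, om)).
      by apply: measurable_funTS; apply: measurableT_comp => //; exact: measurable_pair2.
    apply: (@le_trans _ _ (\int[leb]_(s in `[0%R, T]) `|q (s, om)|%:E)%E).
      exact: (@abs_Rintegral_le R _ (measurableTypeR R) leb).
    rewrite -ge0_integralD//; last 4 first.
    - by move=> s _; rewrite lee_fin sqr_ge0.
    - by apply: (msec (fun p => (E (clamp T p.1) p.2 ^+ 2)%:E)); exact: sq.
    - by move=> s _; rewrite lee_fin sqr_ge0.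
    - by apply: (msec (fun p => (g (clamp T p.1) (vs (clamp T p.1) p.2) p.2 ^+ 2)%:E)); exact: sq.
    apply: ge0_le_integral => //.
    - by apply: (msec (fun p => `|q p|%:E)); apply/measurable_EFinP; exact: measurableT_comp.
    - apply: emeasurable_funD.
      + by apply: (msec (fun p => (E (clamp T p.1) p.2 ^+ 2)%:E)); exact: sq.
      + by apply: (msec (fun p => (g (clamp T p.1) (vs (clamp T p.1) p.2) p.2 ^+ 2)%:E)); exact: sq.
    - move=> s _; rewrite -EFinD lee_fin ler_norml /q/=.
      set a := E _ _; set b := g _ _ _.
      have := sqr_ge0 (a - b); have := sqr_ge0 (a + b).
      have := sqr_ge0 a; have := sqr_ge0 b.
      by move=> h1 h2 h3 h4; apply/andP; split; nra.
rewrite ge0_integralD//; last 3 first.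
- by move=> om _; apply: integral_ge0 => s _; rewrite lee_fin sqr_ge0.
- exact: (measurable_time_integral_square mE).
- by move=> om _; apply: integral_ge0 => s _; rewrite lee_fin sqr_ge0.
apply: lte_add_pinfty; last exact: square_integrable_penalty.
have mE2' := sq _ mE.
rewrite (@tonelli_swap R _ _ (measurableTypeR R) Om leb P `[0%R, T]%classic
  (fun p => (E (clamp T p.1) p.2 ^+ 2)%:E))//; last by move=> p; rewrite lee_fin sqr_ge0.
have C0 := square_integrable_prior_density.
apply: (@le_lt_trans _ _ (\int[leb]_(s in `[0%R, T]) \int[P]_om (E T om ^+ 2)%:E)%E).
  apply: ge0_le_integral => //.
  - by move=> s _; apply: integral_ge0 => om _; rewrite lee_fin sqr_ge0.
  - apply: measurable_funTS.
    apply: (@measurable_integral_param R _ _ (measurableTypeR R) Om P setT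
      (fun p => (E (clamp T p.1) p.2 ^+ 2)%:E)) => //.
    by move=> p; rewrite lee_fin sqr_ge0.
  - move=> s; rewrite /= in_itv/= => sI; rewrite clamp_id//.
    case: hE => _ mgE _ _; have /andP[s0 sT] := sI.
    exact: (cond_exp_sq_le (usual_sigma_algebra uH sI) (@usual_measurable _ _ _ _ _ _ uH s sI)
      (mgE s T s0 sT (lexx _)) prior_density_gt0).
have C1 : (0 <= \int[P]_om (E T om ^+ 2)%:E)%E.
  by apply: integral_ge0 => om _; rewrite lee_fin sqr_ge0.
move: C0 C1; move: (\int[P]_om (E T om ^+ 2)%:E)%E => C C0 C1.
rewrite integral_cst//= lebesgue_measure_itv/= lte_fin T0 -EFinD.
by rewrite -(@fineK _ C) -?EFinM ?ltry// ge0_fin_numE.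
Qed.

(** Both products are bounded by the integrable sum of the squares of their
    factors. *)
Lemma integrable_utility (L : Om -> R) (u : @strategy R d Om) : A1' u ->
  measurable_fun setT L -> {ae P, forall om, L om = log_return m u T om} ->
  P.-integrable setT (EFin \o (fun om => E T om * U (X0 m * expR (L om)))) /\
  P.-integrable setT (EFin \o (fun om =>
    E T om * (derive1 U (X0 m * expR (L om)) * (X0 m * expR (L om))))).
Proof.
move=> A1u mL Lu; have [_ fin] := adm1 A1u.
have mU : measurable_fun setT (fun om => U (X0 m * expR (L om))).
  by apply: (measurableT_comp (measurable_utility_exp hU X00)).
have mU' : measurable_fun setT (fun om => derive1 U (X0 m * expR (L om)) * (X0 m * expR (L om))).
  by apply: (measurableT_comp (measurable_marginal_utility_exp hU X00)).
have mET := measurable_prior_density TT.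
pose B om := `|U (X0 m * expR (L om))| ^+ 2
  + `|derive1 U (X0 m * expR (L om)) * (X0 m * expR (L om))| ^+ 2.
have mB : measurable_fun setT B.
  by apply: measurable_funD; apply: measurable_funX; exact: measurableT_comp.
have B0 om : 0 <= B om by rewrite addr_ge0 ?sqr_ge0.
have iB : P.-integrable setT (EFin \o (fun om => E T om ^+ 2 + B om)).
  apply: (@integrableD _ _ _ P setT measurableT (EFin \o (fun om => E T om ^+ 2)) (EFin \o B)).
    apply/integrableP; split; first exact/measurable_EFinP/measurable_funX.
    have := square_integrable_prior_density; congr (_ < _)%E.
    by apply: eq_integral => om _; rewrite /= ger0_norm ?sqr_ge0.
  apply/integrableP; split; first exact/measurable_EFinP.
  rewrite (_ : \int[P]_om _ = \int[P]_om (`|U (wealth m u T om)| ^+ 2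
                 + `|derive1 U (wealth m u T om) * wealth m u T om| ^+ 2)%:E)%E//.
  apply: ae_eq_integral => //.
  - by apply: measurableT_comp => //; exact/measurable_EFinP.
  - apply/measurable_EFinP; apply: (complete_measurable_ae_eq cP mB).
    by move: Lu; apply: filterS => om e; rewrite /B /wealth e.
  - by move: Lu; apply: filterS => om e _; rewrite /B /wealth /= -e ger0_norm.
split; apply: le_integrable iB => //.
- exact/measurable_EFinP/measurable_funM.
- move=> om _; rewrite /= lee_fin (ger0_norm (addr_ge0 (sqr_ge0 _) (B0 _))) ler_norml.
  rewrite /B; set a := E _ _; set b := U _; set c := derive1 U _ * _.
  have := sqr_ge0 (a - b); have := sqr_ge0 (a + b); have := sqr_ge0 `|c|.
  rewrite -[`|b| ^+ 2]normrX (ger0_norm (sqr_ge0 b)).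
  have := sqr_ge0 a; have := sqr_ge0 b.
  by move=> h1 h2 h3 h4 h5; apply/andP; split; nra.
- exact/measurable_EFinP/measurable_funM.
- move=> om _; rewrite /= lee_fin (ger0_norm (addr_ge0 (sqr_ge0 _) (B0 _))) ler_norml.
  rewrite /B; set a := E _ _; set b := U _; set c := derive1 U _ * _.
  have := sqr_ge0 (a - c); have := sqr_ge0 (a + c); have := sqr_ge0 `|b|.
  rewrite -[`|c| ^+ 2]normrX (ger0_norm (sqr_ge0 c)).
  have := sqr_ge0 a; have := sqr_ge0 c.
  by move=> h1 h2 h3 h4 h5; apply/andP; split; nra.
Qed.

Lemma payoff_version (L : Om -> R) (u : @strategy R d Om) : A1' u ->
  measurable_fun setT L -> {ae P, forall om, L om = log_return m u T om} ->
  payoff m U g eps u vs = (\int[P]_om (E T om * U (X0 m * expR (L om)))%:E +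
    \int[P]_om (\int[leb]_(s in `[0, T]) (E s om * g s (vs s om) om))%:E)%E.
Proof.
move=> A1u mL Lu.
have [iU _] := integrable_utility A1u mL Lu.
have iR := integrable_running_penalty.
have mU : measurable_fun setT (fun om => E T om * U (X0 m * expR (L om))).
  by case/integrableP: iU => /measurable_EFinP.
have mR : measurable_fun setT (fun om => \int[leb]_(s in `[0, T]) (E s om * g s (vs s om) om)).
  by case/integrableP: iR => /measurable_EFinP.
rewrite -integralD// /payoff unlock; apply: ae_eq_integral => //.
- apply/measurable_EFinP; apply: (complete_measurable_ae_eq cP (measurable_funD mU mR)).
  by move: Lu; apply: filterS => om e; rewrite /wealth -e.
- exact/measurable_EFinP/measurable_funD.
- by move: Lu; apply: filterS => om e _; rewrite /wealth -e.
Qed.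

(** The running penalty does not depend on the strategy and has a finite
    expectation, so that it cancels from the inequality between payoffs. *)
Lemma expected_utility_max (L L' : Om -> R) (u : @strategy R d Om) : A1' u ->
  measurable_fun setT L -> {ae P, forall om, L om = log_return m u T om} ->
  measurable_fun setT L' -> {ae P, forall om, L' om = log_return m us T om} ->
  (\int[P]_om (E T om * U (X0 m * expR (L om)))%:E <=
   \int[P]_om (E T om * U (X0 m * expR (L' om)))%:E)%E.
Proof.
move=> A1u mL Lu mL' Lus; case: opt => -[A1us _] _ _ sup _.
have [iU _] := integrable_utility A1u mL Lu.
have [iU' _] := integrable_utility A1us mL' Lus.
have : (payoff m U g eps u vs <= payoff m U g eps us vs)%E.
  by rewrite sup; apply: ereal_sup_ubound; exists u.
rewrite (payoff_version A1u mL Lu) (payoff_version A1us mL' Lus).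
by rewrite leeD2rE// integrable_fin_num//; exact: integrable_running_penalty.
Qed.

Lemma perturb0 (alpha : @strategy R d Om) : perturb us 0 alpha = us.
Proof.
by case: us => pi kappa; congr pair; apply/funext => t; apply/funext => om;
  rewrite /= mul0r addr0.
Qed.

Lemma integrable_marginal_utility (alpha : @strategy R d Om) :
  A1' alpha -> bounded_strategy m alpha ->
  P.-integrable setT (EFin \o (fun om =>
    E T om * derive1 U (wealth m us T om) * wealth m us T om)).
Proof.
move=> A1a ba; case: reg => /(_ alpha A1a ba) [delta [d0 _ [L [hL _ _ _]]]] _.
have [mL] : measurable_fun setT (L 0) /\ {ae P, forall om, L 0 om = log_return m us T om}.
  by have := hL 0; rewrite normr0 perturb0; apply.
have A1us : A1' us by case: opt => -[].
move=> LE; have [_ iU] := integrable_utility A1us mL LE.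
have UE : {ae P, forall om, E T om * (derive1 U (X0 m * expR (L 0 om)) * (X0 m * expR (L 0 om))) =
    E T om * derive1 U (wealth m us T om) * wealth m us T om}.
  by move: LE; apply: filterS => om e; rewrite /wealth -e -[RHS]mulrA.
apply: ae_eq_integrable iU => //.
  apply/measurable_EFinP; apply: (complete_measurable_ae_eq cP _ UE).
  by have /integrableP[/measurable_EFinP] := (integrable_utility A1us mL LE).2.
by move: UE; apply: filterS => om /= -> _.
Qed.

(** [mean_derivative_at_max] for y |-> eps_T U(X0 exp(L_y)), whose derivative at
    0 is Z times the derivative of the logarithmic return. *)
Lemma first_order_condition (alpha : @strategy R d Om) :
  A1' alpha -> bounded_strategy m alpha ->
  dlog_integrable m us alpha /\
  (P.-integrable setT (EFin \o (fun om =>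
     E T om * derive1 U (wealth m us T om) * wealth m us T om * dlog_return m us alpha om)) /\
   (\int[P]_om (E T om * derive1 U (wealth m us T om) * wealth m us T om
     * dlog_return m us alpha om)%:E = 0)%E).
Proof.
move=> A1a ba; case: (reg) => /(_ alpha A1a ba) [delta [d0 A1p [L [hL dX dlog ui]]]] _.
pose X y om := X0 m * expR (L y om).
have z0 : `|0 : R| < delta by rewrite normr0.
have XE om y : 0 < X y om by rewrite mulr_gt0// expR_gt0.
have dU x : 0 < x -> derivable U x 1 by case: hU => _ _ h _; exact: h.
pose phi y om := E T om * U (X y om).
have dphi om y : derivable (X ^~ om) y 1 -> derivable (phi ^~ om) y 1 /\
    derive1 (phi ^~ om) y = E T om * derive1 U (X y om) * derive1 (X ^~ om) y.
  move=> dXy.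
  have dUX : derivable (U \o (X ^~ om)) y 1.
    apply/derivable1_diffP; apply: differentiable_comp; first exact/derivable1_diffP.
    by apply/derivable1_diffP; exact: dU.
  have [h1 h2] := derivable_scale (E T om) dUX; split => //.
  by rewrite h2 (derive1_comp dXy (dU _ (XE om y))) mulrA.
have mphi y : `|y| < delta -> measurable_fun setT (phi y).
  move=> yd; have [mL _] := hL y yd.
  apply: measurable_funM; first exact: measurable_prior_density.
  exact: (measurableT_comp (measurable_utility_exp hU X00) mL).
have aedphi : {ae P, forall om, forall y, `|y| < delta -> derivable (phi ^~ om) y 1}.
  by move: dX; apply: filterS => om h y yd; have [] := dphi om y (h y yd).
have mdphi y : `|y| < delta -> measurable_fun setT (fun om => derive1 (phi ^~ om) y).
  exact: (measurable_derive1_family cP mphi aedphi).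
have uiphi : uniformly_integrable P [set y | `|y| < delta] (fun y om => derive1 (phi ^~ om) y).
  have aeE y : `|y| < delta -> {ae P, forall om, derive1 (phi ^~ om) y =
      E T om * derive1 U (X y om) * derive1 (X ^~ om) y}.
    by move=> yd; move: dX; apply: filterS => om h; have [] := dphi om y (h y yd).
  apply: ae_uniformly_integrable ui => //.
  - by move=> y yd; exact: (complete_measurable_ae_eq cP (mdphi y yd) (aeE y yd)).
  - by move=> y yd; move: (aeE y yd); apply: filterS => om ->.
have [Lus] : measurable_fun setT (L 0) /\ {ae P, forall om, L 0 om = log_return m us T om}.
  by have := hL 0 z0; rewrite perturb0.
move=> L0E.
have [iD ID] := mean_derivative_at_max d0
  (fun y yd => (integrable_utility (A1p y yd) (hL y yd).1 (hL y yd).2).1)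
  aedphi mdphi uiphi
  (fun y yd => expected_utility_max (A1p y yd) (hL y yd).1 (hL y yd).2 Lus L0E).
have [dint dlogE] := dlog 0 z0; rewrite perturb0 in dint dlogE.
have DE : {ae P, forall om, derive1 (phi ^~ om) 0 =
   E T om * derive1 U (wealth m us T om) * wealth m us T om * dlog_return m us alpha om}.
  move: dX dlogE L0E; apply: filterS3 => om dXom e1 e2.
  have [_ ->] := dphi om 0 (dXom 0 z0).
  by rewrite -/X e1 /X /wealth e2 !mulrA.
have mD : measurable_fun setT (fun om => E T om * derive1 U (wealth m us T om) *
    wealth m us T om * dlog_return m us alpha om).
  exact: (complete_measurable_ae_eq cP (mdphi 0 z0) DE).
split => //; split.
  apply: ae_eq_integrable iD => //; first exact/measurable_EFinP.
  by move: DE; apply: filterS => om /= -> _.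
rewrite -ID; apply: ae_eq_integral => //.
- exact/measurable_EFinP.
- by apply/measurable_EFinP; exact: mdphi.
- by move: DE; apply: filterS => om /= -> _.
Qed.

End optimal_strategy.

(** * Time integrals and jump terms *)

Section time_integrals.
Context {R : realType} {d : measure_display} {Om : measurableType d}.
Variables (T : R) (H : R -> set (set Om)).
Local Notation leb := (@lebesgue_measure R).
Hypothesis T0 : 0 <= T.

Let TT : 0 <= T <= T. Proof. by rewrite T0 lexx. Qed.

Definition progressive (D : R -> Om -> R) := forall t, 0 <= t <= T ->
  measurable_fun (setT : set (R * g_sigma_algebraType (H t))) (fun p => D (clamp t p.1) p.2).

Lemma progressive_path (D : R -> Om -> R) om : progressive D ->
  measurable_fun (`[0, T] : set R) (D ^~ om).
Proof.
move=> pD; apply: (eq_measurable_fun (fun s => D (clamp T s) om)).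
  by move=> s; rewrite inE/= in_itv/= => sT; rewrite clamp_id.
apply: measurable_funTS.
exact: (measurableT_comp (pD T TT) (@pair2_measurable _ _ _ (g_sigma_algebraType (H T)) om)).
Qed.

Lemma time_integral_adapted (D : R -> Om -> R) t : progressive D -> 0 <= t <= T ->
  S_measurable (H t) (fun om => \int[leb]_(s in `[0, t]) D s om).
Proof.
move=> pD t0T; rewrite /S_measurable.
rewrite (_ : (fun om => _) = (fun om => \int[leb]_(s in `[0, t]) D (clamp t s) om)).
  exact: (measurable_lebesgue_Rintegral_param (X := g_sigma_algebraType (H t))
    (f := fun p => D (clamp t p.1) p.2) (measurable_itv _) (pD t t0T)).
apply/funext => om; apply: eq_Rintegral => s; rewrite inE/= in_itv/= => st.
by rewrite clamp_id.
Qed.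

(** The restriction of an integrand to ]0, T] comes from the strategy that is
    invested on the whole period. *)
Lemma integrable_drop_time0 (D Y : R -> Om -> R) om : progressive D ->
  (forall s, Y s om = \1_(`]0, T]%classic) s * D s om) ->
  (\int[leb]_(s in `[0%R, T]) `|Y s om|%:E < +oo)%E ->
  leb.-integrable `[0, T] (EFin \o (D ^~ om)).
Proof.
move=> pD YE fin; apply/integrableP; split.
  by apply/measurable_EFinP; exact: progressive_path.
apply: le_lt_trans fin; rewrite le_eqVlt; apply/orP; left; apply/eqP/esym.
apply: (integral_drop_time0 (F := fun s => `|(D s om)%:E|%E)).
- apply: measurableT_comp => //; apply/measurable_EFinP; exact: progressive_path.
- by move=> s sT; rewrite YE indicE mem_set/= ?in_itv// mul1r.
- by rewrite YE indicE memNset ?mul0r ?normr0//= in_itv/= ltxx.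
Qed.

Lemma time_integral_increment (f : R -> R) (k t t' : R) : 0 <= t -> t <= t' -> t' <= T ->
  leb.-integrable `[0, T] (EFin \o f) ->
  \int[leb]_(s in `[0, T]) (k * \1_(`]t, t']%classic) s * f s) =
  k * (\int[leb]_(s in `[0, t']) f s - \int[leb]_(s in `[0, t]) f s).
Proof.
move=> t0 tt' t'T fi.
apply: (Rintegral_indic_diff (mu := leb) (D := `[0, T]%classic) (measurable_itv _)
  (measurable_itv `[0, t]) (measurable_itv `[0, t']) _ _ fi).
- by apply: subset_itvl; rewrite bnd_simp.
- by apply: subset_itvl; rewrite bnd_simp.
- by move=> s /=; rewrite in_itv/= => /andP[s0 sT]; rewrite indic_itvD.
Qed.

End time_integrals.

Lemma ae_product_section (R : realType) (d1 d2 : measure_display)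
    (X : measurableType d1) (Y : measurableType d2)
    (mu : {sigma_finite_measure set X -> \bar R})
    (nu : {sigma_finite_measure set Y -> \bar R}) (Q : X * Y -> Prop) :
  {ae (mu \x nu)%E, forall p, Q p} ->
  {ae mu, forall x, {ae nu, forall y, Q (x, y)}}.
Proof.
move=> [A [mA A0 QA]].
have mG : measurable_fun setT (fun x => nu (xsection A x)) by exact: measurable_fun_xsection.
have : (\int[mu]_x `|nu (xsection A x)| = 0)%E.
  rewrite -A0; apply: eq_integral => x _; rewrite gee0_abs//.
move/(ae_eq_integral_abs mu measurableT mG).
apply: filterS => x /(_ Logic.I) h.
exists (xsection A x); split => //; first exact: measurable_xsection.
by move=> y /= hy; rewrite xsectionE/=; exact: QA.
Qed.

Section jump_terms.
Context {R : realType} {d : measure_display} {Om : measurableType d}.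
Variables (P : probability Om R) (T : R) (H : R -> set (set Om)).
Variables (N : Om -> {measure set (R * R) -> \bar R}).
Variables (G : {sigma_finite_measure set R -> \bar R}) (Un : nat -> set R).
Local Notation leb := (@lebesgue_measure R).
Hypothesis T0 : 0 <= T.
Hypothesis uH : usual_filtration P T H.
Hypothesis mUn : forall n, measurable (Un n).
Hypothesis Un0 : forall n, Un n `<=` R0.
Hypothesis adN : forall t, 0 <= t <= T -> forall C, measurable C ->
  C `<=` `[0, t]%classic `*` R0 -> forall B : set (\bar R), measurable B ->
  H t ((fun om => N om C) @^-1` B).
Hypothesis N_integer : {ae P, forall om, forall C, measurable C ->
  C `<=` half_space -> N om C = +oo%E \/ exists n : nat, N om C = n%:R%:E}.
Hypothesis N_finite : {ae P, forall om, forall n, (N om (`[0%R, T]%classic `*` Un n) < +oo)%E}.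
Hypothesis N_time0 : {ae P, forall om, N om ([set 0] `*` R0) = 0%E}.
Variables (gamma : R -> R -> Om -> R) (p : R -> Om -> R).
Hypothesis pgamma : progressive_field T H gamma.
Hypothesis pp : progressive T H p.

(** The derivative of ln(1 + x gamma) in x at x = p, and below that of ln(1 + x
    gamma) - x gamma, which is the opposite of [jump_correction] where 1 + p
    gamma does not vanish. *)
Definition jump_ratio s z om := gamma s z om / (1 + p s om * gamma s z om).
Definition jump_ratio_excess s z om := jump_ratio s z om - gamma s z om.
Definition jump_correction s z om := p s om * gamma s z om ^+ 2 / (1 + p s om * gamma s z om).

Let ext (zeta : R -> R -> Om -> R) t (x : R * (R * Om)) :=
  if x.2.1 != 0 then zeta (clamp t x.1) x.2.1 x.2.2 else 0.

Let pext t : 0 <= t <= T ->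
  measurable_fun (setT : set (R * (R * g_sigma_algebraType (H t)))) (fun x => p (clamp t x.1) x.2.2).
Proof.
move=> t0T; apply: (measurableT_comp (pp t0T) (g := fun x => (x.1, x.2.2))).
apply: measurable_fun_pair => //.
exact: (measurableT_comp measurable_snd measurable_snd).
Qed.

Lemma progressive_jump_ratio : progressive_field T H jump_ratio.
Proof.
move=> t t0T; have := pgamma t0T; have := pext t0T.
set pe := fun x => p _ _; set ge := fun x => if _ then _ else _ => mpe mge.
rewrite (_ : (fun x => _) = (fun x => ge x / (1 + pe x * ge x))); last first.
  by apply/funext => x; rewrite /ge /pe /jump_ratio; case: ifPn => // _; rewrite mul0r.
apply: measurable_funM => //; apply: (measurableT_comp (@measurable_invr R)).
by apply: measurable_funD => //; exact: measurable_funM.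
Qed.

Lemma progressive_jump_ratio_excess : progressive_field T H jump_ratio_excess.
Proof.
move=> t t0T; have := pgamma t0T; have := progressive_jump_ratio t0T.
set pe := fun x => if _ then jump_ratio _ _ _ else _; set ge := fun x => if _ then _ else _ => mpe mge.
rewrite (_ : (fun x => _) = (fun x => pe x - ge x)); first exact: measurable_funB.
by apply/funext => x; rewrite /ge /pe /jump_ratio_excess; case: ifPn => // _; rewrite subr0.
Qed.

Lemma progressive_jump_correction : progressive_field T H jump_correction.
Proof.
move=> t t0T; have := pgamma t0T; have := pext t0T.
set pe := fun x => p _ _; set ge := fun x => if _ then _ else _ => mpe mge.
rewrite (_ : (fun x => _) = (fun x => pe x * ge x ^+ 2 / (1 + pe x * ge x))); last first.
  apply/funext => x; rewrite /ge /pe /jump_correction; case: ifPn => // _.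
  by rewrite expr0n/= mulr0 mul0r.
apply: measurable_funM; first by apply: measurable_funM => //; exact: measurable_funX.
apply: (measurableT_comp (@measurable_invr R)).
by apply: measurable_funD => //; exact: measurable_funM.
Qed.

Hypothesis pos : {ae P, forall om, {ae (leb \x G)%E, forall x : R * R,
  (`[0, T]%classic `*` R0) x -> 0 < 1 + p x.1 om * gamma x.1 x.2 om}}.

(** gamma / (1 + p gamma) - gamma = - p gamma^2 / (1 + p gamma) for almost all
    times and marks. *)
Lemma compensator_of_jump_ratio : {ae P, forall om, forall t, 0 <= t <= T ->
  \int[leb]_(s in `[0, t]) \int[G]_(z in R0) jump_ratio_excess s z om =
  - \int[leb]_(s in `[0, t]) \int[G]_(z in R0) jump_correction s z om}.
Proof.
move: pos; apply: filterS => om /ae_product_section h t /andP[t0 tT].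
have strip (zeta : R -> R -> Om -> R) : progressive_field T H zeta ->
    measurable_fun (`[0, t] : set R) (fun s => \int[G]_(z in R0) zeta s z om).
  move=> pz; apply: (measurable_funS (measurable_itv `[0, T])).
    by apply: subset_itvl; rewrite bnd_simp.
  have := measurable_compensator_path G T0 om pz (@measurable_cst _ _ R R setT 1).
  by apply: eq_measurable_fun => s _; apply: eq_Rintegral => z _; rewrite mulr1.
have section (zeta : R -> R -> Om -> R) s : progressive_field T H zeta -> 0 <= s <= T ->
    measurable_fun R0 (fun z => zeta s z om).
  move=> pz sT.
  have := measurable_section_path T0 om pz (@measurable_cst _ _ R R setT 1) sT.
  by apply: eq_measurable_fun => z _; rewrite mulr1.
have pe := progressive_jump_ratio_excess; have pc := progressive_jump_correction.
rewrite -[RHS]mulN1r -RintegralZl_measurable//; last exact: strip.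
apply: ae_eq_Rintegral => //; first exact: strip.
  by apply: measurable_funM => //; exact: strip.
move: h; apply: filterS => s h; rewrite /= in_itv/= => /andP[s0 st].
have sT : 0 <= s <= T by rewrite s0 (le_trans st).
rewrite -RintegralZl_measurable//; [|exact: measurable_R0|exact: section].
apply: ae_eq_Rintegral => //; [exact: measurable_R0|exact: section| |].
  by apply: measurable_funM => //; exact: section.
move: h; apply: filterS => z /= h z0; have {}h := h (conj _ z0).
rewrite /jump_ratio_excess /jump_ratio /jump_correction.
have {}h : 1 + p s om * gamma s z om != 0 by rewrite gt_eqF// h//= in_itv.
by field.
Qed.

Section from_full_interval.
Variables (J K : R -> R -> Om -> R) (c : R).
Hypothesis c1 : `|c| = 1.
Hypothesis JE : forall s z om, J s z om = c * \1_(`]0, T]%classic) s * jump_ratio s z om.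
Hypothesis KE : forall s z om, K s z om = c * \1_(`]0, T]%classic) s * jump_ratio_excess s z om.
Hypothesis iJ : fwdN_integrable P T N G Un J.
Hypothesis iK : {ae P, forall om,
  (\int[leb]_(s in `[0%R, T]) \int[G]_(z in R0) (`|K s z om|)%:E < +oo)%E}.

Lemma jump_ratio_locally_integrable : locally_integrable P T G Un jump_ratio.
Proof.
apply: (locally_integrable_drop_time0 T0 mUn c1 _ progressive_jump_ratio) => [s z om _|].
  exact: JE.
by case: iJ.
Qed.

(** The forward integral of the jumps of the fully invested strategy exists up
    to the sign [c] and the time 0. *)
Lemma jump_ratio_spec : exists I, fwdN_spec P T N G Un jump_ratio I.
Proof.
apply: (fwdN_spec_drop_time0 T0 mUn Un0 N_integer N_finite N_time0 progressive_jump_ratio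
  jump_ratio_locally_integrable c1 (fun s z om _ => JE s z om)).
by case: iJ.
Qed.

Lemma jump_ratio_excess_integrable : {ae P, forall om, leb.-integrable `[0, T]
  (EFin \o (fun s => \int[G]_(z in R0) jump_ratio_excess s z om))}.
Proof.
move: iK; apply: filterS => om fin.
have pe := progressive_jump_ratio_excess.
have m1 := @measurable_cst _ _ R R setT 1.
have -> : EFin \o (fun s => \int[G]_(z in R0) jump_ratio_excess s z om) =
    EFin \o (fun s => \int[G]_(z in R0) (jump_ratio_excess s z om * cst 1 z)).
  by apply/funext => s /=; congr (_%:E); apply: eq_Rintegral => z _; rewrite mulr1.
apply: (integrable_compensator_path T0 pe m1).
apply: le_lt_trans fin; rewrite le_eqVlt; apply/orP; left; apply/eqP/esym.
apply: (integral_drop_time0 (measurable_integral_abs_path G T0 om pe m1)).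
- move=> s s0T; apply: eq_integral => z /set_mem z0.
  by rewrite KE// indicE mem_set/= ?in_itv//= !mulr1 normrM c1 mul1r.
- apply: integral0_eq => z z0; rewrite KE// indicE memNset ?mulr0 ?mul0r ?normr0 ?mul0r//.
  by rewrite /= in_itv/= ltxx.
Qed.

End from_full_interval.

Hypothesis hspec : exists I, fwdN_spec P T N G Un jump_ratio I.
Hypothesis hloc : locally_integrable P T G Un jump_ratio.
Hypothesis hexc : {ae P, forall om, leb.-integrable `[0, T]
  (EFin \o (fun s => \int[G]_(z in R0) jump_ratio_excess s z om))}.

(** The jump terms of [m1] for p = pi, and the opposite of those of [m2] for p =
    - kappa. *)
Definition jump_part t om := fwdN P T N G Un jump_ratio t om
  - \int[leb]_(s in `[0, t]) \int[G]_(z in R0) jump_correction s z om.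

Lemma jump_part_at0 : {ae P, forall om, jump_part 0 om = 0}.
Proof.
have := fwdN_at0 T0 mUn N_integer N_finite N_time0 progressive_jump_ratio hloc hspec.
by apply: filterS => om e; rewrite /jump_part e set_itv1 Rintegral_set1 subr0.
Qed.

Lemma jump_part_adapted t : 0 <= t <= T -> S_measurable (H t) (jump_part t).
Proof.
move=> t0T; apply: measurable_funB.
  exact: (fwdN_adapted uH mUn Un0 adN N_finite progressive_jump_ratio hspec t0T).
have := compensator_integral_adapted G (@measurable_cst _ _ R R setT 1) progressive_jump_correction t0T.
congr (S_measurable _ _); apply/funext => om; apply: eq_Rintegral => s _.
by apply: eq_Rintegral => z _; rewrite mulr1.
Qed.

(** The increment of the forward integral is that of [fwdN_increment]. The
    compensator [K] contributes the increment of the integral of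
    [jump_ratio_excess], which is minus that of [jump_correction]. *)
Lemma jump_part_increment (J K : R -> R -> Om -> R) (c t t' : R) (B : set Om) :
  0 <= t -> t <= t' -> t' <= T ->
  (forall s z om, J s z om = c * (\1_B om * \1_(`]t, t']%classic) s) * jump_ratio s z om) ->
  (forall s z om, K s z om = c * (\1_B om * \1_(`]t, t']%classic) s) * jump_ratio_excess s z om) ->
  (exists I, fwdN_spec P T N G Un J I) ->
  {ae P, forall om, fwdN P T N G Un J T om
    + \int[leb]_(s in `[0, T]) \int[G]_(z in R0) K s z om =
    c * \1_B om * (jump_part t' om - jump_part t om)}.
Proof.
move=> t0 tt' t'T JE KE hJ.
have hN := fwdN_increment T0 mUn Un0 N_integer N_finite N_time0 progressive_jump_ratio hloc
  t0 tt' t'T (fun s z om _ => JE s z om) hspec hJ.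
move: hN hexc compensator_of_jump_ratio; apply: filterS3 => om -> ie ce.
have -> : \int[leb]_(s in `[0, T]) \int[G]_(z in R0) K s z om =
    \int[leb]_(s in `[0, T]) (c * \1_B om * \1_(`]t, t']%classic) s *
      \int[G]_(z in R0) jump_ratio_excess s z om).
  apply: eq_Rintegral => s; rewrite inE/= in_itv/= => sT.
  rewrite -RintegralZl_measurable.
  - by apply: eq_Rintegral => z _; rewrite KE !mulrA.
  - exact: measurable_R0.
  - have := measurable_section_path T0 om progressive_jump_ratio_excess (@measurable_cst _ _ R R setT 1) sT.
    by apply: eq_measurable_fun => z _; rewrite mulr1.
rewrite (@time_integral_increment R T _ _ t t' t0 tt' t'T ie).
rewrite !ce ?t0 ?(le_trans tt')// ?(le_trans t0)//.
by rewrite /jump_part; ring.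
Qed.

End jump_terms.

(** * The market *)

Section increment_algebra.
Context {R : comRingType}.
Implicit Types b : R.

Let split_increment b i x1 x2 n1 n2 k1 k2 (D D' w w' v v' j j' l l' c1 c2 c3 c4 : R) :
  i = b * (D' - D) -> x1 = c1 * b * (w' - w) -> x2 = c2 * b * (v' - v) ->
  n1 + k1 = c3 * b * (j' - j) -> n2 + k2 = c4 * b * (l' - l) ->
  i + x1 - x2 + n1 + n2 + k1 + k2 =
  b * ((D' + c1 * w' - c2 * v' + c3 * j' + c4 * l') - (D + c1 * w - c2 * v + c3 * j + c4 * l)).
Proof.
move=> -> -> -> nk1 nk2.
transitivity (b * (D' - D) + c1 * b * (w' - w) - c2 * b * (v' - v) + (n1 + k1) + (n2 + k2)).
  by ring.
by rewrite nk1 nk2; ring.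
Qed.

Lemma combine_increments1 b i x1 x2 n1 n2 k1 k2 (D D' w w' v v' j j' l l' : R) :
  i = b * (D' - D) -> x1 = 1 * b * (w' - w) -> x2 = 0 * b * (v' - v) ->
  n1 + k1 = 1 * b * (j' - j) -> n2 + k2 = 0 * b * (l' - l) ->
  i + x1 - x2 + n1 + n2 + k1 + k2 = b * ((D' + w' + j') - (D + w + j)).
Proof. by move=> h1 h2 h3 h4 h5; rewrite (split_increment h1 h2 h3 h4 h5); ring. Qed.

Lemma combine_increments2 b i x1 x2 n1 n2 k1 k2 (D D' w w' v v' j j' l l' : R) :
  i = b * (D' - D) -> x1 = -1 * b * (w' - w) -> x2 = 1 * b * (v' - v) ->
  n1 + k1 = 0 * b * (j' - j) -> n2 + k2 = -1 * b * (l' - l) ->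
  i + x1 - x2 + n1 + n2 + k1 + k2 = b * ((D' - w' - v' - l') - (D - w - v - l)).
Proof. by move=> h1 h2 h3 h4 h5; rewrite (split_increment h1 h2 h3 h4 h5); ring. Qed.

End increment_algebra.

Section market_facts.
Context {R : realType} {d : measure_display} {Om : measurableType d}.
Variable m : market R Om.
Local Notation P := (pr m).
Local Notation T := (horizon m).
Local Notation H := (filH m).
Local Notation leb := (@lebesgue_measure R).
Local Notation Un := (exhaust m).
Hypothesis hn : noise_axioms m.
Hypothesis hi : information_axioms m.
Hypothesis hc : coefficient_axioms m.

Lemma horizon_gt0 : 0 < T. Proof. by case: hn. Qed.

Let T0 : 0 <= T := ltW horizon_gt0.

Lemma market_usual : usual_filtration P T H. Proof. by case: hi. Qed.

Let filF_H t : 0 <= t <= T -> filF m t `<=` H t.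
Proof. by case: hi => _ _ _ h _ /h[F1 _ GH _]; exact: subset_trans GH. Qed.

Lemma measurable_exhaust n : measurable (Un n).
Proof. by case: hn => _ _ _ _ [h _ _]; apply: compact_measurable; case: (h n). Qed.

Lemma exhaust_nonzero n : Un n `<=` R0.
Proof. by case: hn => _ _ _ _ [_ h _]; rewrite -h => z zn; exists n. Qed.

Lemma W1_adapted s t : 0 <= s -> s <= t -> t <= T -> sub_measurable (H t) (W1 m s).
Proof.
move=> s0 st tT B mB; apply: filF_H; first by rewrite (le_trans s0 st).
apply: sub_sigma_algebra; left; left; left; right; apply: sub_sigma_algebra.
by exists s, B; split => //; rewrite /= in_itv/= s0.
Qed.

Lemma W2_adapted s t : 0 <= s -> s <= t -> t <= T -> sub_measurable (H t) (W2 m s).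
Proof.
move=> s0 st tT B mB; apply: filF_H; first by rewrite (le_trans s0 st).
apply: sub_sigma_algebra; left; left; right; apply: sub_sigma_algebra.
by exists s, B; split => //; rewrite /= in_itv/= s0.
Qed.

Lemma N1_adapted t : 0 <= t <= T -> forall C, measurable C ->
  C `<=` `[0, t]%classic `*` R0 -> forall B : set (\bar R), measurable B ->
  H t ((fun om => N1 m om C) @^-1` B).
Proof.
move=> tT C mC CD B mB; apply: filF_H => //.
apply: sub_sigma_algebra; left; right; apply: sub_sigma_algebra.
by exists C, B.
Qed.

Lemma N2_adapted t : 0 <= t <= T -> forall C, measurable C ->
  C `<=` `[0, t]%classic `*` R0 -> forall B : set (\bar R), measurable B ->
  H t ((fun om => N2 m om C) @^-1` B).
Proof.
move=> tT C mC CD B mB; apply: filF_H => //.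
apply: sub_sigma_algebra; right; apply: sub_sigma_algebra.
by exists C, B.
Qed.

Lemma W1_continuous : {ae P, forall om, {within `[0, +oo[, continuous (W1 m ^~ om)}}.
Proof. by case: hn => _ [[_ _ h _ _] _ _] _ _ _. Qed.

Lemma W2_continuous : {ae P, forall om, {within `[0, +oo[, continuous (W2 m ^~ om)}}.
Proof. by case: hn => _ [_ [_ _ h _ _] _] _ _ _. Qed.

Let poisson1 : poisson_random_measure P (fun om => N1 m om) (G1 m).
Proof. by case: hn => _ _ _ []. Qed.

Let poisson2 : poisson_random_measure P (fun om => N2 m om) (G2 m).
Proof. by case: hn => _ _ _ []. Qed.

Lemma N1_finite : {ae P, forall om, forall n, (N1 m om (`[0%R, T]%classic `*` Un n) < +oo)%E}.
Proof.
apply/ae_foralln => n; apply: (poisson_finite poisson1 T0 (measurable_exhaust n) (@exhaust_nonzero n)).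
by case: hn => _ _ _ _ [_ _ /(_ n)[]].
Qed.

Lemma N2_finite : {ae P, forall om, forall n, (N2 m om (`[0%R, T]%classic `*` Un n) < +oo)%E}.
Proof.
apply/ae_foralln => n; apply: (poisson_finite poisson2 T0 (measurable_exhaust n) (@exhaust_nonzero n)).
by case: hn => _ _ _ _ [_ _ /(_ n)[]].
Qed.

Lemma N1_integer : {ae P, forall om, forall C, measurable C ->
  C `<=` half_space -> N1 m om C = +oo%E \/ exists n : nat, N1 m om C = n%:R%:E}.
Proof. by case: poisson1. Qed.

Lemma N2_integer : {ae P, forall om, forall C, measurable C ->
  C `<=` half_space -> N2 m om C = +oo%E \/ exists n : nat, N2 m om C = n%:R%:E}.
Proof. by case: poisson2. Qed.

Let filG1_H t : 0 <= t <= T -> filG1 m t `<=` H t.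
Proof. by case: hi => _ _ _ h _ /h[]. Qed.

Let filG2_H t : 0 <= t <= T -> filG2 m t `<=` H t.
Proof. by case: hi => _ _ _ h _ /h[]. Qed.

Lemma caglad_adapted_sub (F F' : R -> set (set Om)) X :
  (forall t, 0 <= t <= T -> F t `<=` F' t) -> caglad_adapted T F X -> caglad_adapted T F' X.
Proof. by move=> FF [cX aX]; split => // t tT B mB; apply: FF => //; exact: aX. Qed.

Lemma caglad_adapted_field_sub (F F' : R -> set (set Om)) zeta :
  (forall t, 0 <= t <= T -> F t `<=` F' t) ->
  caglad_adapted_field T F zeta -> caglad_adapted_field T F' zeta.
Proof.
move=> FF [cX aX]; split => // t tT B mB; apply: sub_sigma_algebra2 (aX t tT B mB).
by move=> C [D [A [h1 h2 h3 ->]]]; exists D, A; split => //; exact: FF.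
Qed.

Lemma sigma_caglad : caglad_adapted T H (sigma_ m).
Proof. by case: hc => _ [_ _ _ h _] _ _ _; exact: caglad_adapted_sub h. Qed.

Lemma r_caglad : caglad_adapted T H (r_ m).
Proof. by case: hc => _ [h _ _ _ _] _ _ _; exact: caglad_adapted_sub h. Qed.

Lemma mu_caglad x : caglad_adapted T H (fun t => mu_ m t x).
Proof. by case: hc => _ [_ /(_ x) h _ _ _] _ _ _; exact: caglad_adapted_sub h. Qed.

Lemma a_caglad : caglad_adapted T H (a_ m).
Proof. by case: hc => _ _ [h _ _ _ _] _ _; exact: caglad_adapted_sub h. Qed.

Lemma b_caglad : caglad_adapted T H (b_ m).
Proof. by case: hc => _ _ [_ h _ _ _] _ _; exact: caglad_adapted_sub h. Qed.

Lemma lambda_caglad : caglad_adapted T H (lambda_ m).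
Proof. by case: hc => _ _ [_ _ _ h _] _ _; exact: caglad_adapted_sub h. Qed.

Lemma gamma1_progressive : progressive_field T H (gamma1 m).
Proof.
apply: (progressive_caglad_field market_usual).
by case: hc => _ [_ _ _ _ h] _ _ _; exact: caglad_adapted_field_sub h.
Qed.

Lemma gamma2_progressive : progressive_field T H (gamma2 m).
Proof.
apply: (progressive_caglad_field market_usual).
by case: hc => _ _ [_ _ h _ _] _ _; exact: caglad_adapted_field_sub h.
Qed.

Lemma progressive_caglad X : caglad_adapted T H X -> progressive T H X.
Proof. by move=> cX t tT; exact: (S_measurable_caglad market_usual cX). Qed.

Variable us : @strategy R d Om.
Hypothesis A1us : A1 m us.
Let pi := us.1.
Let kappa := us.2.

Let pi_caglad : caglad_adapted T H pi. Proof. by case: A1us => -[]. Qed.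
Let kappa_caglad : caglad_adapted T H kappa. Proof. by case: A1us => -[]. Qed.

Definition drift1 s om := mu_ m s (pi s om) om - r_ m s om
     + derive1 (fun x => mu_ m s x om) (pi s om) * pi s om
     - sigma_ m s om ^+ 2 * pi s om
     + rho m * sigma_ m s om * b_ m s om * kappa s om.

Definition drift2 s om := lambda_ m s om - a_ m s om
     + rho m * sigma_ m s om * b_ m s om * pi s om
     - b_ m s om ^+ 2 * kappa s om.

(** The rate [mu] is continuously differentiable in the position, so that
    [measurable_caratheodory] and [measurable_derive1_comp] insert the strategy
    into it and its derivative. *)
Lemma progressive_drift1 : progressive T H drift1.
Proof.
move=> t tT; have /andP[t0 tT'] := tT.
have mp := progressive_caglad pi_caglad tT.
have mk := progressive_caglad kappa_caglad tT.
have ms := progressive_caglad sigma_caglad tT.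
have mb := progressive_caglad b_caglad tT.
have mr := progressive_caglad r_caglad tT.
have dmu (x : R * g_sigma_algebraType (H t)) y :
    derivable (fun y => mu_ m (clamp t x.1) y x.2) y 1.
  case: hc => _ [_ _ h _ _] _ _ _.
  have /andP[c0 ct] := clamp_itv x.1 t0.
  by have [] := h (clamp t x.1) x.2; first by rewrite c0 (le_trans ct).
have mmu y := progressive_caglad (mu_caglad y) tT.
have mmp := measurable_caratheodory mmu mp
  (fun x => differentiable_continuous (iffLR (derivable1_diffP _ _) (dmu x _))).
have mdp := measurable_derive1_comp mmu mp dmu.
apply: measurable_funD.
  apply: measurable_funB.
    apply: measurable_funD; first exact: measurable_funB.
    exact: measurable_funM.
  by apply: measurable_funM => //; exact: measurable_funX.
apply: measurable_funM => //; apply: measurable_funM => //.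
exact: measurable_funM.
Qed.

Lemma progressive_drift2 : progressive T H drift2.
Proof.
move=> t tT.
have mp := progressive_caglad pi_caglad tT.
have mk := progressive_caglad kappa_caglad tT.
have ms := progressive_caglad sigma_caglad tT.
have mb := progressive_caglad b_caglad tT.
have ma := progressive_caglad a_caglad tT.
have ml := progressive_caglad lambda_caglad tT.
apply: measurable_funB.
  apply: measurable_funD; first exact: measurable_funB.
  by apply: measurable_funM => //; apply: measurable_funM => //; exact: measurable_funM.
by apply: measurable_funM => //; exact: measurable_funX.
Qed.

Local Notation ratio1 := (jump_ratio (gamma1 m) pi).
Let mkappa := fun s om => - kappa s om.
Local Notation ratio2 := (jump_ratio (gamma2 m) mkappa).
Local Notation jumps1 := (jump_part P T (N1 m) (G1 m) Un (gamma1 m) pi).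
Local Notation jumps2 := (jump_part P T (N2 m) (G2 m) Un (gamma2 m) mkappa).
Let rho_b := fun s om => rho m * b_ m s om.
Let sqrt_b := fun s om => Num.sqrt (1 - rho m ^+ 2) * b_ m s om.

Let ppi : progressive T H pi := progressive_caglad pi_caglad.

Let pmkappa : progressive T H mkappa.
Proof.
by move=> t tT; apply: measurableT_comp => //; exact: (progressive_caglad kappa_caglad tT).
Qed.

Let pos1 : {ae P, forall om, {ae (leb \x G1 m)%E, forall x : R * R,
  (`[0, T]%classic `*` R0) x -> 0 < 1 + pi x.1 om * gamma1 m x.1 x.2 om}}.
Proof.
case: A1us => _ _ [e1 [e2 [/andP[e10 _] _ h _]]] _ _; move: h; apply: filterS => om -[+ _].
by case=> A [mA A0 sA]; exists A; split => // x /= nx; apply: sA => /= h; apply: nx => xT; have := h xT; rewrite /pi; lra.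
Qed.

Let pos2 : {ae P, forall om, {ae (leb \x G2 m)%E, forall x : R * R,
  (`[0, T]%classic `*` R0) x -> 0 < 1 + mkappa x.1 om * gamma2 m x.1 x.2 om}}.
Proof.
case: A1us => _ _ [e1 [e2 [_ /andP[e20 _] _ h]]] _ _; move: h; apply: filterS => om -[+ _].
by case=> A [mA A0 sA]; exists A; split => // x /= nx; apply: sA => /= h; apply: nx => xT; have := h xT; rewrite /mkappa /kappa; lra.
Qed.

Lemma m1E t om : m1 m us t om =
  \int[leb]_(s in `[0, t]) drift1 s om + fwdW P T (W1 m) (sigma_ m) t om + jumps1 t om.
Proof. by rewrite /m1 /jump_part addrA. Qed.

(** The jump terms of [m2] are those of [jump_part] for p = - kappa, as 1 -
    kappa gamma2 = 1 + (- kappa) gamma2. *)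
Lemma m2E t om : 0 <= t <= T -> m2 m us t om =
  \int[leb]_(s in `[0, t]) drift2 s om - fwdW P T (W1 m) rho_b t om
   - fwdW P T (W2 m) sqrt_b t om - jumps2 t om.
Proof.
move=> /andP[t0 tT]; rewrite /m2 /jump_part.
have -> : (fun s z om => gamma2 m s z om / (1 - us.2 s om * gamma2 m s z om)) = ratio2.
  by apply/funext => s; apply/funext => z; apply/funext => om'; rewrite /jump_ratio mulNr.
have pc := progressive_jump_correction gamma2_progressive pmkappa.
have m1' := @measurable_cst _ _ R R setT 1.
have -> : \int[leb]_(s in `[0, t]) \int[G2 m]_(z in R0)
      (us.2 s om * gamma2 m s z om ^+ 2 / (1 - us.2 s om * gamma2 m s z om)) =
    - \int[leb]_(s in `[0, t]) \int[G2 m]_(z in R0) jump_correction (gamma2 m) mkappa s z om.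
  rewrite -[RHS]mulN1r -RintegralZl_measurable//; last first.
    apply: (measurable_funS (measurable_itv `[0, T])).
      by apply: subset_itvl; rewrite bnd_simp.
    have := measurable_compensator_path (G2 m) T0 om pc m1'.
    by apply: eq_measurable_fun => s _; apply: eq_Rintegral => z _; rewrite mulr1.
  apply: eq_Rintegral => s; rewrite inE/= in_itv/= => /andP[s0 st].
  have sT : 0 <= s <= T by rewrite s0 (le_trans st).
  rewrite -RintegralZl_measurable//; last 2 first.
  - exact: measurable_R0.
  - have := measurable_section_path T0 om pc m1' sT.
    by apply: eq_measurable_fun => z _; rewrite mulr1.
  by apply: eq_Rintegral => z _; rewrite /jump_correction /mkappa /kappa mulN1r !mulNr opprK.
by rewrite opprB -/drift2; lra.
Qed.

Hypothesis hA1 : forall t h B1 B2, 0 <= t -> 0 < h -> t + h <= T -> H t B1 -> H t B2 ->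
  A1 m (indicator_strategy B1 B2 t h) /\ dlog_integrable m us (indicator_strategy B1 B2 t h).

Let H0_setT t : 0 <= t <= T -> H t setT.
Proof.
by move=> tT; case: (usual_sigma_algebra market_usual tT) => h0 hC _; rewrite -(setD0 setT); exact: hC.
Qed.

Let H0_set0 t : 0 <= t <= T -> H t set0.
Proof. by move=> tT; case: (usual_sigma_algebra market_usual tT). Qed.

Let I00 : 0 <= (0 : R) <= T. Proof. by rewrite lexx. Qed.

Let full1 : dlog_integrable m us (indicator_strategy setT set0 0 T).
Proof.
by apply: (hA1 (lexx 0) horizon_gt0 _ (H0_setT I00) (H0_set0 I00)).2; rewrite add0r.
Qed.

Let full2 : dlog_integrable m us (indicator_strategy set0 setT 0 T).
Proof.
by apply: (hA1 (lexx 0) horizon_gt0 _ (H0_set0 I00) (H0_setT I00)).2; rewrite add0r.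
Qed.

Let int_sigma : exists I, fwdW_spec P T (W1 m) (sigma_ m) I.
Proof. by case: hc => _ _ _ [e [_ [_ []]]]. Qed.

Let path_integrable X : caglad_adapted T H X ->
  {ae P, forall om, (\int[leb]_(s in `[0%R, T]) `|X s om|%:E < +oo)%E} ->
  {ae P, forall om, leb.-integrable `[0, T] (EFin \o X ^~ om)}.
Proof.
move=> cX; apply: filterS => om fin; apply/integrableP; split => //.
by apply/measurable_EFinP; exact: (progressive_path T0 om (progressive_caglad cX)).
Qed.

Let sigma_integrable : {ae P, forall om, leb.-integrable `[0, T] (EFin \o sigma_ m ^~ om)}.
Proof. by apply: path_integrable sigma_caglad _; case: hc => _ _ _ [e [_ [_ []]]]. Qed.

Let b_integrable : {ae P, forall om, leb.-integrable `[0, T] (EFin \o b_ m ^~ om)}.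
Proof. by apply: path_integrable b_caglad _; case: hc => _ _ _ [e [_ _ [[]]]]. Qed.

Let int_rho_b : exists I, fwdW_spec P T (W1 m) rho_b I.
Proof.
apply: (fwdW_scale T0 W1_continuous _ _ b_integrable).
by case: hc => _ _ _ [e [_ _ [[]]]].
Qed.

Let int_sqrt_b : exists I, fwdW_spec P T (W2 m) sqrt_b I.
Proof.
apply: (fwdW_scale T0 W2_continuous _ _ b_integrable).
by case: hc => _ _ _ [e [_ _ [_ []]]].
Qed.

Let scale_caglad c X : caglad_adapted T H X -> caglad_adapted T H (fun s om => c * X s om).
Proof.
move=> [cX aX]; split => [om|t tT].
  have [cl cr] := cX om; split => t /[dup] tT.
    by move/cl => h; apply: cvgM => //; exact: cvg_cst.
  by move/cr => h; apply: is_cvgM => //; exact: is_cvg_cst.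
apply/(S_measurableP _ (usual_sigma_algebra market_usual tT)); apply: measurable_funM => //.
by apply/(S_measurableP _ (usual_sigma_algebra market_usual tT)); exact: aX.
Qed.

Let scale_integrable c X : {ae P, forall om, leb.-integrable `[0, T] (EFin \o X ^~ om)} ->
  {ae P, forall om, leb.-integrable `[0, T] (EFin \o (fun s => c * X s om))}.
Proof.
apply: filterS => om h.
rewrite (_ : EFin \o _ = (fun s => c%:E * (EFin \o X ^~ om) s)%E)//.
exact: (@integrableZl _ (measurableTypeR R) R leb).
Qed.

Let J1full s z om : dlog_jump1 m us (indicator_strategy setT set0 0 T) s z om =
  1 * \1_(`]0, T]%classic) s * ratio1 s z om.
Proof. by rewrite /dlog_jump1 /indicator_strategy/= indicT mul1r add0r mulrA mul1r. Qed.

Let J2full s z om : dlog_jump2 m us (indicator_strategy set0 setT 0 T) s z om =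
  -1 * \1_(`]0, T]%classic) s * ratio2 s z om.
Proof.
rewrite /dlog_jump2 /indicator_strategy/= indicT mul1r add0r /jump_ratio /mkappa !mulNr.
by rewrite mul1r mulrA.
Qed.

Let K1full s z om : dlog_jump1 m us (indicator_strategy setT set0 0 T) s z om -
   (indicator_strategy setT set0 0 T).1 s om * gamma1 m s z om =
  1 * \1_(`]0, T]%classic) s * jump_ratio_excess (gamma1 m) pi s z om.
Proof.
by rewrite J1full /indicator_strategy/= indicT mul1r add0r /jump_ratio_excess mulrBr !mul1r.
Qed.

Let K2full s z om : dlog_jump2 m us (indicator_strategy set0 setT 0 T) s z om +
   (indicator_strategy set0 setT 0 T).2 s om * gamma2 m s z om =
  -1 * \1_(`]0, T]%classic) s * jump_ratio_excess (gamma2 m) mkappa s z om.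
Proof.
rewrite J2full /indicator_strategy/= indicT mul1r add0r /jump_ratio_excess mulrBr.
by rewrite !mulN1r !mulNr opprK.
Qed.

Let N11 : `|1 : R| = 1. Proof. exact: normr1. Qed.
Let N1N1 : `|-1 : R| = 1. Proof. by rewrite normrN1. Qed.

Let spec1 : exists I, fwdN_spec P T (N1 m) (G1 m) Un ratio1 I.
Proof.
case: full1 => _ i1 _ _ _.
exact: (jump_ratio_spec T0 measurable_exhaust exhaust_nonzero N1_integer N1_finite
  (poisson_time0 poisson1) gamma1_progressive ppi N11 J1full i1).
Qed.

Let spec2 : exists I, fwdN_spec P T (N2 m) (G2 m) Un ratio2 I.
Proof.
case: full2 => _ _ i1 _ _.
exact: (jump_ratio_spec T0 measurable_exhaust exhaust_nonzero N2_integer N2_finite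
  (poisson_time0 poisson2) gamma2_progressive pmkappa N1N1 J2full i1).
Qed.

Let loc1 : locally_integrable P T (G1 m) Un ratio1.
Proof.
case: full1 => _ i1 _ _ _.
exact: (jump_ratio_locally_integrable T0 measurable_exhaust gamma1_progressive ppi N11 J1full i1).
Qed.

Let loc2 : locally_integrable P T (G2 m) Un ratio2.
Proof.
case: full2 => _ _ i1 _ _.
exact: (jump_ratio_locally_integrable T0 measurable_exhaust gamma2_progressive pmkappa N1N1 J2full i1).
Qed.

Let exc1 : {ae P, forall om, leb.-integrable `[0, T]
  (EFin \o (fun s => \int[G1 m]_(z in R0) jump_ratio_excess (gamma1 m) pi s z om))}.
Proof.
case: full1 => _ _ _ i1 _.
exact: (jump_ratio_excess_integrable T0 gamma1_progressive ppi N11 K1full i1).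
Qed.

Let exc2 : {ae P, forall om, leb.-integrable `[0, T]
  (EFin \o (fun s => \int[G2 m]_(z in R0) jump_ratio_excess (gamma2 m) mkappa s z om))}.
Proof.
case: full2 => _ _ _ _ i1.
exact: (jump_ratio_excess_integrable T0 gamma2_progressive pmkappa N1N1 K2full i1).
Qed.

Let drift1_integrable : {ae P, forall om, leb.-integrable `[0, T] (EFin \o drift1 ^~ om)}.
Proof.
case: full1 => + _ _ _ _; apply: filterS => om; apply: (integrable_drop_time0 T0 progressive_drift1).
move=> s; rewrite /dlog_drift /indicator_strategy/= indicT indic0 add0r !mul1r mul0r /drift1 -/pi -/kappa.
by ring.
Qed.

Let drift2_integrable : {ae P, forall om, leb.-integrable `[0, T] (EFin \o drift2 ^~ om)}.
Proof.
case: full2 => + _ _ _ _; apply: filterS => om; apply: (integrable_drop_time0 T0 progressive_drift2).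
move=> s; rewrite /dlog_drift /indicator_strategy/= indicT indic0 add0r !mul1r mul0r /drift2 -/pi -/kappa.
by ring.
Qed.

Lemma m1_adapted t : 0 <= t <= T -> S_measurable (H t) (m1 m us t).
Proof.
move=> tT; rewrite (_ : m1 m us t = fun om => \int[leb]_(s in `[0, t]) drift1 s om
    + fwdW P T (W1 m) (sigma_ m) t om + jumps1 t om).
  apply: measurable_funD; first apply: measurable_funD.
  - exact: (time_integral_adapted progressive_drift1 tT).
  - exact: (fwdW_adapted market_usual W1_adapted W1_continuous sigma_caglad int_sigma tT).
  - exact: (jump_part_adapted market_usual measurable_exhaust exhaust_nonzero N1_adapted
      N1_finite gamma1_progressive ppi spec1 tT).
by apply/funext => om; exact: m1E.
Qed.

Lemma m2_adapted t : 0 <= t <= T -> S_measurable (H t) (m2 m us t).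
Proof.
move=> tT; rewrite (_ : m2 m us t = fun om => \int[leb]_(s in `[0, t]) drift2 s om
    - fwdW P T (W1 m) rho_b t om - fwdW P T (W2 m) sqrt_b t om - jumps2 t om).
  apply: measurable_funB; first (apply: measurable_funB; first apply: measurable_funB).
  - exact: (time_integral_adapted progressive_drift2 tT).
  - exact: (fwdW_adapted market_usual W1_adapted W1_continuous (scale_caglad _ b_caglad) int_rho_b tT).
  - exact: (fwdW_adapted market_usual W2_adapted W2_continuous (scale_caglad _ b_caglad) int_sqrt_b tT).
  - exact: (jump_part_adapted market_usual measurable_exhaust exhaust_nonzero N2_adapted
      N2_finite gamma2_progressive pmkappa spec2 tT).
by apply/funext => om; exact: m2E.
Qed.

Lemma m1_at0 : {ae P, forall om, m1 m us 0 om = 0}.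
Proof.
have := jump_part_at0 T0 measurable_exhaust N1_integer N1_finite
  (poisson_time0 poisson1) gamma1_progressive ppi spec1 loc1.
have := fwdW_at0 T0 int_sigma; apply: filterS2 => om h1 h2.
by rewrite m1E h1 h2 set_itv1 Rintegral_set1 !addr0.
Qed.

Lemma m2_at0 : {ae P, forall om, m2 m us 0 om = 0}.
Proof.
have h := jump_part_at0 T0 measurable_exhaust N2_integer N2_finite
  (poisson_time0 poisson2) gamma2_progressive pmkappa spec2 loc2.
have h' := fwdW_at0 T0 int_rho_b; have h'' := fwdW_at0 T0 int_sqrt_b.
move: h h' h''; apply: filterS3 => om h1 h2 h3.
by rewrite m2E// h1 h2 h3 set_itv1 Rintegral_set1 !subr0.
Qed.

Section increments_as_derivatives.
Variables (t h : R) (B : set Om).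
Hypothesis t0 : 0 <= t.
Hypothesis h0 : 0 < h.
Hypothesis thT : t + h <= T.
Hypothesis HB : H t B.

Let tT : 0 <= t <= T.
Proof. by rewrite t0 (le_trans _ thT)// lerDl ltW. Qed.

Let t'T : 0 <= t + h <= T.
Proof. by rewrite thT addr_ge0// ltW. Qed.

Let tt' : t <= t + h. Proof. by rewrite lerDl ltW. Qed.

Let ind1 s om : (indicator_strategy B set0 t h).1 s om = \1_B om * \1_(`]t, t + h]%classic) s.
Proof. by []. Qed.

Let ind10 s om : (indicator_strategy B set0 t h).2 s om = 0.
Proof. by rewrite /indicator_strategy/= indic0 mul0r. Qed.

Let ind2 s om : (indicator_strategy set0 B t h).2 s om = \1_B om * \1_(`]t, t + h]%classic) s.
Proof. by []. Qed.

Let ind20 s om : (indicator_strategy set0 B t h).1 s om = 0.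
Proof. by rewrite /indicator_strategy/= indic0 mul0r. Qed.

Let drift_increment (D : R -> Om -> R) (alpha : @strategy R d Om) om :
  leb.-integrable `[0, T] (EFin \o D ^~ om) ->
  (forall s, dlog_drift m us alpha s om = \1_B om * \1_(`]t, t + h]%classic) s * D s om) ->
  \int[leb]_(s in `[0, T]) dlog_drift m us alpha s om =
  \1_B om * (\int[leb]_(s in `[0, t + h]) D s om - \int[leb]_(s in `[0, t]) D s om).
Proof.
move=> iD DE; rewrite -(@time_integral_increment R T _ _ t (t + h) t0 tt' thT iD).
by apply: eq_Rintegral => s _; rewrite DE.
Qed.

(** Each term of the derivative of the logarithmic return is the increment over
    ]t, t + h] of the corresponding term of [m1], on the event [B]; the terms
    that carry the second control vanish. *)
Lemma dlog_return_unit_pi : {ae P, forall om,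
  dlog_return m us (indicator_strategy B set0 t h) om =
  \1_B om * (m1 m us (t + h) om - m1 m us t om)}.
Proof.
pose alpha := indicator_strategy B set0 t h.
pose Bt (om : Om) s : R := \1_B om * \1_(`]t, t + h]%classic) s.
have [[_ [s1 _ _] _ _ _] [_ [_ _ j1] [_ _ j2] _ _]] := hA1 t0 h0 thT HB (H0_set0 tT).
pose X1 s om := sigma_ m s om * alpha.1 s om - rho m * b_ m s om * alpha.2 s om.
pose X2 s om := Num.sqrt (1 - rho m ^+ 2) * b_ m s om * alpha.2 s om.
pose K1 s z om := dlog_jump1 m us alpha s z om - alpha.1 s om * gamma1 m s z om.
pose K2 s z om := dlog_jump2 m us alpha s z om + alpha.2 s om * gamma2 m s z om.
have X1E s om : X1 s om = 1 * Bt om s * sigma_ m s om.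
  by rewrite /X1 ind10 ind1 mulr0 subr0 mul1r mulrC.
have X2E s om : X2 s om = 0 * Bt om s * sqrt_b s om by rewrite /X2 ind10 mulr0 !mul0r.
have J1E s z om : dlog_jump1 m us alpha s z om = 1 * Bt om s * ratio1 s z om.
  by rewrite /dlog_jump1 ind1 mul1r /jump_ratio !mulrA.
have K1E s z om : K1 s z om = 1 * Bt om s * jump_ratio_excess (gamma1 m) pi s z om.
  by rewrite /K1 J1E ind1 !mul1r /jump_ratio_excess mulrBr.
have J2E s z om : dlog_jump2 m us alpha s z om = 0 * Bt om s * ratio2 s z om.
  by rewrite /dlog_jump2 ind10 !mul0r oppr0 mul0r.
have K2E s z om : K2 s z om = 0 * Bt om s * jump_ratio_excess (gamma2 m) mkappa s z om.
  by rewrite /K2 J2E ind10 !mul0r addr0.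
have DE s om : dlog_drift m us alpha s om = Bt om s * drift1 s om.
  by rewrite /dlog_drift /drift1 ind10 ind1 -/pi -/kappa /Bt; ring.
have Y1 : exists I, fwdW_spec P T (W1 m) X1 I.
  rewrite (_ : X1 = (fun s om => sigma_ m s om * alpha.1 s om)); first by case: s1.
  by apply/funext => s; apply/funext => om; rewrite /X1 ind10 mulr0 subr0.
have Y2 : exists I, fwdW_spec P T (W2 m) X2 I.
  rewrite (_ : X2 = (fun s om => 0 * sqrt_b s om)).
    exact: (fwdW_scale T0 W2_continuous _ int_sqrt_b (scale_integrable _ b_integrable)).
  by apply/funext => s; apply/funext => om; rewrite X2E !mul0r.
have hW1 := fwdW_indicator T0 W1_continuous t0 tt' thT
  X1E sigma_caglad.1 sigma_integrable int_sigma Y1.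
have hW2 := fwdW_indicator T0 W2_continuous t0 tt' thT
  X2E (scale_caglad _ b_caglad).1 (scale_integrable _ b_integrable) int_sqrt_b Y2.
have hJ1 := jump_part_increment T0 measurable_exhaust exhaust_nonzero N1_integer N1_finite
  (poisson_time0 poisson1) gamma1_progressive ppi pos1 spec1 loc1 exc1 t0 tt' thT J1E K1E j1.
have hJ2 := jump_part_increment T0 measurable_exhaust exhaust_nonzero N2_integer N2_finite
  (poisson_time0 poisson2) gamma2_progressive pmkappa pos2 spec2 loc2 exc2 t0 tt' thT J2E K2E j2.
have hD : {ae P, forall om, \int[leb]_(s in `[0, T]) dlog_drift m us alpha s om =
    \1_B om * (\int[leb]_(s in `[0, t + h]) drift1 s om - \int[leb]_(s in `[0, t]) drift1 s om)}.
  by move: drift1_integrable; apply: filterS => om iD; exact: drift_increment.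
have hW : {ae P, forall om, fwdW P T (W1 m) X1 T om =
      1 * \1_B om * (fwdW P T (W1 m) (sigma_ m) (t + h) om - fwdW P T (W1 m) (sigma_ m) t om) /\
    fwdW P T (W2 m) X2 T om = 0 * \1_B om * (fwdW P T (W2 m) sqrt_b (t + h) om - fwdW P T (W2 m) sqrt_b t om)}.
  by move: hW1 hW2; apply: filterS2 => om h1 h2; split.
have hJ : {ae P, forall om, fwdN P T (N1 m) (G1 m) Un (dlog_jump1 m us alpha) T om
      + \int[leb]_(s in `[0, T]) \int[G1 m]_(z in R0) K1 s z om =
      1 * \1_B om * (jumps1 (t + h) om - jumps1 t om) /\
    fwdN P T (N2 m) (G2 m) Un (dlog_jump2 m us alpha) T om
      + \int[leb]_(s in `[0, T]) \int[G2 m]_(z in R0) K2 s z om =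
      0 * \1_B om * (jumps2 (t + h) om - jumps2 t om)}.
  by move: hJ1 hJ2; apply: filterS2 => om h1 h2; split.
move: hD hW hJ; apply: filterS3 => om e1 [e2 e3] [e4 e5].
rewrite !m1E; exact: (combine_increments1 e1 e2 e3 e4 e5).
Qed.

(** As for the first control. The noise [W1] enters with the coefficient - rho b
    and the jumps of [N2] with the sign - 1. *)
Lemma dlog_return_unit_kappa : {ae P, forall om,
  dlog_return m us (indicator_strategy set0 B t h) om =
  \1_B om * (m2 m us (t + h) om - m2 m us t om)}.
Proof.
pose alpha := indicator_strategy set0 B t h.
pose Bt (om : Om) s : R := \1_B om * \1_(`]t, t + h]%classic) s.
have [[[_ calpha] [_ s1 s2] _ _ _] [_ [_ _ j1] [_ _ j2] _ _]] := hA1 t0 h0 thT (H0_set0 tT) HB.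
pose X1 s om := sigma_ m s om * alpha.1 s om - rho m * b_ m s om * alpha.2 s om.
pose X2 s om := Num.sqrt (1 - rho m ^+ 2) * b_ m s om * alpha.2 s om.
pose K1 s z om := dlog_jump1 m us alpha s z om - alpha.1 s om * gamma1 m s z om.
pose K2 s z om := dlog_jump2 m us alpha s z om + alpha.2 s om * gamma2 m s z om.
have X1E s om : X1 s om = -1 * Bt om s * rho_b s om.
  by rewrite /X1 ind20 ind2 mulr0 sub0r !mulN1r mulNr mulrC.
have X2E s om : X2 s om = 1 * Bt om s * sqrt_b s om by rewrite /X2 ind2 mul1r mulrC.
have J1E s z om : dlog_jump1 m us alpha s z om = 0 * Bt om s * ratio1 s z om.
  by rewrite /dlog_jump1 ind20 !mul0r.
have K1E s z om : K1 s z om = 0 * Bt om s * jump_ratio_excess (gamma1 m) pi s z om.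
  by rewrite /K1 J1E ind20 !mul0r subr0.
have J2E s z om : dlog_jump2 m us alpha s z om = -1 * Bt om s * ratio2 s z om.
  by rewrite /dlog_jump2 ind2 /jump_ratio /mkappa !mulN1r !mulNr mulrA.
have K2E s z om : K2 s z om = -1 * Bt om s * jump_ratio_excess (gamma2 m) mkappa s z om.
  by rewrite /K2 J2E ind2 /jump_ratio_excess mulrBr !mulN1r !mulNr opprK.
have DE s om : dlog_drift m us alpha s om = Bt om s * drift2 s om.
  by rewrite /dlog_drift /drift2 ind20 ind2 -/pi -/kappa /Bt; ring.
have ib : {ae P, forall om, leb.-integrable `[0, T] (EFin \o (fun s => b_ m s om * alpha.2 s om))}.
  case: s1 => _ + _; apply: filterS => om fin; apply/integrableP; split => //.
  apply/measurable_EFinP; apply: measurable_funM.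
    exact: (progressive_path T0 om (progressive_caglad b_caglad)).
  exact: (progressive_path T0 om (progressive_caglad calpha)).
have Y1 : exists I, fwdW_spec P T (W1 m) X1 I.
  rewrite (_ : X1 = (fun s om => - rho m * (b_ m s om * alpha.2 s om))).
    by apply: (fwdW_scale T0 W1_continuous _ _ ib); case: s1.
  by apply/funext => s; apply/funext => om; rewrite /X1 ind20 mulr0 sub0r mulNr -!mulrA.
have Y2 : exists I, fwdW_spec P T (W2 m) X2 I.
  rewrite (_ : X2 = (fun s om => Num.sqrt (1 - rho m ^+ 2) * (b_ m s om * alpha.2 s om))).
    by apply: (fwdW_scale T0 W2_continuous _ _ ib); case: s2.
  by apply/funext => s; apply/funext => om; rewrite /X2 -!mulrA.
have hW1 := fwdW_indicator T0 W1_continuous t0 tt' thT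
  X1E (scale_caglad _ b_caglad).1 (scale_integrable _ b_integrable) int_rho_b Y1.
have hW2 := fwdW_indicator T0 W2_continuous t0 tt' thT
  X2E (scale_caglad _ b_caglad).1 (scale_integrable _ b_integrable) int_sqrt_b Y2.
have hJ1 := jump_part_increment T0 measurable_exhaust exhaust_nonzero N1_integer N1_finite
  (poisson_time0 poisson1) gamma1_progressive ppi pos1 spec1 loc1 exc1 t0 tt' thT J1E K1E j1.
have hJ2 := jump_part_increment T0 measurable_exhaust exhaust_nonzero N2_integer N2_finite
  (poisson_time0 poisson2) gamma2_progressive pmkappa pos2 spec2 loc2 exc2 t0 tt' thT J2E K2E j2.
have hD : {ae P, forall om, \int[leb]_(s in `[0, T]) dlog_drift m us alpha s om =
    \1_B om * (\int[leb]_(s in `[0, t + h]) drift2 s om - \int[leb]_(s in `[0, t]) drift2 s om)}.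
  by move: drift2_integrable; apply: filterS => om iD; exact: drift_increment.
have hW : {ae P, forall om, fwdW P T (W1 m) X1 T om =
      -1 * \1_B om * (fwdW P T (W1 m) rho_b (t + h) om - fwdW P T (W1 m) rho_b t om) /\
    fwdW P T (W2 m) X2 T om = 1 * \1_B om * (fwdW P T (W2 m) sqrt_b (t + h) om - fwdW P T (W2 m) sqrt_b t om)}.
  by move: hW1 hW2; apply: filterS2 => om h1 h2; split.
have hJ : {ae P, forall om, fwdN P T (N1 m) (G1 m) Un (dlog_jump1 m us alpha) T om
      + \int[leb]_(s in `[0, T]) \int[G1 m]_(z in R0) K1 s z om =
      0 * \1_B om * (jumps1 (t + h) om - jumps1 t om) /\
    fwdN P T (N2 m) (G2 m) Un (dlog_jump2 m us alpha) T om
      + \int[leb]_(s in `[0, T]) \int[G2 m]_(z in R0) K2 s z om =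
      -1 * \1_B om * (jumps2 (t + h) om - jumps2 t om)}.
  by move: hJ1 hJ2; apply: filterS2 => om h1 h2; split.
move: hD hW hJ; apply: filterS3 => om e1 [e2 e3] [e4 e5].
rewrite !m2E//; exact: (combine_increments2 e1 e2 e3 e4 e5).
Qed.

End increments_as_derivatives.

End market_facts.

(** * Martingales under the optimal pricing measure *)

Theorem theorem4p3 (R : realType) (d : measure_display) (Om : measurableType d)
    (m : market R Om)
    (U : R -> R) (g : R -> R * R * R * R -> Om -> R)
    (eps : prior -> R -> Om -> R) (Qp : prior -> probability Om R)
    (A1' : set strategy) (A2' : set prior) (us : strategy) (vs : prior)
    (F : R -> Om -> R)
    (P := pr m) (T := horizon m) (H := filH m)
    (Z := fun om => eps vs T om * derive1 U (wealth m us T om) * wealth m us T om) :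
  noise_axioms m -> information_axioms m -> coefficient_axioms m ->
  utility U -> penalty m g ->
  (forall v, A2 m v -> prior_density m v (eps v) (Qp v)) ->
  admissible_strategies m U A1' -> admissible_priors m g eps A2' ->
  optimal_pair (payoff m U g eps) A1' A2' us vs ->
  u_regular m U A1' us (eps vs) ->
  (forall s, 0 <= s <= T ->
     is_cond_exp P (H s) (fun om => Z om / fine ('E_P[Z])) (F s)) ->
  exists Q : probability Om R,
    [/\ forall B, measurable B -> Q B = (\int[P]_(om in B) (F T om)%:E)%E,
        P `<< Q /\ Q `<< P,
        martingale Q T H (m1 m us)
      & martingale Q T H (m2 m us)].
Proof.
move=> hn hi hc hU hpen hE adm1 adm2 opt reg hF.
have T_gt0 : 0 < T := horizon_gt0 hn.
have T0 := ltW T_gt0.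
have uH : usual_filtration P T H := market_usual hi.
have X00 : 0 < X0 m by case: hc => -[_].
have A2vs : A2 m vs by case: opt => -[_ /adm2[]].
have hEv := hE vs A2vs.
have A1us : A1 m us by case: opt => -[/adm1[]].
have HsetT t : 0 <= t <= T -> H t setT.
  by move=> tT; case: (usual_sigma_algebra uH tT) => h0 hC _; rewrite -(setD0 setT); exact: hC.
have Hset0 t : 0 <= t <= T -> H t set0.
  by move=> tT; case: (usual_sigma_algebra uH tT).
have bind B1 B2 t h : bounded_strategy m (indicator_strategy B1 B2 t h).
  exists 1 => s om _; rewrite /indicator_strategy /= !normrM !indicE !normr_nat -!natrM.
  by split; rewrite (ler_nat _ _ 1); do 2 case: (_ \in _).
have foc t h B1 B2 : 0 <= t -> 0 < h -> t + h <= T -> H t B1 -> H t B2 ->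
    [/\ A1 m (indicator_strategy B1 B2 t h), dlog_integrable m us (indicator_strategy B1 B2 t h),
      P.-integrable setT (EFin \o (fun om => Z om * dlog_return m us (indicator_strategy B1 B2 t h) om))
    & (\int[P]_om (Z om * dlog_return m us (indicator_strategy B1 B2 t h) om)%:E = 0)%E].
  move=> t0 h0 thT H1 H2; have A1i := reg.2 t h B1 B2 t0 h0 thT H1 H2.
  have [] := first_order_condition T_gt0 uH X00 hU hpen hEv adm1 adm2 opt reg A1i (bind B1 B2 t h).
  by move=> di [iZ Z0]; split => //; case: (adm1 _ A1i).
have hA1 t h B1 B2 : 0 <= t -> 0 < h -> t + h <= T -> H t B1 -> H t B2 ->
    A1 m (indicator_strategy B1 B2 t h) /\ dlog_integrable m us (indicator_strategy B1 B2 t h).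
  by move=> t0 h0 thT H1 H2; have [] := foc t h B1 B2 t0 h0 thT H1 H2.
have TT : 0 <= T <= T by rewrite T0 lexx.
have I0 : 0 <= (0 : R) <= T by rewrite lexx.
have Zpos : {ae P, forall om, 0 < Z om}.
  move: (prior_density_gt0 T_gt0 hEv); apply: filterS => om e0.
  have w0 : 0 < wealth m us T om by rewrite mulr_gt0// expR_gt0.
  by apply: mulr_gt0 => //; apply: mulr_gt0 => //; exact: (utility_derive_gt0 hU w0).
have iZ : P.-integrable setT (EFin \o Z).
  apply: (integrable_marginal_utility T_gt0 uH X00 hU hpen hEv adm1 adm2 opt reg _ (bind set0 set0 0 T)).
  by apply: (reg.2 0 T) => //; [rewrite add0r|exact: Hset0|exact: Hset0].
have mZ : measurable_fun setT Z by case/integrableP: iZ => /measurable_EFinP.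
pose c := fine ('E_P[Z]).
have EZ : (\int[P]_om (Z om)%:E = c%:E)%E.
  rewrite /c unlock fineK//; exact: integrable_fin_num.
have c0 : 0 < c.
  have absZ : (\int[P]_om `|(Z om)%:E| = c%:E)%E.
    rewrite -EZ; apply: ae_eq_integral => //; first by apply: measurableT_comp => //; exact/measurable_EFinP.
      exact/measurable_EFinP.
    by move: Zpos; apply: filterS => om z0 _; rewrite gee0_abs// lee_fin ltW.
  have c_ge0 : 0 <= c by rewrite -lee_fin -absZ; exact: integral_ge0.
  rewrite lt_neqAle c_ge0 andbT eq_sym; apply/negP => /eqP c0.
  have mEZ : measurable_fun setT (EFin \o Z) by exact/measurable_EFinP.
  move: absZ; rewrite c0 => /(ae_eq_integral_abs P measurableT mEZ) Z0.
  have [A [mA PA0 hA]] : {ae P, forall om : Om, False}.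
    by move: Z0 Zpos; apply: filterS2 => om /(_ Logic.I) [->]; rewrite ltxx.
  have AT : A = setT by apply/seteqP; split=> // om _; exact: hA.
  by move: PA0; rewrite AT probability_setT => /eqP; rewrite onee_eq0.
pose D om := Z om / c.
have D0 : {ae P, forall om, 0 < D om}.
  by move: Zpos; apply: filterS => om z0; rewrite divr_gt0.
have D1 : (\int[P]_om (D om)%:E = 1)%E.
  rewrite /D; under eq_integral do rewrite mulrC EFinM.
  by rewrite integralZl// EZ -EFinM mulVf// gt_eqF.
have [Q [QF QP QD]] := change_of_measure T0 uH D0 D1 (hF T TT).
(* [ind B t h] raises the control that belongs to [M] by 1 on ]t, t + h] and B. Besides
   the increments, the case B = setT, t = 0 gives the integrability of [M t]. *)
have crit (M : R -> Om -> R) (ind : set Om -> R -> R -> strategy) :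
    (forall t, 0 <= t <= T -> S_measurable (H t) (M t)) ->
    {ae P, forall om, M 0 om = 0} ->
    (forall B t h, 0 <= t -> 0 < h -> t + h <= T -> H t B ->
      [/\ {ae P, forall om, dlog_return m us (ind B t h) om = \1_B om * (M (t + h) om - M t om)},
        P.-integrable setT (EFin \o (fun om => Z om * dlog_return m us (ind B t h) om))
      & (\int[P]_om (Z om * dlog_return m us (ind B t h) om)%:E = 0)%E]) ->
    martingale Q T H M.
  move=> aM M0 hM.
  apply: (martingale_change_of_measure T0 uH D0 (hF T TT) QD aM).
  - have mDM r : 0 <= r <= T -> measurable_fun setT (fun om => D om * M r om).
      move=> rT; apply: measurable_funM; first exact: measurable_funM.
      exact: (S_measurable_measurable (usual_sigma_algebra uH rT) (@usual_measurable _ _ _ _ _ _ uH r rT) (aM r rT)).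
    move=> t tT; have /andP[t0 tT'] := tT; have [tz|tz] := eqVneq t 0.
      have i0 : P.-integrable setT (EFin \o (fun _ : Om => 0 : R)) by exact: integrable0.
      apply: ae_eq_integrable i0 => //; first by apply/measurable_EFinP; exact: mDM.
      by move: M0; apply: filterS => om e _; rewrite /= tz e mulr0.
    have t_gt0 : 0 < t by rewrite lt_neqAle eq_sym tz.
    have tT0 : 0 + t <= T by rewrite add0r.
    have [dE dI _] := hM setT 0 t (lexx _) t_gt0 tT0 (HsetT 0 I0).
    have dI' := integrableZl measurableT c^-1 dI.
    apply: ae_eq_integrable dI' => //; first by apply/measurable_EFinP; exact: mDM.
    move: dE M0; apply: filterS2 => om e1 e2 _ /=.
    by rewrite e1 e2 indicT mul1r subr0 add0r -EFinM /D mulrA (mulrC c^-1).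
  - move=> s t A s0 st tT HA; have [->|s_t] := eqVneq s t.
      by under eq_integral do rewrite subrr mulr0 mulr0; rewrite integral0.
    have h0 : 0 < t - s by rewrite subr_gt0 lt_neqAle s_t.
    have [|dE dI d0] := hM A s (t - s) s0 h0 _ HA; first by rewrite subrKC.
    have mDM r : 0 <= r <= T -> measurable_fun setT (M r).
      by move=> rT; exact: (S_measurable_measurable (usual_sigma_algebra uH rT)
        (@usual_measurable _ _ _ _ _ _ uH r rT) (aM r rT)).
    have dI' := integrableZl measurableT c^-1 dI.
    transitivity (c^-1%:E * \int[P]_om (Z om * dlog_return m us (ind A s (t - s)) om)%:E)%E; last first.
      by rewrite d0 mule0.
    rewrite -(integralZl measurableT dI); apply: ae_eq_integral => //.
    - apply/measurable_EFinP; apply: measurable_funM; first exact: measurable_funM.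
      apply: measurable_funM.
        by apply: measurable_indic; apply: (usual_measurable uH _ HA); rewrite s0 (le_trans st).
      apply: measurable_funB; apply: mDM; first by rewrite (le_trans s0 st).
      by rewrite s0 (le_trans st).
    - by case/integrableP: dI'.
    - move: dE; apply: filterS => om e _ /=.
      by rewrite e -EFinM /D subrKC; congr (_%:E); rewrite [RHS]mulrA (mulrC c^-1).
have mart1 : martingale Q T H (m1 m us).
  apply: (crit _ (fun B => indicator_strategy B set0)).
  - exact: (m1_adapted hn hi hc A1us hA1).
  - exact: (m1_at0 hn hi hc A1us hA1).
  - move=> B t h t0 h0 thT HB.
    have tT : 0 <= t <= T by rewrite t0 (le_trans _ thT)// lerDl ltW.
    have [_ _ i e] := foc t h B set0 t0 h0 thT HB (Hset0 t tT); split => //.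
    exact: (dlog_return_unit_pi hn hi hc A1us hA1).
have mart2 : martingale Q T H (m2 m us).
  apply: (crit _ (fun B => indicator_strategy set0 B)).
  - exact: (m2_adapted hn hi hc A1us hA1).
  - exact: (m2_at0 hn hi hc A1us hA1).
  - move=> B t h t0 h0 thT HB.
    have tT : 0 <= t <= T by rewrite t0 (le_trans _ thT)// lerDl ltW.
    have [_ _ i e] := foc t h set0 B t0 h0 thT (Hset0 t tT) HB; split => //.
    exact: (dlog_return_unit_kappa hn hi hc A1us hA1).
by exists Q.
Qed.
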